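(* Let $\Omega\subseteq\mathbb R^d$ be open, $m\in\mathbb N$, $l\in\{0,\dots,m\}$, and let $u_n\rightharpoonup 0$ weakly in $L^2_{\rm loc}(\Omega;\mathbb C^r)$ satisfy $$\sum_{l\le|\alpha|\le m}\varepsilon_n^{|\alpha|-l}\,\partial_\alpha(A_n^\alpha u_n)=f_n\quad\text{in }\Omega,$$ where $(\varepsilon_n)$ is a bounded sequence of positive numbers, $A_n^\alpha\in C(\Omega;\mathrm M_{q\times r}(\mathbb C))$, $A_n^\alpha\to A^\alpha$ locally uniformly on $\Omega$ for every multi-index $\alpha$ with $l\le|\alpha|\le m$, and $(f_n)$ is a sequence in $H^{-m}_{\rm loc}(\Omega;\mathbb C^q)$ such that for every $\varphi\in C_c^\infty(\Omega)$ $$\frac{\widehat{\varphi f_n}}{1+\sum_{s=l}^m\varepsilon_n^{s-l}|\xi|^s}\longrightarrow 0\quad\text{strongly in }L^2(\mathbb R^d;\mathbb C^q).$$ Let $(\omega_n)$ be a sequence of positive numbers with $\omega_n\to0^+$ such that $c:=\lim_n\varepsilon_n/\omega_n$ exists in $[0,\infty]$, and let $\mu$ be the one-scale H-measure with characteristic length $(\omega_n)$ associated to (a subsequence of) $(u_n)$. Then $$p_c\,\mu^\top=0\quad\text{on }\Omega\times \mathrm K_{0,\infty}(\mathbb R^d),$$ where (a) if $c=0$: $\displaystyle p_0(x,\xi)=\sum_{|\alpha|=l}(2\pi i)^l\frac{\xi^\alpha}{|\xi|^l+|\xi|^m}A^\alpha(x)$; (b) if $c\in(0,\infty)$: $\displaystyle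 p_c(x,\xi)=\sum_{l\le|\alpha|\le m}(2\pi i c)^{|\alpha|}\frac{\xi^\alpha}{|\xi|^l+|\xi|^m}A^\alpha(x)$; (c) if $c=\infty$: $\displaystyle p_\infty(x,\xi)=\sum_{|\alpha|=m}(2\pi i)^m\frac{\xi^\alpha}{|\xi|^l+|\xi|^m}A^\alpha(x)$.
   Context: Conventions: functions on $\Omega$ are extended by zero to $\mathbb R^d$; $\hat u(\xi)=\int_{\mathbb R^d}e^{-2\pi i x\cdot\xi}u(x)\,dx$; $(a\otimes b)_{ij}=a_i\overline{b_j}$. $f\in H^{-m}_{\rm loc}(\Omega)$ means $\varphi f\in H^{-m}(\mathbb R^d)$ for all $\varphi\in C_c^\infty(\Omega)$. Compactification: $\mathrm K_{0,\infty}(\mathbb R^d)$ is the compactification of $\mathbb R^d\setminus\{0\}$ obtained by adjoining a unit sphere $\Sigma_0=\{0^e:e\in S^{d-1}\}$ at the origin and a unit sphere $\Sigma_\infty=\{\infty^e:e\in S^{d-1}\}$ at infinity, with the topology of $S^{d-1}\times[0,\infty]$ (the point $re$ corresponds to $(e,r)$, $0^e$ to $(e,0)$, $\infty^e$ to $(e,\infty)$). Thus $C(\mathrm K_{0,\infty}(\mathbb R^d))$ is identified with the space of continuous $\psi$ on $\mathbb R^d\setminus\{0\}$ for which there are $\psi_0,\psi_\infty\in C(S^{d-1})$ with $\psi(\xi)-\psi_0(\xi/|\xi|)\to0$ as $|\xi|\to0$ and $\psi(\xi)-\psi_\infty(\xi/|\xi|)\to0$ as $|\xi|\to\infty$; then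 $\psi(0^e)=\psi_0(e)$, $\psi(\infty^e)=\psi_\infty(e)$. The functions $\xi\mapsto\xi^\alpha/(|\xi|^l+|\xi|^m)$, $l\le|\alpha|\le m$, belong to $C(\mathrm K_{0,\infty}(\mathbb R^d))$ and are understood as extended by continuity to $\Sigma_0\cup\Sigma_\infty$. One-scale H-measure: if $u_n\rightharpoonup0$ in $L^2_{\rm loc}(\Omega;\mathbb C^r)$ and $\omega_n\to0^+$, then, after passing to a subsequence, there is a (unique) $r\times r$ hermitian non-negative matrix Radon measure $\mu$ on $\Omega\times\mathrm K_{0,\infty}(\mathbb R^d)$ such that for all $\varphi_1,\varphi_2\in C_c(\Omega)$, $\psi\in C(\mathrm K_{0,\infty}(\mathbb R^d))$, $$\lim_n\int_{\mathbb R^d}\big(\widehat{\varphi_1u_n}(\xi)\otimes\widehat{\varphi_2u_n}(\xi)\big)\psi(\omega_n\xi)\,d\xi=\int_{\Omega\times\mathrm K_{0,\infty}(\mathbb R^d)}\varphi_1(x)\overline{\varphi_2(x)}\psi(\xi)\,d\bar\mu(x,\xi),$$ where $\bar\mu$ is the entrywise complex conjugate. $\mu$ is called the one-scale H-measure with characteristic length $(\omega_n)$ associated to the (sub)sequence. *)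

(* Defs.v *)
From HB Require Import structures.
From mathcomp Require Import all_boot all_order all_algebra.
From mathcomp Require Import all_classical all_reals all_analysis.
From mathcomp.real_closed Require Export complex.

Set Implicit Arguments.
Unset Strict Implicit.
Unset Printing Implicit Defensive.
Import Order.TTheory GRing.Theory Num.Theory.
Import numFieldNormedType.Exports.
Local Open Scope classical_set_scope.
Local Open Scope complex_scope.
Local Open Scope ring_scope.

(* R^d is 'rV[R]_d with the sigma-algebra generated by the coordinates, i.e.
   its Borel sigma-algebra. *)
Definition rV_display : measure_display -> measure_display.
Proof. exact. Qed.

Section rV_measurable.
Context (R : realType) (d : nat).

Definition rV_sigma : set (set 'rV[R]_d) :=
  g_sigma_preimage (fun i (x : 'rV[R]_d) => x ord0 i : R).

Let rV_sigma0 : rV_sigma set0.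
Proof. exact: sigma_algebra0. Qed.

Let rV_sigmaC A : rV_sigma A -> rV_sigma (~` A).
Proof. exact: sigma_algebraC. Qed.

Let rV_sigma_bigcup (F : (set 'rV[R]_d)^nat) :
  (forall i, rV_sigma (F i)) -> rV_sigma (\bigcup_i F i).
Proof. exact: sigma_algebra_bigcup. Qed.

HB.instance Definition _ := @isMeasurable.Build
  (rV_display default_measure_display) 'rV[R]_d rV_sigma
  rV_sigma0 rV_sigmaC rV_sigma_bigcup.
End rV_measurable.

Lemma measurable_rV_coord (R : realType) d (i : 'I_d) :
  measurable_fun [set: 'rV[R]_d] (fun x : 'rV[R]_d => x ord0 i).
Proof.
move=> _ Y mY; rewrite setTI; apply: sub_sigma_algebra => /=.
rewrite -bigcup_seq/=; exists i => /=; first by rewrite mem_index_enum.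
by exists Y => //; rewrite setTI.
Qed.

Lemma measurable_fun_rV (R : realType) d0 (T : measurableType d0) d
    (f : T -> 'rV[R]_d) :
  (forall i, measurable_fun [set: T] (fun t => f t ord0 i)) ->
  measurable_fun [set: T] f.
Proof.
move=> mf _ A; rewrite setTI; move: A.
suff : @measurable _ 'rV[R]_d `<=` image_set_system setT f measurable.
  by move=> + A mA => /(_ A mA); rewrite /image_set_system /= setTI.
apply: smallest_sub; first exact/sigma_algebra_image/sigma_algebra_measurable.
elim/big_ind : _ => [//|X Y hX hY|i _]; first by rewrite subUset.
move=> A [B mB <-]; rewrite /image_set_system /= setTI setTI.
by rewrite -[_ @^-1` _]setTI; exact: mf.
Qed.

Section rV_cons.
Context (R : realType) (d : nat).

Definition rV_cons (p : R * 'rV[R]_d) : 'rV[R]_d.+1 :=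
  \row_i (if unlift ord0 i is Some j then p.2 ord0 j else p.1).

Lemma measurable_rV_cons : measurable_fun [set: R * 'rV[R]_d] rV_cons.
Proof.
apply: measurable_fun_rV => i.
under eq_fun do rewrite mxE.
case: unliftP => [j _|_]; last exact: measurable_fst.
exact: (measurableT_comp (measurable_rV_coord j) measurable_snd).
Qed.

Variable mu : {sigma_finite_measure set 'rV[R]_d -> \bar R}.

Definition leb_step : set 'rV[R]_d.+1 -> \bar R :=
  pushforward (@lebesgue_measure R \x mu)%E rV_cons.


Let step_preim A : measurable A -> measurable (rV_cons @^-1` A).
Proof. by move=> mA; rewrite -[_ @^-1` _]setTI; exact: measurable_rV_cons. Qed.

Let step0 : leb_step set0 = 0%E.
Proof. by rewrite /leb_step /pushforward preimage_set0 measure0. Qed.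

Let step_ge0 A : (0 <= leb_step A)%E.
Proof. by rewrite /leb_step /pushforward measure_ge0. Qed.

Let step_sigma_additive : semi_sigma_additive leb_step.
Proof.
move=> F mF tF mUF; rewrite /leb_step /pushforward preimage_bigcup.
apply: measure_semi_sigma_additive.
- by move=> n; exact: step_preim.
- apply/trivIsetP => /= i j _ _ ij; rewrite -preimage_setI.
  by move/trivIsetP : tF => /(_ _ _ _ _ ij) ->//; rewrite preimage_set0.
- by rewrite -preimage_bigcup; exact: step_preim.
Qed.

HB.instance Definition _ := isMeasure.Build _ _ _ leb_step
  step0 step_ge0 step_sigma_additive.

Let step_sigma_finite : sigma_finite setT leb_step.
Proof.
pose hd (x : 'rV[R]_d.+1) : R := x ord0 ord0.
pose tl (x : 'rV[R]_d.+1) : 'rV[R]_d := \row_j x ord0 (lift ord0 j).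
have mhd : measurable_fun setT hd by exact: measurable_rV_coord.
have mtl : measurable_fun setT tl.
  by apply: measurable_fun_rV => i; under eq_fun do rewrite mxE;
    exact: measurable_rV_coord.
pose ht x := (hd x, tl x).
have mht : measurable_fun setT ht by exact/measurable_fun_pairP.
have htK p : ht (rV_cons p) = p.
  case: p => a v; rewrite /ht /hd /tl; congr pair.
    by rewrite mxE unlift_none.
  by apply/rowP => j; rewrite !mxE liftK.
have /sigma_finiteP[F [TF ndF Foo]] := sigma_finiteT (@lebesgue_measure R).
have /sigma_finiteP[G [TG ndG Goo]] := sigma_finiteT mu.
exists (fun n => ht @^-1` (F n `*` G n)).
  apply/esym/seteqP; split=> // x _.
  have [n _ Fn] : (\bigcup_n F n) (hd x) by rewrite -TF.
  have [k _ Gk] : (\bigcup_n G n) (tl x) by rewrite -TG.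
  exists (maxn n k) => //; split.
  - have /subsetPset : (F n <= F (maxn n k))%O by exact/ndF/leq_maxl.
    exact.
  - have /subsetPset : (G k <= G (maxn n k))%O by exact/ndG/leq_maxr.
    exact.
move=> n; have [mF Fn] := Foo n; have [mG Gn] := Goo n; split.
  by rewrite -[_ @^-1` _]setTI; apply: mht => //; exact: measurableX.
rewrite /leb_step /pushforward.
have -> : rV_cons @^-1` (ht @^-1` (F n `*` G n)) = F n `*` G n.
  by apply/funext => p; rewrite -[RHS](congr1 (F n `*` G n) (htK p)).
by rewrite product_measure1E// lte_mul_pinfty// ge0_fin_numE.
Qed.

HB.instance Definition _ := Measure_isSigmaFinite.Build _ _ _ leb_step
  step_sigma_finite.
End rV_cons.

Section lebesgue_rV.
Context (R : realType).

(* Lebesgue measure on R^d, as an iterated product of the one-dimensional one. *)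
Fixpoint lebesgue_rV (d : nat) :
    {sigma_finite_measure set 'rV[R]_d -> \bar R} :=
  if d is d'.+1 then [the sigma_finite_measure _ _ of leb_step (lebesgue_rV d')]
  else [the sigma_finite_measure _ _ of @dirac _ 'rV[R]_0 0 R].
End lebesgue_rV.

Section function_spaces.
Context (R : realType) (d : nat).
Local Notation C := R[i].
Local Notation E := 'rV[R]_d.
Local Notation leb := (lebesgue_rV R d).
Implicit Types (Omega K : set E) (f g phi theta eta : E -> C).

Definition dotr (x y : E) : R := \sum_i x ord0 i * y ord0 i.

(* The canonical norm of 'rV[R]_d is the sup norm; |xi| is the Euclidean one. *)
Definition enorm (x : E) : R := Num.sqrt (\sum_i x ord0 i ^+ 2).

(* |z| as an element of R, the norm `|z| being an element of R[i]. *)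
Definition cmod (z : C) : R := complex.Re `|z|.

Definition cmeasurable f :=
  measurable_fun [set: E] (@complex.Re R \o f) /\
  measurable_fun [set: E] (@complex.Im R \o f).

Definition cintegrable f :=
  leb.-integrable [set: E] (EFin \o @complex.Re R \o f) /\
  leb.-integrable [set: E] (EFin \o @complex.Im R \o f).

Definition cint f : C :=
  (\int[leb]_x complex.Re (f x))%R +i* (\int[leb]_x complex.Im (f x))%R.

Definition L2 f :=
  cmeasurable f /\ (\int[leb]_x (cmod (f x) ^+ 2)%:E < +oo)%E.

Definition vanishes_off K (r : nat) (v : E -> 'cV[C]_r) :=
  forall x, ~ K x -> v x = 0.

Definition compactly_supported_in Omega f :=
  exists K, [/\ compact K, K `<=` Omega & forall x, ~ K x -> f x = 0].

(* Functions on Omega are functions on R^d whose values off Omega are never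
   used: every occurrence is multiplied by a function supported in Omega. *)
Definition L2loc Omega (r : nat) (u : E -> 'cV[C]_r) :=
  forall K, compact K -> K `<=` Omega ->
  forall j, L2 (fun x => (\1_K x)%:C * u x j ord0).

(* Weak convergence to 0 in the Frechet space L2loc, tested on its dual, the
   space of L2 functions with compact support in Omega. *)
Definition weakly_null_L2loc Omega (r : nat) (u : nat -> E -> 'cV[C]_r) :=
  (forall n, L2loc Omega (u n)) /\
  forall K (v : E -> 'cV[C]_r), compact K -> K `<=` Omega ->
    (forall j, L2 (fun x => v x j ord0)) -> vanishes_off K v ->
    (fun n => cint (fun x => \sum_j u n x j ord0 * conjc (v x j ord0)) : C^o)
      @ \oo --> (0 : C^o).

Definition Cc Omega phi :=
  continuous (phi : E -> C^o) /\ compactly_supported_in Omega phi.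

Definition cpartial (i : 'I_d) f : E -> C := fun x =>
  ('D_(delta_mx ord0 i : E) (@complex.Re R \o f : E -> R) x) +i*
  ('D_(delta_mx ord0 i : E) (@complex.Im R \o f : E -> R) x).

Definition cpartials (s : seq 'I_d) f : E -> C := foldr cpartial f s.

Definition csmooth f := forall s : seq 'I_d,
  continuous (cpartials s f : E -> C^o) /\
  forall i x,
    derivable (@complex.Re R \o cpartials s f : E -> R) x (delta_mx ord0 i : E) /\
    derivable (@complex.Im R \o cpartials s f : E -> R) x (delta_mx ord0 i : E).

Definition Ccinf Omega phi :=
  csmooth phi /\ compactly_supported_in Omega phi.

Definition schwartz eta :=
  csmooth eta /\
  forall (k : nat) (s : seq 'I_d), exists M : R, forall x,
    (1 + enorm x) ^+ k * cmod (cpartials s eta x) <= M.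

Definition expi (t : R) : C := cos t +i* sin t.

Definition fourier f : E -> C :=
  fun xi => cint (fun x => expi (- (2 * pi * dotr x xi)) * f x).

End function_spaces.

Section distributions.
Context (R : realType) (d : nat).
Local Notation C := R[i].
Local Notation E := 'rV[R]_d.
Local Notation leb := (lebesgue_rV R d).
Local Notation functional := ((E -> C) -> C).
Implicit Types (Omega K : set E) (f g phi theta eta : E -> C) (T : functional).

(* Multi-indices with entries at most m: every alpha with |alpha| <= m is one of
   them, and the sums over l <= |alpha| <= m become finite. *)
Definition multiindex (m : nat) := {ffun 'I_d -> 'I_m.+1}.

Definition mlen (m : nat) (a : multiindex m) : nat := (\sum_i a i)%N.

Definition mpow (m : nat) (a : multiindex m) (xi : E) : R :=
  \prod_i xi ord0 i ^+ a i.

Definition mpartial (m : nat) (a : multiindex m) theta : E -> C :=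
  cpartials (flatten [seq nseq (a i) i | i <- enum 'I_d]) theta.

(* An element of D'(Omega) is a functional on all functions, of which only the
   values on Ccinf Omega matter. *)
Definition distribution Omega T :=
  (forall (a : C) theta1 theta2, Ccinf Omega theta1 -> Ccinf Omega theta2 ->
    T (fun x => a * theta1 x + theta2 x) = a * T theta1 + T theta2) /\
  forall K, compact K -> K `<=` Omega -> exists (N : nat) (M : R),
    forall theta (B : R), Ccinf Omega theta ->
      (forall x, ~ K x -> theta x = 0) ->
      (forall s : seq 'I_d, (size s <= N)%N ->
        forall x, cmod (cpartials s theta x) <= B) ->
      cmod (T theta) <= M * B.

Definition dist_of_fun (w : E -> C) : functional :=
  fun theta => cint (fun x => w x * theta x).

Definition dist_partial (m : nat) (a : multiindex m) T : functional :=
  fun theta => (-1) ^+ mlen a * T (mpartial a theta).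

Definition cutoff phi T : functional := fun eta => T (fun x => phi x * eta x).

(* The Fourier transform of the tempered distribution S is the function g. *)
Definition is_fourier (S : functional) g :=
  cmeasurable g /\
  forall eta, schwartz eta ->
    cintegrable (fun xi => g xi * eta xi) /\
    S (fourier eta) = cint (fun xi => g xi * eta xi).

(* S belongs to H^{-m}(R^d). *)
Definition Hneg (m : nat) (S : functional) :=
  exists2 g, is_fourier S g &
    (\int[leb]_xi (cmod (g xi) ^+ 2 / (1 + enorm xi ^+ 2) ^+ m)%:E < +oo)%E.

Definition Hneg_loc Omega (m : nat) T :=
  distribution Omega T /\
  forall phi, Ccinf Omega phi -> Hneg m (cutoff phi T).

(* For every cut-off phi, the Fourier transform of phi f_n divided by
   1 + sum_{s=l}^m eps_n^{s-l} |xi|^s tends to 0 strongly in L2(R^d; C^q). *)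
Definition weighted_null Omega (l m q : nat) (eps : nat -> R)
    (f : nat -> 'I_q -> functional) :=
  forall phi, Ccinf Omega phi ->
  exists g : nat -> 'I_q -> E -> C,
    (forall n i, is_fourier (cutoff phi (f n i)) (g n i)) /\
    (fun n => \int[leb]_xi
      (\sum_(i < q) (cmod (g n i xi) /
        (1 + \sum_(l <= s < m.+1) eps n ^+ (s - l) * enorm xi ^+ s)) ^+ 2)%:E)%E
      @ \oo --> 0%E.

Definition locally_uniform_cvg Omega (F : nat -> E -> C) (G : E -> C) :=
  forall K, compact K -> K `<=` Omega ->
    {uniform K, (F : nat -> E -> C^o) @ \oo --> (G : E -> C^o)}.

End distributions.

(* Complex Radon measures on a locally compact S are continuous linear
   functionals on Cc(S); elements of Cc(S) are represented by functions on the
   ambient space whose values off S are irrelevant. *)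
Section radon.
Context (R : realType) (T : topologicalType).
Local Notation C := R[i].
Implicit Types (S L : set T) (Phi : T -> C) (nu : (T -> C) -> C).

Definition supported_in S L Phi := forall z, S z -> ~ L z -> Phi z = 0.

Definition Cc_on S Phi :=
  {within S, continuous (Phi : T -> C^o)} /\
  exists L, [/\ compact L, L `<=` S & supported_in S L Phi].

Definition radon S nu :=
  (forall (a : C) Phi1 Phi2, Cc_on S Phi1 -> Cc_on S Phi2 ->
    nu (fun z => a * Phi1 z + Phi2 z) = a * nu Phi1 + nu Phi2) /\
  forall L, compact L -> L `<=` S -> exists M : R,
    forall Phi (B : R), Cc_on S Phi -> supported_in S L Phi ->
      (forall z, L z -> cmod (Phi z) <= B) -> cmod (nu Phi) <= M * B.

Definition conj_measure nu : (T -> C) -> C :=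
  fun Phi => conjc (nu (fun z => conjc (Phi z))).

Definition nonneg_hermitian_measure S (r : nat)
    (mu : 'I_r -> 'I_r -> (T -> C) -> C) :=
  [/\ forall j k, radon S (mu j k),
      forall j k Phi, Cc_on S Phi -> mu j k Phi = conj_measure (mu k j) Phi &
      forall Phi, Cc_on S Phi -> (forall z, S z -> 0 <= Phi z) ->
        forall v : 'cV[C]_r,
          0 <= \sum_j \sum_k v j ord0 * conjc (v k ord0) * mu j k Phi].

End radon.

Section one_scale.
Context (R : realType) (d : nat).
Local Notation C := R[i].
Local Notation E := 'rV[R]_d.
Local Notation KT := (E * \bar R)%type.
Implicit Types (Omega : set E).

(* K_{0,oo}(R^d) = S^{d-1} x [0, oo]: (e, 0) is 0^e, (e, +oo) is oo^e. *)
Definition K0oo : set KT := [set k | enorm k.1 = 1 /\ (0 <= k.2)%E].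

Definition K0oo_finite : set KT :=
  [set k | enorm k.1 = 1 /\ (0 < k.2 < +oo)%E].

Definition to_K0oo (xi : E) : KT := ((enorm xi)^-1 *: xi, (enorm xi)%:E).

Definition of_K0oo (k : KT) : E := fine k.2 *: k.1.

(* Extension by continuity to Sigma_0 and Sigma_oo of a function on
   R^d \ {0}. *)
Definition extend_K0oo (h : E -> R) (k : KT) : R :=
  lim ((h \o of_K0oo) @ within K0oo_finite (nbhs k)).

(* The values of psi off K0oo, which are only read at xi = 0, play no role. *)
Definition C_K0oo (psi : KT -> C) := {within K0oo, continuous (psi : KT -> C^o)}.

Definition one_scale_Hmeasure Omega (r : nat) (u : nat -> E -> 'cV[C]_r)
    (omega : nat -> R) (mu : 'I_r -> 'I_r -> (E * KT -> C) -> C) :=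
  nonneg_hermitian_measure (Omega `*` K0oo) mu /\
  forall phi1 phi2 psi, Cc Omega phi1 -> Cc Omega phi2 -> C_K0oo psi ->
  forall j k,
    (fun n => cint (fun xi =>
        fourier (fun x => phi1 x * u n x j ord0) xi *
        conjc (fourier (fun x => phi2 x * u n x k ord0) xi) *
        psi (to_K0oo (omega n *: xi))) : C^o)
      @ \oo -->
    (conj_measure (mu j k)
      (fun z => phi1 z.1 * conjc (phi2 z.1) * psi z.2) : C^o).

Definition weight (l m : nat) (a : multiindex d m) (xi : E) : R :=
  mpow a xi / (enorm xi ^+ l + enorm xi ^+ m).

(* sum over lo <= |alpha| <= hi of
     (2 pi i c)^|alpha| xi^alpha / (|xi|^l + |xi|^m) A^alpha(x). *)
Definition symbol (l m q r : nat) (lo hi : nat) (c : R)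
    (A : multiindex d m -> E -> 'M[C]_(q, r)) (x : E) (k : KT) : 'M[C]_(q, r) :=
  \sum_(a : multiindex d m | (lo <= mlen a <= hi)%N)
    ((0 +i* (2 * pi * c)) ^+ mlen a * (extend_K0oo (weight l a) k)%:C) *: A a x.

(* Entry (i, j) of the matrix measure p mu^T. *)
Definition mul_tr_measure (q r : nat) (p : E -> KT -> 'M[C]_(q, r))
    (mu : 'I_r -> 'I_r -> (E * KT -> C) -> C) (i : 'I_q) (j : 'I_r) :
    (E * KT -> C) -> C :=
  fun Phi => \sum_k mu j k (fun z => p z.1 z.2 i k * Phi z).

Definition mul_tr_measure_eq0 Omega (q r : nat) (p : E -> KT -> 'M[C]_(q, r))
    (mu : 'I_r -> 'I_r -> (E * KT -> C) -> C) :=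
  forall i j Phi, Cc_on (Omega `*` K0oo) Phi -> mul_tr_measure p mu i j Phi = 0.

End one_scale.

(* Main.v *)
(** Near a point of [Omega], multiply the equation by a smooth bump [phi]
supported in a small cube. By Leibniz' rule the Fourier transform of [phi f_n] is
[sum_a eps_n^(|a|-l) (2 pi i xi)^a F(phi A_n^a u_n)] plus terms of lower order in
[xi]. Divide by [1 + sum_s eps_n^(s-l) |xi|^s]: by hypothesis the left-hand side
tends to 0 in L2. Since [u_n] is bounded in L2 on compact sets, Plancherel's
inequality makes the lower-order terms O(1/rho) in L2 off the ball of radius [rho],
and on that ball [F(phi A_n^a u_n)] tends to 0 by weak convergence. Rescaling,
[lambda_n sum_a (2 pi i)^|a| (eps_n/omega_n)^(|a|-l) w_a(omega_n xi) F(phi A^a u_n)]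
tends to 0 in L2, where [w_a(xi) = xi^a / (|xi|^l + |xi|^m)] and [lambda_n] keeps the
coefficients bounded: [lambda_n = 1], [c^l] or [(omega_n/eps_n)^(m-l)] according as
[c = 0], [0 < c < oo] or [c = oo]. Pairing with the conjugate of [F(phi_2 u_n)], weighted
by [psi(omega_n xi)], gives in the limit the claim tested on tensor products
[phi(x) phi_2(x) psi(xi)]; these suffice, by a smooth partition of unity. *)

Require Import Defs.
From HB Require Import structures.
From mathcomp Require Import all_boot all_order all_algebra.
From mathcomp Require Import all_classical all_reals all_analysis.
From mathcomp Require Import measurable_realfun.
From mathcomp.real_closed Require Import complex.
From mathcomp Require Import ring lra.

Set Implicit Arguments.
Unset Strict Implicit.
Unset Printing Implicit Defensive.
Import Order.TTheory GRing.Theory Num.Theory.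
Import numFieldNormedType.Exports.
Local Open Scope classical_set_scope.
Local Open Scope complex_scope.
Local Open Scope ring_scope.

(** The Fourier transform [g] of [phi f_n] is known only through its pairings with Schwartz
    functions, so it is never identified pointwise with the smooth function [G] that Leibniz' rule
    gives. Equality of the pairings with smooth compactly supported functions is enough: duality
    bounds the weighted L2 norm of [G] by a multiple of that of [g]. The test functions contain the
    inverse weight, which must therefore be smooth; [Qsum], a polynomial in xi, replaces the square
    of the denominator, in general not smooth at the origin. Of Plancherel's theorem one inequality
    suffices, for functions vanishing off a unit cube, where it follows from Bessel's inequality for
    exponentials; hence the localising bumps have side at most 1. The three cases are one statement
    about the limits [kapl s] of [lambda_n (eps_n/omega_n)^(s-l)]: [lambda_n] makes these limits
    finite without all being zero. The transpose of [mu] appears because [mu] is hermitian. The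
    multipliers [w_a psi] are themselves continuous on the compactification, so no approximation in
    xi is needed. *)

Local Notation re := (@complex.Re _).
Local Notation im := (@complex.Im _).

(** * Complex-valued functions and integrals *)

Section complex_modulus.
Context {R : realType}.
Implicit Types (z w : R[i]).

Lemma reD z w : re (z + w) = re z + re w. Proof. by case: z w => [a b] []. Qed.
Lemma imD z w : im (z + w) = im z + im w. Proof. by case: z w => [a b] []. Qed.
Lemma reN z : re (- z) = - re z. Proof. by case: z. Qed.
Lemma imN z : im (- z) = - im z. Proof. by case: z. Qed.
Lemma reB z w : re (z - w) = re z - re w. Proof. by rewrite reD reN. Qed.
Lemma imB z w : im (z - w) = im z - im w. Proof. by rewrite imD imN. Qed.
Lemma reM z w : re (z * w) = re z * re w - im z * im w.
Proof. by case: z w => [a b] []. Qed.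
Lemma imM z w : im (z * w) = re z * im w + im z * re w.
Proof. by case: z w => [a b] []. Qed.
Lemma reJ z : re (conjc z) = re z. Proof. by case: z. Qed.
Lemma imJ z : im (conjc z) = - im z. Proof. by case: z. Qed.

Lemma complex_eqP z w : re z = re w -> im z = im w -> z = w.
Proof. by case: z w => [a b] [c e] /= -> ->. Qed.

Lemma conjcM z w : conjc (z * w) = conjc z * conjc w. Proof. exact: rmorphM. Qed.

Lemma conjcB z w : conjc (z - w) = conjc z - conjc w. Proof. exact: rmorphB. Qed.
Lemma conjc_sum I (s : seq I) (P : pred I) (F : I -> R[i]) :
  conjc (\sum_(i <- s | P i) F i) = \sum_(i <- s | P i) conjc (F i).
Proof. exact: rmorph_sum. Qed.
Lemma realc_sum I (s : seq I) (P : pred I) (F : I -> R) :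
  (\sum_(i <- s | P i) F i)%:C = \sum_(i <- s | P i) (F i)%:C.
Proof. exact: rmorph_sum. Qed.

Lemma realcM (a b : R) : (a * b)%:C = a%:C * b%:C.
Proof. exact: rmorphM. Qed.
Lemma realcD (a b : R) : (a + b)%:C = a%:C + b%:C.
Proof. exact: rmorphD. Qed.
Lemma realcX (a : R) n : (a ^+ n)%:C = a%:C ^+ n.
Proof. exact: rmorphXn. Qed.

Lemma cmodE z : cmod z = Num.sqrt (re z ^+ 2 + im z ^+ 2).
Proof. by rewrite /cmod normc_def. Qed.

Lemma norm_cmod z : `|z| = (cmod z)%:C.
Proof. by rewrite cmodE normc_def. Qed.

Lemma sqr_cmod z : cmod z ^+ 2 = re z ^+ 2 + im z ^+ 2.
Proof. by rewrite cmodE sqr_sqrtr// addr_ge0// sqr_ge0. Qed.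

Lemma cmod_ge0 z : 0 <= cmod z.
Proof. by rewrite cmodE sqrtr_ge0. Qed.

Lemma cmodM z w : cmod (z * w) = cmod z * cmod w.
Proof. by apply: (@complexI R); rewrite realcM -!norm_cmod normrM. Qed.

Lemma cmodD z w : cmod (z + w) <= cmod z + cmod w.
Proof. by rewrite -lecR realcD -!norm_cmod ler_normD. Qed.

Lemma cmodN z : cmod (- z) = cmod z.
Proof. by rewrite !cmodE reN imN !sqrrN. Qed.

Lemma cmodB z w : cmod (z - w) = cmod (w - z).
Proof. by rewrite -cmodN opprB. Qed.

Lemma cmodJ z : cmod (conjc z) = cmod z.
Proof. by rewrite !cmodE reJ imJ !sqrrN. Qed.

Lemma cmod_real (x : R) : cmod x%:C = `|x|.
Proof. by rewrite cmodE /= expr0n addr0 sqrtr_sqr. Qed.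

Lemma cmod0 : cmod (0 : R[i]) = 0. Proof. by rewrite (cmod_real 0) normr0. Qed.
Lemma cmod1 : cmod (1 : R[i]) = 1. Proof. by rewrite (cmod_real 1) normr1. Qed.

Lemma cmod_eq0 z : cmod z = 0 -> z = 0.
Proof.
by move=> z0; apply/eqP; rewrite -normr_eq0 norm_cmod z0.
Qed.

Lemma cmodX z n : cmod (z ^+ n) = cmod z ^+ n.
Proof. by elim: n => [|n ih]; rewrite ?expr0 ?cmod1// !exprS cmodM ih. Qed.

Lemma cmod_sum I (s : seq I) (P : pred I) (F : I -> R[i]) :
  cmod (\sum_(i <- s | P i) F i) <= \sum_(i <- s | P i) cmod (F i).
Proof.
elim/big_rec2 : _ => [|i x y _ h]; first by rewrite cmod0.
by rewrite (le_trans (cmodD _ _))// lerD2l.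
Qed.

Lemma re_le_cmod z : `|re z| <= cmod z.
Proof. by rewrite cmodE -sqrtr_sqr ler_wsqrtr// lerDl sqr_ge0. Qed.

Lemma im_le_cmod z : `|im z| <= cmod z.
Proof. by rewrite cmodE -sqrtr_sqr ler_wsqrtr// lerDr sqr_ge0. Qed.

Lemma cmod_le_reim z : cmod z <= `|re z| + `|im z|.
Proof.
rewrite -(@ler_pXn2r _ 2)// ?nnegrE ?cmod_ge0// ?addr_ge0// sqr_cmod sqrrD.
by rewrite !real_normK ?num_real// lerD2r lerDl mulrn_wge0// mulr_ge0.
Qed.

Lemma mulJ_cmod z : z * conjc z = (cmod z ^+ 2)%:C.
Proof.
apply: complex_eqP; first by rewrite reM reJ imJ /= sqr_cmod; ring.
by rewrite imM reJ imJ /=; ring.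
Qed.

Lemma sqr_cmodD z w : cmod (z + w) ^+ 2 <= 2 * cmod z ^+ 2 + 2 * cmod w ^+ 2.
Proof.
rewrite !sqr_cmod reD imD.
have := sqr_ge0 (re z - re w); have := sqr_ge0 (im z - im w).
by rewrite !sqrrB !sqrrD; lra.
Qed.

(** Iterates [sqr_cmodD]. The exponential constant is harmless: all sums to which it is applied have
    a length independent of [n]. *)
Lemma sqr_cmod_sum I (s : seq I) (P : pred I) (F : I -> R[i]) :
  cmod (\sum_(i <- s | P i) F i) ^+ 2 <=
  2 ^+ size s * \sum_(i <- s | P i) cmod (F i) ^+ 2.
Proof.
elim: s => [|i s ih]; first by rewrite !big_nil cmod0 expr0n mulr0.
rewrite !big_cons; case: ifP => _ /=; last first.
  rewrite (le_trans ih)// ler_wpM2r ?sumr_ge0// ?ler_weXn2l ?ler1n// => j _.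
  exact: sqr_ge0.
rewrite (le_trans (sqr_cmodD _ _))// mulrDr [2 ^+ _.+1]exprS lerD//.
  by rewrite -mulrA ler_wpM2l// ler_peMl ?sqr_ge0// exprn_ege1// ler1n.
by rewrite -mulrA ler_wpM2l.
Qed.

Lemma cmod_expi (t : R) : cmod (expi t) = 1.
Proof. by rewrite cmodE /= cos2Dsin2 sqrtr1. Qed.

Lemma expiD (s t : R) : expi (s + t) = expi s * expi t.
Proof.
by apply: complex_eqP; rewrite ?reM ?imM /expi /= ?cosD ?sinD //; ring.
Qed.

Lemma conjc_expi (t : R) : conjc (expi t) = expi (- t).
Proof. by apply: complex_eqP; rewrite ?reJ ?imJ /expi /= ?cosN ?sinN. Qed.

Lemma expi0 : expi (0 : R) = 1.
Proof. by apply: complex_eqP; rewrite /expi /= ?cos0 ?sin0. Qed.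

End complex_modulus.

Section complex_limits.
Context {R : realType} {T : Type} (F : set_system T) {FF : Filter F}.
Implicit Types (f g : T -> R[i]) (l : R[i]).

(** The norm of [R[i]^o] has values in [R[i]], so its radii are complex numbers; a positive one is
    real, which brings convergence back to a real sequence. *)
Lemma ccvg_cmodP f l : ((f : T -> R[i]^o) @ F --> (l : R[i]^o)) <->
  ((fun t => cmod (f t - l)) @ F --> (0 : R)).
Proof.
split=> [/cvgrPdist_lt h|/cvgrPdist_lt h].
  apply/cvgrPdist_lt => e e0.
  have e0' : 0 < e%:C by rewrite ltcR.
  have := h _ e0'; apply: filterS => t.
  rewrite norm_cmod ltcR sub0r normrN ger0_norm ?cmod_ge0//.
  by rewrite cmodB.
apply/cvgrPdist_lt => -[e e']; rewrite ltcE /= => /andP[/eqP -> e0].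
have := h _ e0; apply: filterS => t.
by rewrite sub0r normrN ger0_norm ?cmod_ge0// norm_cmod ltcR cmodB.
Qed.

Lemma ccvgP f l : ((f : T -> R[i]^o) @ F --> (l : R[i]^o)) <->
  ((fun t => re (f t)) @ F --> re l) /\ ((fun t => im (f t)) @ F --> im l).
Proof.
rewrite ccvg_cmodP; split=> [h|[h1 h2]].
  split.
    apply/subr_cvg0; apply/norm_cvg0P.
    apply: (squeeze_cvgr _ (cvg_cst 0) h).
    by apply: nearW => t; rewrite normr_ge0 -reB re_le_cmod.
  apply/subr_cvg0; apply/norm_cvg0P.
  apply: (squeeze_cvgr _ (cvg_cst 0) h).
  by apply: nearW => t; rewrite normr_ge0 -imB im_le_cmod.
have {}h1 : (fun t => `|re (f t) - re l|) @ F --> (0:R).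
  by apply/norm_cvg0P/subr_cvg0.
have {}h2 : (fun t => `|im (f t) - im l|) @ F --> (0:R).
  by apply/norm_cvg0P/subr_cvg0.
have h : (fun t => `|re (f t) - re l| + `|im (f t) - im l|) @ F --> (0:R).
  by rewrite -[0](addr0 0); exact: cvgD h1 h2.
apply: (squeeze_cvgr _ (cvg_cst 0) h).
apply: nearW => t; rewrite cmod_ge0 /=.
by rewrite (le_trans (cmod_le_reim _))// reB imB.
Qed.

End complex_limits.

Section complex_continuity.
Context {R : realType} {T : topologicalType}.
Implicit Types (f g : T -> R[i]).

Lemma ccontP f : continuous (f : T -> R[i]^o) <->
  continuous (re \o f) /\ continuous (im \o f).
Proof.
split=> [h|[h1 h2] x]; last by apply/ccvgP; split; [exact: h1|exact: h2].
by split=> x; case: ((ccvgP _ _).1 (h x)).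
Qed.

Lemma ccontM f g : continuous (f : T -> R[i]^o) -> continuous (g : T -> R[i]^o) ->
  continuous ((fun x => f x * g x) : T -> R[i]^o).
Proof.
move=> /ccontP[f1 f2] /ccontP[g1 g2]; apply/ccontP; split.
  rewrite (_ : _ \o _ = fun x => re (f x) * re (g x) - im (f x) * im (g x)).
    by move=> x; apply: cvgB; apply: cvgM; [exact: f1|exact: g1|exact: f2|exact: g2].
  by apply/funext => x /=; rewrite reM.
rewrite (_ : _ \o _ = fun x => re (f x) * im (g x) + im (f x) * re (g x)).
  by move=> x; apply: cvgD; apply: cvgM; [exact: f1|exact: g2|exact: f2|exact: g1].
by apply/funext => x /=; rewrite imM.
Qed.

Lemma ccontD f g : continuous (f : T -> R[i]^o) -> continuous (g : T -> R[i]^o) ->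
  continuous ((fun x => f x + g x) : T -> R[i]^o).
Proof.
move=> /ccontP[f1 f2] /ccontP[g1 g2]; apply/ccontP; split.
  rewrite (_ : _ \o _ = fun x => re (f x) + re (g x)).
    by move=> x; apply: cvgD; [exact: f1|exact: g1].
  by apply/funext => x /=; rewrite reD.
rewrite (_ : _ \o _ = fun x => im (f x) + im (g x)).
  by move=> x; apply: cvgD; [exact: f2|exact: g2].
by apply/funext => x /=; rewrite imD.
Qed.

Lemma ccontJ f : continuous (f : T -> R[i]^o) ->
  continuous ((fun x => conjc (f x)) : T -> R[i]^o).
Proof.
move=> /ccontP[f1 f2]; apply/ccontP; split.
  rewrite (_ : _ \o _ = fun x => re (f x)); first exact: f1.
  by apply/funext => x /=; rewrite reJ.
rewrite (_ : _ \o _ = fun x => - im (f x)); first by move=> x; apply: cvgN; exact: f2.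
by apply/funext => x /=; rewrite imJ.
Qed.

Lemma ccont_cst (c : R[i]) : continuous ((fun=> c) : T -> R[i]^o).
Proof. by apply/ccontP; split=> x; exact: cvg_cst. Qed.

Lemma ccont_real (f : T -> R) : continuous f ->
  continuous ((fun x => (f x)%:C) : T -> R[i]^o).
Proof. by move=> h; apply/ccontP; split=> x; [exact: h|exact: cvg_cst]. Qed.

Lemma cont_cmod f : continuous (f : T -> R[i]^o) -> continuous (fun x => cmod (f x)).
Proof.
move=> /ccontP[f1 f2] x.
rewrite (_ : (fun _ => _) = fun x => Num.sqrt (re (f x) ^+ 2 + im (f x) ^+ 2)); last first.
  by apply/funext => y; rewrite cmodE.
apply: (@continuous_comp _ _ _ (fun x => re (f x) ^+ 2 + im (f x) ^+ 2) Num.sqrt);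
  last exact: sqrt_continuous.
rewrite (_ : (fun _ => _) = fun x => re (f x) * re (f x) + im (f x) * im (f x)) //.
by apply: cvgD; apply: cvgM; [exact: f1|exact: f1|exact: f2|exact: f2].
Qed.

End complex_continuity.

Section complex_integral.
Context {disp : measure_display} {T : measurableType disp} {R : realType}.
Variable mu : {measure set T -> \bar R}.
Implicit Types (f g : T -> R[i]) (z : R[i]).

(** For the Lebesgue measure on row vectors, [cmeas], [cinteg] and [cI] unfold to [cmeasurable],
    [cintegrable] and [cint]. A general measure is needed for the one-dimensional factors and the
    products in Fubini's theorem. *)
Definition cmeas f := measurable_fun [set: T] (re \o f) /\
                      measurable_fun [set: T] (im \o f).

Definition cinteg f := mu.-integrable [set: T] (EFin \o re \o f) /\
                       mu.-integrable [set: T] (EFin \o im \o f).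

Definition cI f : R[i] := (\int[mu]_x re (f x))%R +i* (\int[mu]_x im (f x))%R.

Lemma cmeasM f g : cmeas f -> cmeas g -> cmeas (fun x => f x * g x).
Proof.
move=> [f1 f2] [g1 g2]; split.
  rewrite (_ : _ \o _ = fun x => re (f x) * re (g x) - im (f x) * im (g x)).
    by apply: measurable_funB; apply: measurable_funM.
  by apply/funext => x /=; rewrite reM.
rewrite (_ : _ \o _ = fun x => re (f x) * im (g x) + im (f x) * re (g x)).
  by apply: measurable_funD; apply: measurable_funM.
by apply/funext => x /=; rewrite imM.
Qed.

Lemma cmeasD f g : cmeas f -> cmeas g -> cmeas (fun x => f x + g x).
Proof.
move=> [f1 f2] [g1 g2]; split.
  rewrite (_ : _ \o _ = fun x => re (f x) + re (g x)); first exact: measurable_funD.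
  by apply/funext => x /=; rewrite reD.
rewrite (_ : _ \o _ = fun x => im (f x) + im (g x)); first exact: measurable_funD.
by apply/funext => x /=; rewrite imD.
Qed.

Lemma cmeas_cst z : cmeas (fun=> z).
Proof. by split; exact: measurable_cst. Qed.

Lemma cmeas_real (h : T -> R) : measurable_fun [set: T] h ->
  cmeas (fun x => (h x)%:C).
Proof. by move=> mh; split; [exact: mh|exact: measurable_cst]. Qed.

Lemma cmeasJ f : cmeas f -> cmeas (fun x => conjc (f x)).
Proof.
move=> [f1 f2]; split.
  by rewrite (_ : _ \o _ = re \o f)//; apply/funext => x /=; rewrite reJ.
rewrite (_ : _ \o _ = fun x => - im (f x)); first exact: measurable_funN.
by apply/funext => x /=; rewrite imJ.
Qed.

Lemma cmeasN f : cmeas f -> cmeas (fun x => - f x).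
Proof.
move=> mf; rewrite (_ : (fun _ => _) = fun x => (-1) * f x).
  by apply: cmeasM => //; exact: cmeas_cst.
by apply/funext => x; rewrite mulN1r.
Qed.

Lemma cmeasB f g : cmeas f -> cmeas g -> cmeas (fun x => f x - g x).
Proof. by move=> mf mg; apply: cmeasD => //; exact: cmeasN. Qed.

Lemma cmeas_sum I (s : seq I) (P : pred I) (F : I -> T -> R[i]) :
  (forall i, P i -> cmeas (F i)) -> cmeas (fun x => \sum_(i <- s | P i) F i x).
Proof.
move=> h; elim: s => [|i s ih].
  rewrite (_ : (fun _ => _) = fun=> 0); first exact: cmeas_cst.
  by apply/funext => x; rewrite big_nil.
rewrite (_ : (fun _ => _) = fun x => if P i then
   F i x + \sum_(i <- s | P i) F i x else \sum_(i <- s | P i) F i x).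
  by case Pi: (P i) => //; apply: cmeasD => //; exact: h.
by apply/funext => x; rewrite big_cons.
Qed.

Lemma cmeas_prod I (s : seq I) (P : pred I) (F : I -> T -> R[i]) :
  (forall i, P i -> cmeas (F i)) -> cmeas (fun x => \prod_(i <- s | P i) F i x).
Proof.
move=> h; elim: s => [|i s ih].
  rewrite (_ : (fun _ => _) = fun=> 1); first exact: cmeas_cst.
  by apply/funext => x; rewrite big_nil.
rewrite (_ : (fun _ => _) = fun x => if P i then
   F i x * \prod_(i <- s | P i) F i x else \prod_(i <- s | P i) F i x).
  by case Pi: (P i) => //; apply: cmeasM => //; exact: h.
by apply/funext => x; rewrite big_cons.
Qed.

Lemma measurable_cmod2 f : cmeas f -> measurable_fun setT (fun x => cmod (f x) ^+ 2).
Proof.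
move=> [f1 f2].
rewrite (_ : (fun _ => _) = fun x => re (f x) ^+ 2 + im (f x) ^+ 2).
  by apply: measurable_funD; apply: measurable_funX.
by apply/funext => x; rewrite sqr_cmod.
Qed.

Lemma measurable_cmod f : cmeas f -> measurable_fun setT (fun x => cmod (f x)).
Proof.
move=> mf; rewrite (_ : (fun _ => _) = fun x => Num.sqrt (cmod (f x) ^+ 2)).
  by apply: measurableT_comp (measurable_cmod2 mf); apply: continuous_measurable_fun;
    exact: sqrt_continuous.
by apply/funext => x; rewrite sqrtr_sqr ger0_norm ?cmod_ge0.
Qed.

Lemma cmeas_expi (h : T -> R) : measurable_fun setT h -> cmeas (fun x => expi (h x)).
Proof.
move=> mh; split.
  by apply: (measurableT_comp _ mh); apply: continuous_measurable_fun; exact: continuous_cos.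
by apply: (measurableT_comp _ mh); apply: continuous_measurable_fun; exact: continuous_sin.
Qed.

Lemma cintegP f : cinteg f <->
  cmeas f /\ mu.-integrable setT (fun x => (cmod (f x))%:E).
Proof.
split=> [[i1 i2]|[[m1 m2] i]].
  have mf : cmeas f.
    by split; apply/measurable_EFinP; [exact: (measurable_int _ i1)|
      exact: (measurable_int _ i2)].
  split => //.
  apply: (le_integrable measurableT _ _ (integrableD measurableT
    (integrable_abse i1) (integrable_abse i2))) => //=.
    by apply/measurable_EFinP; exact: measurable_cmod.
  move=> x _; rewrite !lee_fin ger0_norm ?cmod_ge0//.
  by rewrite ger0_norm ?addr_ge0// cmod_le_reim.
split.
  apply: (le_integrable measurableT _ _ i) => //=; first exact/measurable_EFinP.
  by move=> x _; rewrite lee_fin (ger0_norm (cmod_ge0 _)) re_le_cmod.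
apply: (le_integrable measurableT _ _ i) => //=; first exact/measurable_EFinP.
by move=> x _; rewrite lee_fin (ger0_norm (cmod_ge0 _)) im_le_cmod.
Qed.

Lemma le_cinteg f (h : T -> R) : cmeas f -> mu.-integrable setT (EFin \o h) ->
  (forall x, cmod (f x) <= h x) -> cinteg f.
Proof.
move=> mf ih fh; apply/cintegP; split=> //.
apply: (le_integrable measurableT _ _ ih) => //=.
  by apply/measurable_EFinP; exact: measurable_cmod.
move=> x _; rewrite lee_fin (ger0_norm (cmod_ge0 _)).
by rewrite (le_trans (fh x))// ler_norm.
Qed.

Lemma cinteg_le f g : cmeas f -> cinteg g -> (forall x, cmod (f x) <= cmod (g x)) ->
  cinteg f.
Proof. by move=> mf /cintegP[mg ig]; exact: le_cinteg. Qed.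

Lemma cintegD f g : cinteg f -> cinteg g -> cinteg (fun x => f x + g x).
Proof.
move=> [f1 f2] [g1 g2]; split.
  rewrite (_ : _ \o _ = (EFin \o re \o f) \+ (EFin \o re \o g))%E;
    first exact: integrableD.
  by apply/funext => x /=; rewrite reD.
rewrite (_ : _ \o _ = (EFin \o im \o f) \+ (EFin \o im \o g))%E; first exact: integrableD.
by apply/funext => x /=; rewrite imD.
Qed.

Lemma cID f g : cinteg f -> cinteg g -> cI (fun x => f x + g x) = cI f + cI g.
Proof.
move=> [f1 f2] [g1 g2]; apply: complex_eqP; rewrite ?reD ?imD /=.
  rewrite -RintegralD//; apply: eq_Rintegral => x _; exact: reD.
rewrite -RintegralD//; apply: eq_Rintegral => x _; exact: imD.
Qed.

Lemma cintegZ z f : cinteg f -> cinteg (fun x => z * f x).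
Proof.
move=> /cintegP[mf i]; apply/cintegP; split.
  by apply: cmeasM => //; exact: cmeas_cst.
under eq_fun do rewrite cmodM EFinM.
exact: integrableZl.
Qed.

Lemma cIZ z f : cinteg f -> cI (fun x => z * f x) = z * cI f.
Proof.
move=> [f1 f2].
have ii (c : R) (h : T -> R) : mu.-integrable [set: T] (EFin \o h) ->
    mu.-integrable [set: T] (EFin \o (fun x => c * h x)).
  exact: integrableZl.
apply: complex_eqP; rewrite ?reM ?imM.
  rewrite -!RintegralZl// -RintegralB//; [|exact: ii f1|exact: ii f2].
  by apply: eq_Rintegral => x _; rewrite reM.
rewrite -!RintegralZl// -RintegralD//; [|exact: ii f2|exact: ii f1].
by apply: eq_Rintegral => x _; rewrite imM.
Qed.

Lemma cIZr z f : cinteg f -> cI (fun x => f x * z) = cI f * z.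
Proof. by move=> fi; under eq_fun do rewrite mulrC; rewrite cIZ// mulrC. Qed.

Lemma cinteg0 : cinteg (fun=> 0).
Proof. by split; exact: integrable0. Qed.

Lemma cI0 : cI (fun=> 0) = 0.
Proof. by apply: complex_eqP; rewrite /cI /= /Rintegral integral0. Qed.

Lemma cintegJ f : cinteg f -> cinteg (fun x => conjc (f x)).
Proof.
move=> /cintegP[mf fi]; apply/cintegP; split; first exact: cmeasJ.
by under eq_fun do rewrite cmodJ.
Qed.

Lemma cintegN f : cinteg f -> cinteg (fun x => - f x).
Proof. by move=> h; under eq_fun do rewrite -mulN1r; exact: cintegZ. Qed.

Lemma cintegB f g : cinteg f -> cinteg g -> cinteg (fun x => f x - g x).
Proof. by move=> hf hg; apply: cintegD => //; exact: cintegN. Qed.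

Lemma cIN f : cinteg f -> cI (fun x => - f x) = - cI f.
Proof. by move=> h; under eq_fun do rewrite -mulN1r; rewrite cIZ// mulN1r. Qed.

Lemma cIB f g : cinteg f -> cinteg g -> cI (fun x => f x - g x) = cI f - cI g.
Proof. by move=> hf hg; rewrite cID// ?cIN//; exact: cintegN. Qed.

Lemma cinteg_sum I (s : seq I) (P : pred I) (F : I -> T -> R[i]) :
  (forall i, P i -> cinteg (F i)) -> cinteg (fun x => \sum_(i <- s | P i) F i x).
Proof.
move=> h; elim: s => [|i s ih].
  by under eq_fun do rewrite big_nil; exact: cinteg0.
under eq_fun do rewrite big_cons.
by case Pi: (P i) => //; apply: cintegD => //; exact: h.
Qed.

Lemma cI_sum I (s : seq I) (P : pred I) (F : I -> T -> R[i]) :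
  (forall i, P i -> cinteg (F i)) ->
  cI (fun x => \sum_(i <- s | P i) F i x) = \sum_(i <- s | P i) cI (F i).
Proof.
move=> h; elim: s => [|i s ih].
  by under eq_fun do rewrite big_nil; rewrite big_nil cI0.
under eq_fun do rewrite big_cons.
rewrite big_cons; case: ifPn => // Pi; rewrite cID// ?ih//; first exact: h.
exact: cinteg_sum.
Qed.

Lemma cIJ f : cinteg f -> cI (fun x => conjc (f x)) = conjc (cI f).
Proof.
move=> [f1 f2]; apply: complex_eqP; rewrite ?reJ ?imJ /=.
  by apply: eq_Rintegral => x _; rewrite reJ.
rewrite -[RHS]mulN1r -RintegralZl//; apply: eq_Rintegral => x _.
by rewrite imJ mulN1r.
Qed.

(* The factor 2 is not optimal, but makes the bound immediate from real and
   imaginary parts. *)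
Lemma cmod_cI_le f : cinteg f ->
  ((cmod (cI f))%:E <= 2%:E * \int[mu]_x (cmod (f x))%:E)%E.
Proof.
move=> fi; have [mf ia] := (cintegP f).1 fi; case: fi => [f1 f2].
rewrite -(@fineK _ (\int[mu]_x _)%E); last exact: integrable_fin_num.
rewrite -EFinM lee_fin (le_trans (cmod_le_reim _))// mulr_natl mulr2n lerD//=.
  rewrite (le_trans (le_normr_Rintegral measurableT f1))//.
  apply: le_Rintegral => //; first exact: (integrable_norm f1).
  by move=> x _; exact: re_le_cmod.
rewrite (le_trans (le_normr_Rintegral measurableT f2))//.
apply: le_Rintegral => //; first exact: (integrable_norm f2).
by move=> x _; exact: im_le_cmod.
Qed.

Lemma eq_cI f g : f =1 g -> cI f = cI g.
Proof. by move=> /funext ->. Qed.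

Definition sqn f : \bar R := (\int[mu]_x (cmod (f x) ^+ 2)%:E)%E.

Lemma sqn_ge0 f : (0 <= sqn f)%E.
Proof. by apply: integral_ge0 => x _; rewrite lee_fin sqr_ge0. Qed.

Let m2 f : cmeas f -> measurable_fun setT (fun x => (cmod (f x) ^+ 2)%:E).
Proof. by move=> /measurable_cmod2 h; exact/measurable_EFinP. Qed.

Lemma le_sqn (c : R) f g : 0 <= c -> cmeas f -> cmeas g ->
  (forall x, cmod (f x) ^+ 2 <= c * cmod (g x) ^+ 2) -> (sqn f <= c%:E * sqn g)%E.
Proof.
move=> c0 mf mg h; rewrite /sqn -ge0_integralZl//; first last.
- by move=> x _; rewrite lee_fin sqr_ge0.
- exact: m2.
apply: ge0_le_integral => //.
- by move=> x _; rewrite lee_fin sqr_ge0.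
- exact: m2.
- by apply: measurable_funeM; exact: m2.
- by move=> x _; rewrite -EFinM lee_fin.
Qed.

Lemma sqnD f g : cmeas f -> cmeas g ->
  (sqn (fun x => f x + g x)%R <= 2%:E * sqn f + 2%:E * sqn g)%E.
Proof.
move=> mf mg; rewrite /sqn -!ge0_integralZl//; try exact: m2;
  try by move=> x _; rewrite lee_fin sqr_ge0.
rewrite -ge0_integralD//; first last.
- by apply: measurable_funeM; exact: m2.
- by move=> x _; rewrite -EFinM lee_fin mulr_ge0// sqr_ge0.
- by apply: measurable_funeM; exact: m2.
- by move=> x _; rewrite -EFinM lee_fin mulr_ge0// sqr_ge0.
apply: ge0_le_integral => //.
- by move=> x _; rewrite lee_fin sqr_ge0.
- by apply: m2; exact: cmeasD.
- by apply: emeasurable_funD; apply: measurable_funeM; exact: m2.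
- by move=> x _; rewrite -!EFinM -EFinD lee_fin sqr_cmodD.
Qed.

Lemma sqn_sum I (s : seq I) (P : pred I) (F : I -> T -> R[i]) :
  (forall i, P i -> cmeas (F i)) ->
  (sqn (fun x => \sum_(i <- s | P i) F i x)%R <=
     (2 ^+ size s)%:E * \sum_(i <- s | P i) sqn (F i))%E.
Proof.
move=> h; elim: s => [|i s ih].
  under eq_fun do rewrite big_nil.
  by rewrite big_nil mule0 /sqn integral0_eq// => x _; rewrite cmod0 expr0n.
under eq_fun do rewrite big_cons.
have s0 : (0 <= \sum_(i <- s | P i) sqn (F i))%E by apply: sume_ge0 => j _; exact: sqn_ge0.
rewrite big_cons /=; case: ifPn => Pi; last first.
  by rewrite (le_trans ih)// lee_wpmul2r// lee_fin ler_weXn2l ?ler1n.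
rewrite (le_trans (sqnD (h _ Pi) (cmeas_sum s h)))//.
rewrite (@ge0_muleDr _ _ (sqn (F i)) _ (sqn_ge0 _) s0).
rewrite leeD//=; first 1 last.
  by rewrite exprS EFinM -muleA lee_wpmul2l.
by rewrite lee_wpmul2r ?sqn_ge0// lee_fin exprS ler_peMr// exprn_ege1// ler1n.
Qed.

Lemma cinteg_mulJ f g : cmeas f -> cmeas g -> (sqn f < +oo)%E -> (sqn g < +oo)%E ->
  cinteg (fun x => f x * g x).
Proof.
move=> mf mg hf hg.
have ii h : cmeas h -> (sqn h < +oo)%E ->
    mu.-integrable setT (EFin \o (fun x => cmod (h x) ^+ 2)).
  move=> mh hh; apply/integrableP; split; first exact: m2.
  under eq_integral do rewrite gee0_abs ?lee_fin ?sqr_ge0//.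
  exact: hh.
apply: (@le_cinteg _ (fun x => cmod (f x) ^+ 2 + cmod (g x) ^+ 2)).
- exact: cmeasM.
- exact: (integrableD measurableT (ii _ mf hf) (ii _ mg hg)).
- move=> x; rewrite cmodM.
  have := sqr_ge0 (cmod (f x) - cmod (g x)); rewrite sqrrB.
  have := sqr_ge0 (cmod (f x)); have := sqr_ge0 (cmod (g x)); lra.
Qed.

(* AM-GM, [2 a b <= t a^2 + b^2 / t]; the 2 comes from [cmod_cI_le]. *)
Lemma cmod_cI_mul_le (t : R) f g : 0 < t -> cmeas f -> cmeas g ->
  (sqn f < +oo)%E -> (sqn g < +oo)%E ->
  ((cmod (cI (fun x => f x * g x)))%:E <= t%:E * sqn f + t^-1%:E * sqn g)%E.
Proof.
move=> t0 mf mg hf hg; have ti := cinteg_mulJ mf mg hf hg.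
rewrite (le_trans (cmod_cI_le ti))// /sqn -!ge0_integralZl//; try exact: m2;
  try (by move=> x _; rewrite lee_fin ?sqr_ge0 ?cmod_ge0);
  try (by rewrite lee_fin ?invr_ge0 ltW).
  2: by apply/measurable_EFinP; apply: measurable_cmod; exact: cmeasM.
rewrite -ge0_integralD//; first last.
- by apply: measurable_funeM; exact: m2.
- by move=> x _; rewrite -EFinM lee_fin mulr_ge0 ?sqr_ge0// invr_ge0 ltW.
- by apply: measurable_funeM; exact: m2.
- by move=> x _; rewrite -EFinM lee_fin mulr_ge0 ?sqr_ge0// ltW.
apply: ge0_le_integral => //.
- by move=> x _; rewrite -EFinM lee_fin mulr_ge0// cmod_ge0.
- apply: measurable_funeM; apply/measurable_EFinP; apply: measurable_cmod.
  exact: cmeasM.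
- by apply: emeasurable_funD; apply: measurable_funeM; exact: m2.
- move=> x _; rewrite -!EFinM -EFinD lee_fin cmodM.
  set a := cmod (f x); set b := cmod (g x).
  have -> : t * a ^+ 2 + t^-1 * b ^+ 2 = t^-1 * ((t * a) ^+ 2 + b ^+ 2).
    by field; rewrite gt_eqF.
  rewrite [leRHS]mulrC ler_pdivlMr//.
  by have := sqr_ge0 (t * a - b); rewrite sqrrB; lra.
Qed.

Lemma sqn_integrable f : cmeas f -> (sqn f < +oo)%E ->
  mu.-integrable setT (EFin \o (fun x => cmod (f x) ^+ 2)).
Proof.
move=> mh hh; apply/integrableP; split; first exact: m2.
under eq_integral do rewrite gee0_abs ?lee_fin ?sqr_ge0//.
exact: hh.
Qed.

End complex_integral.

(** * Integration over row vectors *)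

Section real_fubini.
Context {d1 d2 : measure_display} {T1 : measurableType d1} {T2 : measurableType d2}
  {R : realType}.
Variables (m1 : {sigma_finite_measure set T1 -> \bar R})
  (m2 : {sigma_finite_measure set T2 -> \bar R}).

Lemma measurable_param_eint (f : T1 * T2 -> \bar R) : measurable_fun setT f ->
  measurable_fun setT (fun x => \int[m2]_y f (x, y))%E.
Proof.
move=> mf.
rewrite (_ : (fun x => _) = fun x => (\int[m2]_y (f^\+ (x, y)) -
   \int[m2]_y (f^\- (x, y)))%E).
  apply: emeasurable_funB.
    by apply: measurable_fun_fubini_tonelli_F => //; exact: measurable_funepos.
  by apply: measurable_fun_fubini_tonelli_F => //; exact: measurable_funeneg.
apply/funext => x; rewrite [LHS]integralE.
under eq_integral do rewrite funepos_comp/=.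
by under [X in (_ - X)%E = _]eq_integral do rewrite funeneg_comp/=.
Qed.

Lemma measurable_param_int (f : T1 * T2 -> R) : measurable_fun setT f ->
  measurable_fun setT (fun x => \int[m2]_y f (x, y))%R.
Proof.
move=> /measurable_EFinP mf.
by apply: (@measurableT_comp _ _ _ _ _ _ fine) => //; exact: (measurable_param_eint mf).
Qed.

Lemma integrable_param_int (f : T1 * T2 -> R) :
  (m1 \x m2)%E.-integrable setT (EFin \o f) ->
  m1.-integrable setT (EFin \o (fun x => \int[m2]_y f (x, y))%R).
Proof.
move=> fi; have Fi := integrable_fubini_F fi.
apply: (le_integrable measurableT _ _ Fi).
  apply/measurable_EFinP; apply: measurable_param_int.
  by apply/measurable_EFinP; exact: measurable_int fi.
(* [fine] turns an infinite inner integral into 0, so the real inner integral is dominated by the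
   extended one. *)
move=> x _ /=; rewrite /Rintegral /fubini_F /=.
set J := (X in (_ <= `|X|)%E); rewrite -/J.
by case: J => [r| |] //=; rewrite ?lee_fin ?normr0 ?leey.
Qed.

(** The inner integrals are finite almost everywhere, so taking [fine] of each of them does not
    change the outer integral. *)
Lemma Rintegral12 (f : T1 * T2 -> R) :
  (m1 \x m2)%E.-integrable setT (EFin \o f) ->
  (\int[m1]_x (\int[m2]_y f (x, y)) = \int[(m1 \x m2)%E]_z f z)%R.
Proof.
move=> fi; rewrite /Rintegral -(integral12_prod_meas1 fi); congr fine.
have Fi := integrable_fubini_F fi.
apply: ae_eq_integral => //.
- by have := measurable_int _ (integrable_param_int fi).
- exact: measurable_int Fi.
- have := integrable_ae measurableT Fi; apply: filterS => x /= + _ => /(_ I).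
  by rewrite /fubini_F /= => /fineK ->.
Qed.

End real_fubini.

Section real_fubini_swap.
Context {d1 d2 : measure_display} {T1 : measurableType d1} {T2 : measurableType d2}
  {R : realType}.
Variables (m1 : {sigma_finite_measure set T1 -> \bar R})
  (m2 : {sigma_finite_measure set T2 -> \bar R}).

Lemma integrable_swap (f : T1 * T2 -> R) :
  (m1 \x m2)%E.-integrable setT (EFin \o f) ->
  (m2 \x m1)%E.-integrable setT (EFin \o (fun z => f (z.2, z.1))).
Proof.
move=> fi; have mf := measurable_int _ fi.
have mf' : measurable_fun setT (fun z : T2 * T1 => (f (z.2, z.1))%:E).
  apply: (measurableT_comp mf).
  by apply/measurable_fun_pairP; split; [exact: measurable_snd|exact: measurable_fst].
apply/integrable12ltyP => //.
by move/(integrable21ltyP _ _ mf) : fi.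
Qed.

Lemma Rfubini (f : T1 * T2 -> R) :
  (m1 \x m2)%E.-integrable setT (EFin \o f) ->
  (\int[m1]_x (\int[m2]_y f (x, y)) = \int[m2]_y (\int[m1]_x f (x, y)))%R.
Proof.
move=> fi; rewrite (Rintegral12 fi) (Rintegral12 (integrable_swap fi)).
rewrite /Rintegral -(integral12_prod_meas1 (integrable_swap fi)).
by rewrite -(integral21_prod_meas1 fi).
Qed.

Lemma cmeas_param_cI (F : T1 * T2 -> R[i]) : cmeas F ->
  cmeas (fun x => cI m2 (fun y => F (x, y))).
Proof.
move=> [h1 h2]; split.
  exact: (measurable_param_int m2 h1).
exact: (measurable_param_int m2 h2).
Qed.

Lemma cI12 (F : T1 * T2 -> R[i]) : cinteg (m1 \x m2)%E F ->
  cI m1 (fun x => cI m2 (fun y => F (x, y))) = cI (m1 \x m2)%E F.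
Proof.
by move=> [h1 h2]; apply: complex_eqP => /=; [rewrite -(Rintegral12 h1)|
  rewrite -(Rintegral12 h2)].
Qed.

Lemma cfubini (F : T1 * T2 -> R[i]) : cinteg (m1 \x m2)%E F ->
  cI m1 (fun x => cI m2 (fun y => F (x, y))) =
  cI m2 (fun y => cI m1 (fun x => F (x, y))).
Proof.
by move=> [h1 h2]; apply: complex_eqP => /=; [rewrite (Rfubini h1)|
  rewrite (Rfubini h2)].
Qed.

(** Tonelli. The factor [k] will be the kernel of the Fourier transform. *)
Lemma cinteg_prod (f : T1 -> R[i]) (g : T2 -> R[i]) (k : T1 * T2 -> R[i]) :
  cinteg m1 f -> cinteg m2 g -> cmeas k -> (forall z, cmod (k z) <= 1) ->
  cinteg (m1 \x m2)%E (fun z => k z * (f z.1 * g z.2)).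
Proof.
move=> /cintegP[mf fi] /cintegP[mg gi] mk k1.
have mF : cmeas (fun z : T1 * T2 => f z.1 * g z.2).
  apply: cmeasM.
    by case: mf => f1 f2; split; [exact: (measurableT_comp f1 measurable_fst)|
      exact: (measurableT_comp f2 measurable_fst)].
  by case: mg => f1 f2; split; [exact: (measurableT_comp f1 measurable_snd)|
    exact: (measurableT_comp f2 measurable_snd)].
apply: (@cinteg_le _ _ _ _ _ (fun z => f z.1 * g z.2)).
- exact: cmeasM.
- apply/cintegP; split => //.
  have mF' : measurable_fun setT (fun z : T1 * T2 => (cmod (f z.1 * g z.2))%:E).
    by apply/measurable_EFinP; exact: measurable_cmod.
  apply/integrable12ltyP => //=.
  under eq_integral => x _.
    under eq_integral => y _ do
      rewrite cmodM normrM (ger0_norm (cmod_ge0 _)) (ger0_norm (cmod_ge0 _)) EFinM.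
    rewrite ge0_integralZl//; first last.
    - by rewrite lee_fin cmod_ge0.
    - by move=> y _; rewrite lee_fin cmod_ge0.
    - by apply/measurable_EFinP; exact: measurable_cmod.
    over.
  rewrite ge0_integralZr//; first last.
  - by apply: integral_ge0 => y _; rewrite lee_fin cmod_ge0.
  - by move=> y _; rewrite lee_fin cmod_ge0.
  - by apply/measurable_EFinP; exact: measurable_cmod.
  apply: lte_mul_pinfty.
  - by apply: integral_ge0 => y _; rewrite lee_fin cmod_ge0.
  - exact: integrable_fin_num.
  - exact: integrable_lty.
- by move=> z; rewrite cmodM -[leRHS]mul1r ler_wpM2r ?cmod_ge0.
Qed.

End real_fubini_swap.

Section rV_measure_theory.
Context {R : realType}.

Lemma measurable_rV_box d (I : 'I_d -> set R) :
  (forall i, measurable (I i)) ->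
  measurable [set x : 'rV[R]_d | forall i, I i (x ord0 i)].
Proof.
move=> mI; rewrite (_ : [set x | _] =
   \bigcap_(i in [set: 'I_d]) [set x : 'rV[R]_d | I i (x ord0 i)]).
  apply: fin_bigcap_measurable => // i _.
  rewrite -[X in measurable X]setTI.
  exact: (@measurable_rV_coord R d i).
by apply/seteqP; split=> [x h i _|x h i]; [exact: h|exact: h].
Qed.

(** The sigma-algebra is the one generated by the coordinates, so an open set has to be written as a
    countable union of boxes: those of rational centre and half-side [1/(k+1)] that lie in [U]. *)
Lemma open_measurable_rV d (U : set 'rV[R]_d) : open U -> measurable U.
Proof.
move=> oU.
pose B (p : 'rV[rat]_d * nat) := [set x : 'rV[R]_d | forall i,
  ball (ratr (p.1 ord0 i) : R) (p.2.+1%:R^-1) (x ord0 i)].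
have -> : U = \bigcup_(p in [set: 'rV[rat]_d * nat]) (if pselect (B p `<=` U) then B p else set0).
  apply/seteqP; split=> [x Ux|x [p _]]; last by case: pselect => // h /h.
  have [e /= e0 xe] : nbhs_ball x U by rewrite nbhs_ballE; apply: open_nbhs_nbhs.
  have [k ke] : exists k : nat, k.+1%:R^-1 < e / 2.
    have e2 : 0 < e / 2 by rewrite divr_gt0.
    by have /filter_ex[k hk] := near_infty_natSinv_lt (PosNum e2); exists k.
  have hq i : exists q : rat, `|x ord0 i - ratr q| < k.+1%:R^-1 :> R.
    have k0 : x ord0 i < x ord0 i + k.+1%:R^-1 by rewrite ltrDl invr_gt0.
    have [q] := rat_in_itvoo k0.
    rewrite in_itv /= => /andP[q1 q2]; exists q.
    by rewrite distrC ger0_norm ?subr_ge0 ?(ltW q1)// ltrBlDl.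
  have [q {}hq] := choice hq.
  exists (\row_i q i, k) => //=; case: pselect => [?|]; last first.
    case=> y /= hy; apply: xe; split => // i j; rewrite (ord1 i).
    have := hy j; rewrite !mxE /ball /= => hyj.
    rewrite (splitr e) (le_lt_trans (ler_distD (ratr (q j)) _ _))// ltrD//.
      exact: lt_trans (hq j) ke.
    exact: lt_trans hyj ke.
  by move=> i; rewrite /= mxE /ball /= distrC; exact: hq.
apply: countable_bigcupT_measurable => // p.
case: (pselect (B p `<=` U)) => //= _.
apply: (@measurable_rV_box d (fun i => ball (ratr (p.1 ord0 i) : R) p.2.+1%:R^-1)) => i.
exact: measurable_ball.
Qed.

Lemma continuous_measurable_rV d (f : 'rV[R]_d -> R) : continuous f ->
  measurable_fun setT f.
Proof.
move=> /continuousP cf; apply: (measurability _ (RGenOpens.measurableE R)).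
move=> _ [_ [a [b ->] <-]]; rewrite setTI; apply: open_measurable_rV.
exact/cf/interval_open.
Qed.

Lemma ccont_cmeas d (f : 'rV[R]_d -> R[i]) : continuous (f : _ -> R[i]^o) -> cmeas f.
Proof. by move=> /ccontP[h1 h2]; split; exact: continuous_measurable_rV. Qed.

Lemma closed_measurable_rV d (U : set 'rV[R]_d) : closed U -> measurable U.
Proof. by rewrite -openC => /open_measurable_rV /measurableC; rewrite setCK. Qed.

Lemma compact_measurable_rV d (U : set 'rV[R]_d) : compact U -> measurable U.
Proof. by move=> /compact_closed h; apply: closed_measurable_rV; apply: h. Qed.

(* [lebesgue_measure] lives on [measurableTypeR R], whose display is not the
   default one of [R]. *)
Lemma measurable_rV_consR d :
  measurable_fun [set: measurableTypeR R * 'rV[R]_d] (@rV_cons R d).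
Proof. exact: measurable_rV_cons. Qed.

Lemma ge0_integral_rV_cons d (f : 'rV[R]_d.+1 -> \bar R) :
  measurable_fun setT f -> (forall x, 0 <= f x)%E ->
  (\int[lebesgue_rV R d.+1]_x f x =
   \int[lebesgue_measure \x lebesgue_rV R d]_p f (rV_cons p))%E.
Proof.
move=> mf f0.
have h := ge0_integral_pushforward (@measurable_rV_consR d)
  (lebesgue_measure \x lebesgue_rV R d)%E measurableT mf (fun x _ => f0 x).
rewrite -[RHS]h.
by apply: eq_measure_integral; first exact: measurable_rV_consR.
Qed.

Lemma integrable_rV_cons d (f : 'rV[R]_d.+1 -> R) :
  (lebesgue_rV R d.+1).-integrable setT (EFin \o f) ->
  (lebesgue_measure \x lebesgue_rV R d)%E.-integrable setT
    (EFin \o (fun p => f (rV_cons p))).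
Proof.
move=> /integrableP[mf fi]; apply/integrableP; split.
  exact: (measurableT_comp mf (@measurable_rV_consR d)).
move: fi; rewrite ge0_integral_rV_cons//.
exact: measurableT_comp.
Qed.

Lemma Rintegral_rV_cons d (f : 'rV[R]_d.+1 -> R) :
  (lebesgue_rV R d.+1).-integrable setT (EFin \o f) ->
  (\int[lebesgue_rV R d.+1]_x f x =
   \int[(lebesgue_measure \x lebesgue_rV R d)%E]_p f (rV_cons p))%R.
Proof.
move=> fi; rewrite /Rintegral.
have h := integral_pushforward (@measurable_rV_consR d)
  (measurable_int _ fi) (integrable_rV_cons fi) measurableT.
congr fine; rewrite -[RHS]h.
by apply: eq_measure_integral; first exact: measurable_rV_consR.
Qed.

Lemma cinteg_rV_cons d (f : 'rV[R]_d.+1 -> R[i]) :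
  cinteg (lebesgue_rV R d.+1) f ->
  cinteg (lebesgue_measure \x lebesgue_rV R d)%E (fun p => f (rV_cons p)).
Proof.
by move=> [h1 h2]; split; [exact: (integrable_rV_cons h1)|
  exact: (integrable_rV_cons h2)].
Qed.

Lemma cI_rV_cons d (f : 'rV[R]_d.+1 -> R[i]) :
  cinteg (lebesgue_rV R d.+1) f ->
  cI (lebesgue_rV R d.+1) f =
  cI (lebesgue_measure \x lebesgue_rV R d)%E (fun p => f (rV_cons p)).
Proof.
by move=> [h1 h2]; apply: complex_eqP => /=; rewrite /cI /=;
  [exact: (Rintegral_rV_cons h1)|exact: (Rintegral_rV_cons h2)].
Qed.

Lemma lebesgue_rV_box d (I : 'I_d -> set R) : (forall i, measurable (I i)) ->
  lebesgue_rV R d [set x : 'rV[R]_d | forall i, I i (x ord0 i)] =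
  (\prod_i (@lebesgue_measure R (I i)))%E.
Proof.
elim: d I => [|d ih] I mI.
  by rewrite big_ord0 /= diracE mem_set// => -[].
rewrite big_ord_recl /= /leb_step /pushforward.
rewrite (_ : _ @^-1` _ =
   I ord0 `*` [set x : 'rV[R]_d | forall i, I (lift ord0 i) (x ord0 i)]).
  rewrite product_measure1E//; first by rewrite (ih (fun i => I (lift ord0 i))).
    exact: mI.
  by apply: (@measurable_rV_box d (fun i => I (lift ord0 i))) => i; exact: mI.
apply/seteqP; split=> [[a x] /= h|[a x] /= [h1 h2] i].
  split; first by have := h ord0; rewrite mxE unlift_none.
  by move=> i; have := h (lift ord0 i); rewrite mxE liftK.
by rewrite mxE; case: unliftP => [j ->|->].
Qed.

Lemma lebesgue_rV_cube_lty d (a : 'rV[R]_d) (b : R) :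
  (lebesgue_rV R d [set x : 'rV[R]_d | forall i, (`|x ord0 i - a ord0 i| <= b)%R] < +oo)%E.
Proof.
have -> : [set x : 'rV[R]_d | forall i, `|x ord0 i - a ord0 i| <= b] =
    [set x : 'rV[R]_d | forall i, `[a ord0 i - b, a ord0 i + b]%classic (x ord0 i)].
  apply/seteqP; split=> x /= h i; have := h i.
    by rewrite in_itv /= ler_norml; move=> /andP[? ?]; apply/andP; split; lra.
  by rewrite in_itv /= ler_norml; move=> /andP[? ?]; apply/andP; split; lra.
rewrite (@lebesgue_rV_box d (fun i => `[a ord0 i - b, a ord0 i + b]%classic))//.
(* For [b < 0] the intervals are empty, whence the maximum with 0. *)
rewrite (eq_bigr (fun=> (Num.max 0 (b + b))%:E)).
  by rewrite -(big_morph EFin (@EFinM R) erefl) ltry.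
move=> i _; rewrite lebesgue_measure_itv /= lte_fin.
have -> : (a ord0 i - b < a ord0 i + b) = (0 < b + b) by apply/idP/idP => ?; lra.
case: ltrP => h //.
by rewrite -EFinD; congr EFin; ring.
Qed.

Lemma mx_norm_coord d (x : 'rV[R]_d) (i : 'I_d) : `|x ord0 i| <= `|x|.
Proof.
rewrite [leRHS]/Num.norm /= mx_normrE.
have := @le_bigmax_cond _ R _ 0 (ord0, i) xpredT (fun p : 'I_1 * 'I_d => `|x p.1 p.2|) isT.
by [].
Qed.

Lemma lebesgue_rV_compact_lty d (K : set 'rV[R]_d) : compact K ->
  (lebesgue_rV R d K < +oo)%E.
Proof.
move=> cK; have [M [_ hM]] := compact_bounded cK.
have mK := compact_measurable_rV cK.
apply: (le_lt_trans _ (lebesgue_rV_cube_lty (0 : 'rV[R]_d) (M + 1))).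
apply: le_measure; rewrite ?inE//.
  have -> : [set x : 'rV[R]_d | forall i, `|x ord0 i - (0 : 'rV[R]_d) ord0 i| <= M + 1] =
      [set x : 'rV[R]_d | forall i, `[- (M + 1), M + 1]%classic (x ord0 i)].
    apply/seteqP; split=> x /= h i; have := h i; rewrite mxE subr0 ler_norml in_itv /= ?bnd_simp.
    by [].
    by [].
  exact: (@measurable_rV_box d (fun=> `[- (M + 1), M + 1]%classic)).
move=> x Kx i; rewrite /= mxE subr0.
have := hM (M + 1); rewrite ltrDl ltr01 => /(_ isT _ Kx).
apply: le_trans; exact: mx_norm_coord.
Qed.

End rV_measure_theory.

(** * Plancherel's inequality for functions vanishing off the unit cube *)

Section bessel.
Context {R : realType}.
Local Notation RT := (measurableTypeR R).
Local Notation lam := (@lebesgue_measure R).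

Definition fourier1 (G : RT -> R[i]) (t : R) : R[i] :=
  cI lam (fun x : RT => expi (- (2 * pi * ((x : R) * t))) * G x).

(** Exponentials truncated to an interval of length 1: those whose frequencies [a] differ by
    multiples of 2 pi are orthonormal. *)
Let Ec (c : R) (a : R) (x : RT) : R[i] := (\1_`[c, c + 1]%classic (x : R))%:C * expi (a * (x : R)).

Let measurable_lin (a : R) : measurable_fun [set: RT] (fun x : RT => a * (x : R)).
Proof. by apply: measurable_funM => //; exact: measurable_cst. Qed.

Let cmeas_Ec c a : cmeas (Ec c a).
Proof.
apply: cmeasM; first by apply: cmeas_real; apply: measurable_indic.
by apply: cmeas_expi.
Qed.

Let sqn_Ec c a : (sqn lam (Ec c a) < +oo)%E.
Proof.
apply: (@le_lt_trans _ _ (\int[lam]_x (\1_`[c, (c + 1)%R]%classic x)%:E)%E).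
  apply: ge0_le_integral => //.
  - by move=> x _; rewrite lee_fin sqr_ge0.
  - by apply/measurable_EFinP; exact: measurable_cmod2.
  - by apply/measurable_EFinP; exact: measurable_indic.
  - move=> x _; rewrite lee_fin /Ec cmodM cmod_expi mulr1 cmod_real.
    by rewrite indicE; case: (_ \in _) => /=; rewrite ?normr1 ?expr1n ?normr0 ?expr0n.
rewrite integral_indic//= setIT lebesgue_measure_itv /= lte_fin ltrDl ltr01.
by rewrite -EFinD ltry.
Qed.

Let integral_Ec c (h : R -> R) : measurable_fun [set: R] h ->
  (\int[lam]_x (\1_`[c, c + 1]%classic (x : R) * h x) =
   \int[lam]_(x in `[c, c + 1]) h x)%R.
Proof.
move=> mh; rewrite [RHS]Rintegral_mkcond; apply: eq_Rintegral => x _.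
by rewrite patchE indicE; case: (_ \in _); rewrite ?mul1r ?mul0r.
Qed.

Let integral_trig (a c : R) (f F : R -> R) : continuous f ->
  (forall x : R, is_derive x 1 F (f x)) -> F (c + 1) = F c ->
  (\int[lam]_(x in `[c, (c + 1)%R]) f x)%R = 0.
Proof.
move=> cf dF Fc; rewrite /Rintegral (@continuous_FTC2 _ f F c (c + 1))//.
- by rewrite Fc -EFinB subrr.
- by rewrite ltrDl.
- by apply: continuous_subspaceT => x; exact: cf.
- have cF : continuous F.
    by move=> x; apply: differentiable_continuous; apply/derivable1_diffP.
  split => //.
  + by apply: cvg_at_right_filter; exact: cF.
  + by apply: cvg_at_left_filter; exact: cF.
- by move=> x _; rewrite derive1E; exact: derive_val.
Qed.

(** As [expi a = 1], the antiderivatives of the real and imaginary parts take equal values at [c]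
    and [c + 1]. *)
Let cI_Ec0 (c a : R) : a != 0 -> expi a = 1 -> cI lam (Ec c a) = 0.
Proof.
move=> a0 ea.
have per : expi (a * (c + 1)) = expi (a * c) by rewrite mulrDr mulr1 expiD ea mulr1.
have dlin (x : R) : is_derive x 1 ( *%R a) a.
  have := @is_deriveZ R R R (@idfun R) a x 1 1 (is_derive_id _ _).
  by rewrite /GRing.scale /= mulr1.
have clin : continuous ( *%R a) by exact: mulrl_continuous.
apply: complex_eqP; rewrite /cI /=.
  rewrite (_ : (fun x => _) = fun x : RT => \1_`[c, c + 1]%classic (x : R) * cos (a * x)).
    rewrite integral_Ec; last first.
      by apply: measurableT_comp (measurable_lin a); apply: continuous_measurable_fun;
        exact: continuous_cos.
    apply: (@integral_trig a c _ (fun x => a^-1 * sin (a * x))).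
    - by move=> x; apply: continuous_comp; [exact: clin|exact: continuous_cos].
    - move=> x.
      have h := @is_derive1_comp R sin ( *%R a) x _ _ (is_derive_sin _) (dlin x).
      have := @is_deriveZ R R R (sin \o ( *%R a)) a^-1 x 1 _ h.
      by rewrite /GRing.scale /= [cos _ * a]mulrC mulKf.
    - by congr (_ * _); exact: (congr1 im per).
  by apply/funext => x; rewrite mul0r subr0.
rewrite (_ : (fun x => _) = fun x : RT => \1_`[c, c + 1]%classic (x : R) * sin (a * x)).
  rewrite integral_Ec; last first.
    by apply: measurableT_comp (measurable_lin a); apply: continuous_measurable_fun;
      exact: continuous_sin.
  apply: (@integral_trig a c _ (fun x => - a^-1 * cos (a * x))).
  - by move=> x; apply: continuous_comp; [exact: clin|exact: continuous_sin].
  - move=> x.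
    have h := @is_derive1_comp R cos ( *%R a) x _ _ (is_derive_cos _) (dlin x).
    have := @is_deriveZ R R R (cos \o ( *%R a)) (- a^-1) x 1 _ h.
    by rewrite /GRing.scale /= mulNr [- _ * a]mulrC mulrN mulrN opprK mulKf.
  - by congr (_ * _); exact: (congr1 re per).
by apply/funext => x; rewrite mul0r addr0.
Qed.

Let cI_Ec1 (c : R) : cI lam (Ec c 0) = 1.
Proof.
rewrite (_ : Ec c 0 = fun x : RT => (\1_`[c, c + 1]%classic (x : R))%:C); last first.
  by apply/funext => x; rewrite /Ec mul0r expi0 mulr1.
apply: complex_eqP; rewrite /cI /=; last by rewrite /Rintegral integral0.
rewrite /Rintegral integral_indic//= setIT lebesgue_measure_itv /= lte_fin ltrDl ltr01.
by rewrite -EFinD /=; ring.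
Qed.

Let mul_Ec c a b x : Ec c a x * conjc (Ec c b x) = Ec c (a - b) x.
Proof.
rewrite /Ec conjcM conjc_real conjc_expi mulrACA -realcM -expiD mulrBl.
by congr (_%:C * _); rewrite indicE; case: (_ \in _); rewrite ?mulr1 ?mulr0.
Qed.

Lemma expi_2pi_nat (n : nat) : expi (2 * pi * n%:R) = 1 :> R[i].
Proof.
elim: n => [|n ih]; first by rewrite mulr0 expi0.
rewrite -[n.+1%:R]natr1 mulrDr expiD ih mul1r mulr1 mulr_natl.
by apply: complex_eqP; rewrite /expi /= ?cos2pi ?sin2pi.
Qed.

(** Bessel's inequality: [fourier1 G (t + k)] is the coefficient of [G] along [e k], and for each
    fixed [t] the [e k] are orthonormal. The freedom in [t] serves to integrate over a period
    afterwards. *)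
Lemma bessel (c t : R) (M : nat) (G : RT -> R[i]) : cmeas G ->
  (forall x : R, ~ `[c, c + 1]%classic x -> G x = 0) -> (sqn lam G < +oo)%E ->
  ((\sum_(k < M) cmod (fourier1 G (t + k%:R)) ^+ 2)%:E <= sqn lam G)%E.
Proof.
move=> mG G0 Goo.
pose e (k : nat) := Ec c (2 * pi * (t + k%:R)).
pose z (k : nat) := fourier1 G (t + k%:R).
pose S x := \sum_(k < M) z k * e k x.
have me k : cmeas (e k) by exact: cmeas_Ec.
have eoo k : (sqn lam (e k) < +oo)%E by exact: sqn_Ec.
have mJ f : cmeas f -> cmeas (fun x : RT => conjc (f x)) by exact: cmeasJ.
have sJ f : sqn lam (fun x : RT => conjc (f x)) = sqn lam f.
  by apply: eq_integral => x _; rewrite cmodJ.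
have iGe k : cinteg lam (fun x => G x * conjc (e k x)).
  by apply: cinteg_mulJ => //; [exact: mJ|rewrite sJ].
have iee k l : cinteg lam (fun x => e k x * conjc (e l x)).
  by apply: cinteg_mulJ => //; [exact: mJ|rewrite sJ].
have Ge k : cI lam (fun x => G x * conjc (e k x)) = z k.
  apply: eq_cI => x; rewrite mulrC /e /Ec conjcM conjc_real conjc_expi.
  have [xI|xI] := pselect (`[c, c + 1]%classic (x : R)).
    by rewrite indicE mem_set// mul1r; congr (expi _ * _); ring.
  by rewrite G0// !mulr0.
have ee k l : cI lam (fun x => e k x * conjc (e l x)) = (k == l)%:R.
  rewrite (eq_cI _ (mul_Ec c _ _)) -mulrBr.
  have [->|kl] := eqVneq k l; first by rewrite subrr mulr0 cI_Ec1.
  apply: cI_Ec0.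
    apply: mulf_neq0; first by rewrite mulf_neq0 ?pnatr_eq0// gt_eqF ?pi_gt0.
    by rewrite opprD addrACA subrr add0r subr_eq0 eqr_nat.
  rewrite opprD addrACA subrr add0r mulrBr expiD expi_2pi_nat mul1r.
  by rewrite -conjc_expi expi_2pi_nat conjc1.
have iGS : cinteg lam (fun x => G x * conjc (S x)).
  rewrite (_ : (fun _ => _) = fun x => \sum_(k < M) conjc (z k) * (G x * conjc (e k x))).
    by apply: cinteg_sum => k _; exact: cintegZ.
  apply/funext => x; rewrite /S conjc_sum mulr_sumr; apply: eq_bigr => k _.
  by rewrite conjcM mulrCA.
have GS : cI lam (fun x => G x * conjc (S x)) = (\sum_(k < M) cmod (z k) ^+ 2)%:C.
  rewrite (eq_cI _ (g := fun x => \sum_(k < M) conjc (z k) * (G x * conjc (e k x)))).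
    rewrite cI_sum; last by move=> k _; exact: cintegZ.
    rewrite realc_sum; apply: eq_bigr => k _.
    by rewrite cIZ// Ge mulrC mulJ_cmod.
  move=> x; rewrite /S conjc_sum mulr_sumr; apply: eq_bigr => k _.
  by rewrite conjcM mulrCA.
have SSE x : S x * conjc (S x) =
   \sum_(k < M) \sum_(l < M) (z k * conjc (z l)) * (e k x * conjc (e l x)).
  rewrite /S conjc_sum mulr_suml; apply: eq_bigr => k _.
  rewrite mulr_sumr; apply: eq_bigr => l _.
  by rewrite conjcM mulrACA.
have iSS : cinteg lam (fun x => S x * conjc (S x)).
  rewrite (funext SSE).
  by apply: cinteg_sum => k _; apply: cinteg_sum => l _; exact: cintegZ.
have SS : cI lam (fun x => S x * conjc (S x)) = (\sum_(k < M) cmod (z k) ^+ 2)%:C.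
  rewrite (eq_cI _ SSE) cI_sum; last first.
    by move=> k _; apply: cinteg_sum => l _; exact: cintegZ.
  rewrite realc_sum; apply: eq_bigr => k _.
  rewrite cI_sum; last by move=> l _; exact: cintegZ.
  have El (l : 'I_M) : cI lam (fun x => z k * conjc (z l) * (e k x * conjc (e l x))) =
      z k * conjc (z l) * (k == l)%:R.
    by rewrite cIZ// ee.
  rewrite (eq_bigr _ (fun l _ => El l)) (bigD1 k)// eqxx mulr1 mulJ_cmod.
  rewrite big1; first exact: addr0.
  by move=> l lk; rewrite eq_sym (negbTE lk) mulr0.
have iGG : cinteg lam (fun x => G x * conjc (G x)).
  by apply: cinteg_mulJ => //; [exact: mJ|rewrite sJ].
have iSG : cinteg lam (fun x => S x * conjc (G x)).
  rewrite (_ : (fun _ => _) = fun x => conjc (G x * conjc (S x))).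
    exact: cintegJ.
  by apply/funext => x; rewrite rmorphM /= conjcK mulrC.
have SG : cI lam (fun x => S x * conjc (G x)) = (\sum_(k < M) cmod (z k) ^+ 2)%:C.
  rewrite -[RHS]conjc_real -GS -cIJ//; apply: eq_cI => x.
  by rewrite conjcM conjcK mulrC.
(* Each of the three products in the bracket has integral [\sum_k |z k|^2], hence so has the
   bracket; the integral of [|G - S|^2] is dropped at the end. *)
have E x : G x * conjc (G x) = (G x - S x) * conjc (G x - S x) +
    (S x * conjc (G x) + G x * conjc (S x) - S x * conjc (S x)).
  by rewrite conjcB; ring.
have iD : cinteg lam (fun x => (G x - S x) * conjc (G x - S x)).
  rewrite (_ : (fun _ => _) = fun x => G x * conjc (G x) -
    (S x * conjc (G x) + G x * conjc (S x) - S x * conjc (S x))).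
    by apply: cintegB => //; apply: cintegB => //; exact: cintegD.
  by apply/funext => x; rewrite E addrK.
have : cI lam (fun x => G x * conjc (G x)) =
   cI lam (fun x => (G x - S x) * conjc (G x - S x)) + (\sum_(k < M) cmod (z k) ^+ 2)%:C.
  rewrite (eq_cI _ E) cID//; last by apply: cintegB => //; exact: cintegD.
  by rewrite cIB//; [rewrite cID// SG GS SS addrK|exact: cintegD].
move/(congr1 re); rewrite reD /=.
have reG : sqn lam G = (\int[lam]_x re (G x * conjc (G x)))%:E.
  rewrite /Rintegral fineK; last exact: (integrable_fin_num measurableT iGG.1).
  by apply: eq_integral => x _; rewrite mulJ_cmod.
rewrite reG => ->; rewrite lee_fin lerDr; apply: Rintegral_ge0 => x _.
by rewrite mulJ_cmod /= sqr_ge0.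
Qed.

End bessel.

Section tiling.
Context {R : realType}.
Local Notation RT := (measurableTypeR R).
Local Notation lam := (@lebesgue_measure R).
Local Notation shift k := ((fun x : R => x + k) : RT -> RT).

Let measurable_shift (k : R) : measurable_fun [set: RT] (shift k).
Proof. by apply: (@measurable_funD _ RT R) => //; exact: measurable_cst. Qed.

Lemma lebesgue_measure_shift (k : R) (A : set RT) : measurable A ->
  pushforward lam (shift k) A = lam A.
Proof.
move=> mA; apply/esym/lebesgue_measure_unique => //= _ [[a b]] _ <-.
rewrite /pushforward /=.
rewrite (_ : _ @^-1` _ = `](a - k), (b - k)]%classic).
  rewrite !lebesgue_measure_itv /= !lte_fin ltrD2r.
  by case: ifP => // _; rewrite -!EFinD; congr EFin; ring.
by apply/seteqP; split=> x /=; rewrite !in_itv /= ltrBlDr lerBrDr.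
Qed.

Lemma ge0_integral_shift (k : R) (f : R -> \bar R) (D : set R) :
  measurable (D : set RT) ->
  measurable_fun [set: RT] (f : RT -> _) -> (forall x, 0 <= f x)%E ->
  (\int[lam]_(x in D) f x = \int[lam]_(x in (shift k) @^-1` D) f (x + k)%R)%E.
Proof.
move=> mD mf f0.
have h := ge0_integral_pushforward (measurable_shift k) lam mD
  (measurable_funTS mf) (fun x _ => f0 x).
rewrite -[RHS]h; apply: eq_measure_integral => A mA _.
by rewrite /= lebesgue_measure_shift.
Qed.

(** Cut the line into unit intervals and translate them onto one: the integral over an interval of
    length [M] is the integral over an interval of length 1 of a sum of [M] translates, each such
    sum being at most [B]. *)
Lemma integral_tiling_le (f : R -> R) (B : R) :
  measurable_fun [set: R] f -> (forall x, 0 <= f x) ->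
  (forall t (M : nat), \sum_(k < M) f (t + k%:R) <= B) ->
  (\int[lam]_x (f x)%:E <= B%:E)%E.
Proof.
move=> mf f0 fB.
have mfE : measurable_fun [set: RT] (EFin \o f : RT -> \bar R).
  by apply/measurable_EFinP.
have mfk (k : R) : measurable_fun [set: RT] (fun x : RT => f (x + k)).
  exact: (measurableT_comp (mf : measurable_fun [set: RT] (f : RT -> R)) (measurable_shift k)).
have mS (M : nat) : measurable_fun [set: RT] (fun x : RT => \sum_(k < M) f (x + k%:R)).
  by apply: measurable_sum => k; exact: mfk.
have step (a : R) (M : nat) :
    (\int[lam]_(x in `[a, (a + M%:R)%R[) (f x)%:E =
     \int[lam]_(x in `[a, (a + 1)%R[) (\sum_(k < M) f (x + k%:R))%:E)%E.
  elim: M => [|M ih].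
    rewrite addr0 set_itvco0 integral_set0 integral0_eq// => x _.
    by rewrite big_ord0.
  rewrite (@itv_bndbnd_setU _ _ _ (BLeft (a + M%:R))); last 2 first.
    by rewrite bnd_simp lerDl.
    by rewrite bnd_simp lerD2l ler_nat.
  rewrite ge0_integral_setU//=; last 3 first.
  - exact: measurable_funTS.
  - by move=> x _; rewrite lee_fin.
  - apply/disj_setPS => x [] /=; rewrite !in_itv /= => /andP[_ h1] /andP[h2 _].
    by move: (lt_le_trans h1 h2); rewrite ltxx.
  rewrite ih (@ge0_integral_shift M%:R _ `[(a + M%:R), (a + M.+1%:R)[%classic)//.
  rewrite (_ : _ @^-1` _ = `[a, a + 1[%classic); last first.
    by apply/seteqP; split=> x /=; rewrite !in_itv /= lerD2r -[M.+1%:R]natr1 addrA [a + M%:R +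
      1]addrAC ltrD2r.
  rewrite -ge0_integralD//=.
  - by apply: eq_integral => x _; rewrite big_ord_recr.
  - by move=> x _; rewrite lee_fin sumr_ge0.
  - by apply/measurable_EFinP; exact: (measurable_funTS (mS M)).
  - by move=> x _; rewrite lee_fin.
  - by apply/measurable_EFinP; exact: (measurable_funTS (mfk M%:R)).
(* The interval [[-N, N)] in the shape required by [step]; these exhaust the line. *)
have bound (N : nat) : (\int[lam]_(x in `[(- N%:R)%R, (- N%:R + (N + N)%:R)%R[) (f x)%:E <= B%:E)%E.
  rewrite step.
  apply: (@le_trans _ _ (\int[lam]_(x in `[(- N%:R)%R, (- N%:R + 1)%R[) B%:E)%E).
    apply: ge0_le_integral => //.
    - by move=> x _; rewrite lee_fin sumr_ge0.
    - by apply/measurable_EFinP; exact: (measurable_funTS (mS _)).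
    - by move=> x _; rewrite lee_fin.
  rewrite integral_cst//= lebesgue_measure_itv /= lte_fin ltrDl ltr01 -EFinD -EFinM lee_fin.
  by rewrite addrAC subrr add0r mulr1.
have EN (N : nat) : - N%:R + (N + N)%:R = N%:R :> R by rewrite natrD; ring.
have cup : \bigcup_N `[(- N%:R : R), (- N%:R + (N + N)%:R)[%classic = setT.
  apply/seteqP; split=> // x _; exists (Num.truncn `|x|).+1 => //=.
  rewrite EN in_itv /=; have := truncnS_gt `|x|.
  by rewrite ltr_norml => /andP[h1 h2]; rewrite h2 (ltW h1).
have h := @ge0_nondecreasing_set_cvg_integral _ RT R
  (fun N => `[(- N%:R : R), (- N%:R + (N + N)%:R)[%classic) (EFin \o f) lam.
rewrite -cup; apply: cvge_le (h _ _ _ _).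
- by apply: nearW => N; exact: bound.
- apply/nondecreasing_seqP => N; apply/subsetPset => x /=; rewrite !EN !in_itv /=.
  move=> /andP[h1 h2]; rewrite -[N.+1%:R]natr1; apply/andP; split; lra.
- by [].
- by move=> N; exact: measurable_funTS.
- by move=> N x _; rewrite lee_fin.
Qed.

End tiling.

Section plancherel1.
Context {R : realType}.
Local Notation RT := (measurableTypeR R).
Local Notation lam := (@lebesgue_measure R).

Lemma cmeas_fourier1 (G : RT -> R[i]) : cmeas G -> cmeas (fourier1 G : RT -> R[i]).
Proof.
move=> [m1 m2].
apply: (@cmeas_param_cI _ _ RT RT R lam (fun p : RT * RT =>
  expi (- (2 * pi * ((p.2 : R) * (p.1 : R)))) * G p.2)).
apply: cmeasM; last first.
  by split; [exact: (measurableT_comp m1 measurable_snd)|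
    exact: (measurableT_comp m2 measurable_snd)].
apply: cmeas_expi; apply: measurable_funN; apply: measurable_funM => //.
by apply: measurable_funM; [exact: measurable_snd|exact: measurable_fst].
Qed.

(** The sums over integer translates of [|fourier1 G|^2] are sums of squared Fourier coefficients,
    which Bessel's inequality bounds uniformly; tiling turns this bound into one of the integral. *)
Lemma plancherel1_le (c : R) (G : RT -> R[i]) : cmeas G ->
  (forall x : R, ~ `[c, c + 1]%classic x -> G x = 0) ->
  (sqn lam (fourier1 G : RT -> R[i]) <= sqn lam G)%E.
Proof.
move=> mG G0; have [Goo|] := ltP (sqn lam G) +oo%E; last first.
  by rewrite leye_eq => /eqP ->; rewrite leey.
have Gfin : sqn lam G \is a fin_num by rewrite ge0_fin_numE// sqn_ge0.
rewrite -(fineK Gfin) /sqn.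
apply: (@integral_tiling_le R (fun t => cmod (fourier1 G t) ^+ 2)).
- by have := measurable_cmod2 (cmeas_fourier1 mG).
- by move=> x; rewrite sqr_ge0.
- by move=> t M; rewrite -lee_fin fineK//; exact: (bessel (c := c)).
Qed.

End plancherel1.

Section ae_complex.
Context {disp : measure_display} {T : measurableType disp} {R : realType}.
Variable mu : {measure set T -> \bar R}.

Lemma ae_eq_cI (f g : T -> R[i]) : cmeas f -> cmeas g ->
  {ae mu, forall x, f x = g x} -> cI mu f = cI mu g.
Proof.
move=> [f1 f2] [g1 g2] fg; apply: complex_eqP; rewrite /cI /= /Rintegral;
  congr fine; apply: ae_eq_integral => //; try (exact/measurable_EFinP);
  by apply: filterS fg => x /= ->.
Qed.

Lemma cinteg_sqn_off (K : set T) (f : T -> R[i]) : measurable K -> (mu K < +oo)%E ->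
  cmeas f -> (forall x, ~ K x -> f x = 0) -> (sqn mu f < +oo)%E -> cinteg mu f.
Proof.
move=> mK Koo mf f0 foo.
have mI : cmeas (fun x => (\1_K x)%:C : R[i]).
  by apply: cmeas_real; exact: measurable_indic.
rewrite (_ : f = fun x => f x * (\1_K x)%:C); last first.
  apply/funext => x; have [xK|xK] := pselect (K x); last by rewrite f0// mul0r.
  by rewrite indicE mem_set// mulr1.
apply: cinteg_mulJ => //.
rewrite (_ : sqn _ _ = \int[mu]_x (\1_K x)%:E)%E.
  by rewrite integral_indic// setIT.
apply: eq_integral => x _; rewrite cmod_real indicE.
by case: (_ \in _); rewrite ?normr1 ?expr1n ?normr0 ?expr0n.
Qed.

End ae_complex.

Section fourier_rV.
Context {R : realType}.
Local Notation RT := (measurableTypeR R).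
Local Notation lam := (@lebesgue_measure R).
Local Notation leb d := (lebesgue_rV R d).

Lemma measurable_dotr d : measurable_fun [set: 'rV[R]_d * 'rV[R]_d]
  (fun p => dotr p.1 p.2).
Proof.
apply: measurable_sum => i; apply: measurable_funM.
  exact: (measurableT_comp (@measurable_rV_coord R d i) measurable_fst).
exact: (measurableT_comp (@measurable_rV_coord R d i) measurable_snd).
Qed.

Lemma dotrC d (x y : 'rV[R]_d) : dotr x y = dotr y x.
Proof. by apply: eq_bigr => i _; rewrite mulrC. Qed.

Lemma cmeas_kernel d :
  cmeas (fun p : 'rV[R]_d * 'rV[R]_d => expi (- (2 * pi * dotr p.1 p.2)) : R[i]).
Proof.
apply: cmeas_expi; apply: measurable_funN; apply: measurable_funM => //.
exact: measurable_dotr.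
Qed.

Lemma cmeas_snd d1 d2 (T1 : measurableType d1) (T2 : measurableType d2) (f : T2 -> R[i]) :
  cmeas f -> cmeas (fun p : T1 * T2 => f p.2).
Proof.
by move=> [m1 m2]; split; [exact: (measurableT_comp m1 measurable_snd)|
  exact: (measurableT_comp m2 measurable_snd)].
Qed.

Lemma cmeas_comp d1 d2 (T1 : measurableType d1) (T2 : measurableType d2) (f : T2 -> R[i])
  (h : T1 -> T2) : cmeas f -> measurable_fun [set: T1] h -> cmeas (fun x => f (h x)).
Proof.
by move=> [m1 m2] mh; split; [exact: (measurableT_comp m1 mh)|
  exact: (measurableT_comp m2 mh)].
Qed.

Lemma cmeas_kernelr d (xi : 'rV[R]_d) :
  cmeas (fun x => expi (- (2 * pi * dotr x xi)) : R[i]).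
Proof.
apply: (cmeas_comp (cmeas_kernel d) (h := fun x => (x, xi))).
exact: measurable_pair2.
Qed.

Lemma cmeas_fourier d (f : 'rV[R]_d -> R[i]) : cmeas f -> cmeas (fourier f).
Proof.
move=> mf; apply: (@cmeas_param_cI _ _ _ _ R (leb d) (fun p : 'rV[R]_d * 'rV[R]_d =>
  expi (- (2 * pi * dotr p.2 p.1)) * f p.2)).
apply: cmeasM; last exact: cmeas_snd.
under eq_fun do rewrite dotrC.
exact: cmeas_kernel.
Qed.

Lemma cinteg_kernel d (f : 'rV[R]_d -> R[i]) (xi : 'rV[R]_d) : cinteg (leb d) f ->
  cinteg (leb d) (fun x => expi (- (2 * pi * dotr x xi)) * f x).
Proof.
move=> fi; apply: (cinteg_le _ fi).
  by apply: cmeasM; [exact: cmeas_kernelr|case/cintegP: fi].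
by move=> x; rewrite cmodM cmod_expi mul1r.
Qed.

Lemma dotr_cons d (p q : R * 'rV[R]_d) :
  dotr (rV_cons p) (rV_cons q) = p.1 * q.1 + dotr p.2 q.2.
Proof.
rewrite /dotr big_ord_recl !mxE unlift_none; congr (_ + _).
by apply: eq_bigr => i _; rewrite !mxE liftK.
Qed.

Definition unit_cube d (c x : 'rV[R]_d) := forall i, c ord0 i <= x ord0 i <= c ord0 i + 1.

Lemma unit_cube_sub d (c : 'rV[R]_d) :
  unit_cube c = [set x | forall i, `[c ord0 i, c ord0 i + 1]%classic (x ord0 i)].
Proof. by apply/seteqP; split=> x h i; have := h i; rewrite /= in_itv. Qed.

Lemma measurable_unit_cube d (c : 'rV[R]_d) : measurable (unit_cube c).
Proof.
by rewrite unit_cube_sub; exact: (@measurable_rV_box R d (fun i => `[c ord0 i, c ord0 i + 1]%classic)).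
Qed.

Lemma unit_cube_lty d (c : 'rV[R]_d) : (leb d (unit_cube c) < +oo)%E.
Proof.
rewrite unit_cube_sub (@lebesgue_rV_box R d (fun i => `[c ord0 i, c ord0 i + 1]%classic))//.
rewrite (eq_bigr (fun=> 1%:E)); first by rewrite big1// ltry.
move=> i _; rewrite lebesgue_measure_itv /= lte_fin ltrDl ltr01 -EFinD.
by rewrite addrAC subrr add0r.
Qed.

(** Fubini splits off the first variable. The sections of [f] are integrable for almost every [s]
    only, so the scalar [expi] factor can be taken out of the inner integral only almost
    everywhere. *)
Let fourier_cons d (f : 'rV[R]_d.+1 -> R[i]) (t : R) (xi : 'rV[R]_d) :
  cinteg (leb d.+1) f ->
  fourier f (rV_cons (t, xi)) =
  fourier1 (fun s : RT => fourier (fun x => f (rV_cons (s : R, x))) xi) t.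
Proof.
move=> fi; have [mf _] := (cintegP _ _).1 fi.
have ki := cinteg_kernel (rV_cons (t, xi)) fi.
have kc := cinteg_rV_cons ki.
transitivity (cI (leb d.+1) (fun x => expi (- (2 * pi * dotr x (rV_cons (t, xi)))) * f x)).
  by [].
rewrite (cI_rV_cons ki) -(cI12 kc).
have mfc : cmeas (fun p : RT * 'rV[R]_d => f (rV_cons p)).
  exact: (cmeas_comp mf (@measurable_rV_consR R d)).
have [kc1 kc2] := kc.
have mleft : cmeas (fun s : RT => fourier (fun x => f (rV_cons (s : R, x))) xi).
  apply: (@cmeas_param_cI _ _ RT _ R (leb d) (fun p : RT * 'rV[R]_d =>
    expi (- (2 * pi * dotr p.2 xi)) * f (rV_cons p))).
  by apply: cmeasM => //; exact: (@cmeas_snd _ _ RT _ _ (cmeas_kernelr xi)).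
apply: ae_eq_cI.
- exact: (cmeas_param_cI (leb d) ((cintegP _ _).1 kc).1).
- apply: cmeasM => //; apply: cmeas_expi; apply: measurable_funN.
  apply: measurable_funM => //; apply: measurable_funM => //.
- have h1 := ae_integrable1 kc1; have h2 := ae_integrable1 kc2.
  apply: filterS2 h1 h2 => s i1 i2.
  have -> : fourier (fun x => f (rV_cons (s : R, x))) xi =
      expi (2 * pi * (s * t)) * cI (leb d) (fun y =>
       expi (- (2 * pi * dotr (rV_cons (s : R, y)) (rV_cons (t, xi)))) * f (rV_cons (s : R, y))).
    rewrite -cIZ; last by split; [exact: i1|exact: i2].
    apply: eq_cI => x; rewrite mulrA -expiD dotr_cons /=; congr (_ * _).
    by congr expi; ring.
  by rewrite mulrA -expiD addrC subrr expi0 mul1r.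
Qed.

(** Induction on the dimension: the one-dimensional inequality in the first variable at fixed [xi],
    Tonelli, then the induction hypothesis in the other variables at fixed [s]. In dimension 0 the
    measure is a Dirac mass and [fourier f = f]. *)
Lemma plancherel_le d (c : 'rV[R]_d) (f : 'rV[R]_d -> R[i]) : cmeas f ->
  (forall x, ~ unit_cube c x -> f x = 0) ->
  (sqn (leb d) (fourier f) <= sqn (leb d) f)%E.
Proof.
elim: d c f => [|d ih] c f mf f0.
  rewrite /sqn; apply: ge0_le_integral => //.
  - by move=> x _; rewrite lee_fin sqr_ge0.
  - by apply/measurable_EFinP; apply: measurable_cmod2; exact: cmeas_fourier.
  - by apply/measurable_EFinP; exact: measurable_cmod2.
  move=> xi _.
  have -> : fourier f xi = f xi.
    rewrite /fourier -[LHS]/(cI _ _); apply: complex_eqP; rewrite /cI /= /Rintegral.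
      rewrite integral_dirac//=.
        rewrite indicE in_setT mul1r /dotr big_ord0 mulr0 oppr0 expi0 mul1r.
        by congr (re (f _)); apply/rowP => -[].
      by apply/measurable_EFinP; case: (cmeasM (cmeas_kernelr xi) mf).
    rewrite integral_dirac//=.
      rewrite indicE in_setT mul1r /dotr big_ord0 mulr0 oppr0 expi0 mul1r.
      by congr (im (f _)); apply/rowP => -[].
    by apply/measurable_EFinP; case: (cmeasM (cmeas_kernelr xi) mf).
  exact: lexx.
have [foo|] := ltP (sqn (leb d.+1) f) +oo%E; last first.
  by rewrite leye_eq => /eqP ->; rewrite leey.
have fi : cinteg (leb d.+1) f.
  exact: (cinteg_sqn_off (measurable_unit_cube c) (unit_cube_lty c)).
have mfc : cmeas (fun p : RT * 'rV[R]_d => f (rV_cons p)).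
  exact: (cmeas_comp mf (@measurable_rV_consR R d)).
(* Partial Fourier transform in all variables but the first, intermediate between [f] and
   [fourier f]. *)
pose W (p : RT * 'rV[R]_d) := fourier (fun x => f (rV_cons (p.1 : R, x))) p.2.
have mW : cmeas W.
  apply: (@cmeas_param_cI _ _ (RT * 'rV[R]_d)%type _ R (leb d)
    (fun q : (RT * 'rV[R]_d) * 'rV[R]_d =>
    expi (- (2 * pi * dotr q.2 q.1.2)) * f (rV_cons (q.1.1 : R, q.2)))).
  apply: cmeasM.
    apply: (cmeas_comp (cmeas_kernel d) (h := fun q : (RT * 'rV[R]_d) * 'rV[R]_d => (q.2, q.1.2))).
    by apply/measurable_fun_pairP; split; [exact: measurable_snd|
      exact: (measurableT_comp measurable_snd measurable_fst)].
  apply: (cmeas_comp mfc (h := fun q : (RT * 'rV[R]_d) * 'rV[R]_d => (q.1.1, q.2))).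
  by apply/measurable_fun_pairP; split; [exact: (measurableT_comp measurable_fst measurable_fst)|
    exact: measurable_snd].
have mWs xi : cmeas (fun s : RT => W (s, xi)).
  by apply: (cmeas_comp mW (h := fun s : RT => (s, xi))); exact: measurable_pair2.
have mWx s : cmeas (fun xi => W (s, xi)).
  by apply: (cmeas_comp mW (h := fun xi => (s, xi))); exact: measurable_pair1.
have mF : cmeas (fun p : RT * 'rV[R]_d => fourier f (rV_cons p)).
  exact: (cmeas_comp (cmeas_fourier mf) (@measurable_rV_consR R d)).
have sm (T : measurableType _) (h : T -> R[i]) : cmeas h ->
    measurable_fun setT (fun x => (cmod (h x) ^+ 2)%:E).
  by move=> mh; apply/measurable_EFinP; exact: measurable_cmod2.
have sge (T : Type) (h : T -> R[i]) x : (0 <= (cmod (h x) ^+ 2)%:E)%E.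
  by rewrite lee_fin sqr_ge0.
rewrite /sqn ge0_integral_rV_cons//; last by apply: sm; exact: cmeas_fourier.
rewrite (fubini_tonelli2 (fun p : RT * 'rV[R]_d => (cmod (fourier f (rV_cons p)) ^+ 2)%:E))//;
  last exact: sm.
rewrite ge0_integral_rV_cons//; last exact: sm.
rewrite (fubini_tonelli1 (fun p : RT * 'rV[R]_d => (cmod (f (rV_cons p)) ^+ 2)%:E))//;
  last exact: sm.
apply: (@le_trans _ _ (\int[leb d]_xi \int[lam]_s (cmod (W (s, xi)) ^+ 2)%:E)%E).
  apply: ge0_le_integral => //.
  - by move=> xi _; apply: integral_ge0 => s _; exact: sge.
  - by apply: (measurable_fun_fubini_tonelli_G
      (fun p : RT * 'rV[R]_d => (cmod (fourier f (rV_cons p)) ^+ 2)%:E)) => //; exact: sm.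
  - by apply: (measurable_fun_fubini_tonelli_G
      (fun p : RT * 'rV[R]_d => (cmod (W p) ^+ 2)%:E)) => //; exact: sm.
  move=> xi _; rewrite /fubini_G /=.
  under eq_integral => t _ do rewrite fourier_cons//.
  apply: (@plancherel1_le R (c ord0 ord0) (fun s : RT => W (s, xi))) => //.
  move=> s /= nI; rewrite /W /= -[LHS]/(cI _ _) -[RHS](cI0 (leb d)).
  apply: eq_cI => x; rewrite f0 ?mulr0// => /(_ ord0); rewrite mxE unlift_none /=.
  by move=> h; apply: nI; rewrite in_itv.
rewrite -(fubini_tonelli (fun p : RT * 'rV[R]_d => (cmod (W p) ^+ 2)%:E))//; last exact: sm.
apply: ge0_le_integral => //.
- by move=> xi _; apply: integral_ge0 => s _; exact: sge.
- by apply: (measurable_fun_fubini_tonelli_F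
      (fun p : RT * 'rV[R]_d => (cmod (W p) ^+ 2)%:E)) => //; exact: sm.
- by apply: (measurable_fun_fubini_tonelli_F
      (fun p : RT * 'rV[R]_d => (cmod (f (rV_cons p)) ^+ 2)%:E)) => //; exact: sm.
move=> s _; rewrite /fubini_F /=.
apply: (ih (\row_j c ord0 (lift ord0 j)) (fun x => f (rV_cons (s : R, x)))).
  by apply: (cmeas_comp mfc (h := fun x => (s, x))); exact: measurable_pair1.
move=> x nx; apply: f0 => h; apply: nx => j; have := h (lift ord0 j).
by rewrite !mxE liftK.
Qed.

End fourier_rV.

(** * Weakly null sequences are bounded in L2 *)

(* Gliding hump: if [f n] were unbounded in L2, a lacunary series of normalised
   [f n] would be a test function on which [f n] does not converge. *)
Section uniform_boundedness.
Context {disp : measure_display} {T : measurableType disp} {R : realType}.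
Variable mu : {measure set T -> \bar R}.
Implicit Types (f g v : T -> R).
Local Notation I f := (\int[mu]_x f x)%R.

Definition L2r f := measurable_fun setT f /\
  mu.-integrable setT (EFin \o (fun x => f x ^+ 2)).

Lemma L2r_mul f g : L2r f -> L2r g ->
  mu.-integrable setT (EFin \o (fun x => f x * g x)).
Proof.
move=> [mf fi] [mg gi].
apply: (le_integrable measurableT _ _ (integrableD measurableT fi gi)) => //=.
  by apply/measurable_EFinP; exact: measurable_funM.
move=> x _; rewrite lee_fin normrM [leRHS]ger0_norm ?addr_ge0 ?sqr_ge0//.
rewrite -(real_normK (num_real (f x))) -(real_normK (num_real (g x))).
have := sqr_ge0 (`|f x| - `|g x|); rewrite sqrrB.
have := sqr_ge0 `|f x|; have := sqr_ge0 `|g x|; lra.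
Qed.

(** Pointwise, [|f g|] is at most [(b/a f^2 + a/b g^2) / 2], and the integral of this bound is
    exactly [a b]. *)
Lemma L2r_cauchy_schwarz f g (a b : R) : L2r f -> L2r g -> 0 < a -> 0 < b ->
  I (fun x => f x ^+ 2) = a ^+ 2 -> I (fun x => g x ^+ 2) = b ^+ 2 ->
  `|I (fun x => f x * g x)| <= a * b.
Proof.
move=> hf hg a0 b0 fa gb; have fg := L2r_mul hf hg.
have [[mf fi] [mg gi]] := (hf, hg).
have Zi (c : R) h : mu.-integrable setT (EFin \o h) ->
    mu.-integrable setT (EFin \o (fun x => c * h x)) by exact: integrableZl.
apply: (le_trans (le_normr_Rintegral measurableT fg)).
have E : a * b = I (fun x => (b / a / 2) * f x ^+ 2 + (a / b / 2) * g x ^+ 2).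
  rewrite RintegralD//; [|exact: Zi|exact: Zi].
  by rewrite !RintegralZl// fa gb; field; rewrite !gt_eqF.
rewrite E; apply: le_Rintegral => //.
- exact: (integrable_norm fg).
- exact: (integrableD measurableT (Zi _ _ fi) (Zi _ _ gi)).
- move=> x _; rewrite normrM.
  rewrite -(real_normK (num_real (f x))) -(real_normK (num_real (g x))).
  set y := `|f x|; set z := `|g x|.
  have -> : b / a / 2 * y ^+ 2 + a / b / 2 * z ^+ 2 =
      y * z + (b * y - a * z) ^+ 2 / (2 * a * b) by field; rewrite !gt_eqF.
  by rewrite lerDl divr_ge0 ?sqr_ge0// !mulr_ge0// ltW.
Qed.

(** Cauchy-Schwarz for the weights [p]: both sides are double sums with weights [p i * p j],
    compared by [y i * y j <= (y i ^+ 2 + y j ^+ 2) / 2]. *)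
Let ler_sum_sqr n (p y : nat -> R) : (forall i, 0 <= p i) ->
  (\sum_(i < n) p i * y i) ^+ 2 <=
  (\sum_(i < n) p i) * \sum_(i < n) p i * y i ^+ 2.
Proof.
move=> p0; rewrite expr2 !mulr_suml.
have -> : \sum_(i < n) p i * (\sum_(j < n) p j * y j ^+ 2) =
    \sum_(i < n) \sum_(j < n) p i * p j * ((y i ^+ 2 + y j ^+ 2) / 2).
  have E1 : \sum_(i < n) \sum_(j < n) p i * p j * y j ^+ 2 =
      \sum_(i < n) p i * (\sum_(j < n) p j * y j ^+ 2).
    by apply: eq_bigr => i _; rewrite mulr_sumr; apply: eq_bigr => j _; rewrite mulrA.
  have E2 : \sum_(i < n) \sum_(j < n) p i * p j * y i ^+ 2 =
      \sum_(i < n) \sum_(j < n) p i * p j * y j ^+ 2.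
    rewrite exchange_big /=; apply: eq_bigr => i _; apply: eq_bigr => j _.
    by rewrite [p j * p i]mulrC.
  rewrite -E1; transitivity ((\sum_(i < n) \sum_(j < n) p i * p j * y i ^+ 2 +
      \sum_(i < n) \sum_(j < n) p i * p j * y j ^+ 2) / 2).
    by rewrite E2; field.
  rewrite -big_split /= mulr_suml; apply: eq_bigr => i _.
  by rewrite -big_split /= mulr_suml; apply: eq_bigr => j _; field.
apply: ler_sum => i _; rewrite mulr_sumr; apply: ler_sum => j _.
rewrite mulrACA ler_wpM2l ?mulr_ge0// ler_pdivlMr//.
have := sqr_ge0 (y i - y j); rewrite sqrrB; lra.
Qed.

Let geo_sum (n : nat) : \sum_(i < n) (4^-1 : R) ^+ i <= 2.
Proof.
have -> : \sum_(i < n) (4^-1 : R) ^+ i = 4 / 3 * (1 - (4^-1) ^+ n).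
  elim: n => [|n ih]; first by rewrite big_ord0 expr0 subrr mulr0.
  by rewrite big_ord_recr /= ih exprS; field.
by have : 0 <= (4^-1 : R) ^+ n by []; lra.
Qed.

(* The series [sum_j 4^-j g_j] of functions of norm 1 has an L2 sum, tested
   against which integrals converge. *)
Let lacunary_series (g : nat -> T -> R) :
  (forall j, L2r (g j)) -> (forall j, I (fun x => g j x ^+ 2) = 1) ->
  exists v, L2r v /\ forall f, L2r f ->
    (fun m => I (fun x => f x * \sum_(j < m) (4^-1) ^+ j * g j x)) @ \oo -->
    I (fun x => f x * v x).
Proof.
move=> Lg g1; pose p j : R := (4^-1) ^+ j.
have p0 j : 0 <= p j by rewrite exprn_ge0.
(* [H], the sum of the [4^-j g_j^2], has integral at most 2, and by Cauchy-Schwarz [2 H] dominates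
   the squares of all partial sums. It yields almost everywhere convergence, square integrability of
   the limit, and the dominating function for the limit of the integrals. *)
pose h j x : \bar R := (p j * g j x ^+ 2)%:E.
have h0 j x : (0 <= h j x)%E by rewrite lee_fin mulr_ge0// sqr_ge0.
have mh j : measurable_fun setT (h j).
  apply/measurable_EFinP; apply: measurable_funM => //.
  by apply: measurable_funX; case: (Lg j).
pose H x := (\sum_(0 <= j <oo) h j x)%E.
have mH : measurable_fun setT H by apply: ge0_emeasurable_sum.
have H0 x : (0 <= H x)%E by apply: nneseries_ge0 => j _ _; exact: h0.
have Hm x m : (\sum_(j < m) h j x <= H x)%E.
  rewrite -(big_mkord xpredT (fun j => h j x)).
  exact: nneseries_lim_ge.
have inth j : (\int[mu]_x h j x = (p j)%:E)%E.
  have [_ gi] := Lg j.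
  rewrite (eq_integral (fun x => (p j)%:E * (g j x ^+ 2)%:E)%E)//.
  have E : (\int[mu]_x (g j x ^+ 2)%:E = 1%:E)%E.
    by rewrite -(g1 j) /Rintegral fineK// integrable_fin_num.
  by rewrite integralZl// E mule1.
have Hoo : (\int[mu]_x H x <= 2%:E)%E.
  rewrite integral_nneseries//; apply: lime_le.
    by apply: is_cvg_nneseries => j _ _; exact: integral_ge0.
  apply: nearW => m; rewrite (eq_bigr (fun j => (p j)%:E))//.
  by rewrite sumEFin lee_fin big_mkord geo_sum.
have Hi : mu.-integrable setT H.
  apply/integrableP; split => //.
  rewrite (eq_integral H); last by move=> x _; rewrite gee0_abs.
  exact: le_lt_trans Hoo (ltry _).
pose D := [set x | H x \is a fin_num].
have mD : measurable D.
  by have := emeasurable_fin_num measurableT mH; rewrite setTI.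
have aeD : {ae mu, forall x, D x}.
  by have := integrable_ae measurableT Hi; apply: filterS => x /= /(_ Logic.I).
pose S m x := \sum_(j < m) p j * g j x.
(* Cutting to the set where [H] is finite makes the partial sums converge at every point, so that
   the limit is measurable. *)
pose s m x := \1_D x * S m x.
have mg j : measurable_fun setT (g j) by case: (Lg j).
have mS m : measurable_fun setT (S m).
  by apply: measurable_sum => j; apply: measurable_funM.
have ms m : measurable_fun setT (s m).
  by apply: measurable_funM => //; exact: measurable_indic.
have Sb m x : S m x ^+ 2 <= 2 * \sum_(j < m) p j * g j x ^+ 2.
  apply: (le_trans (ler_sum_sqr m (fun j => g j x) p0)).
  rewrite ler_wpM2r ?geo_sum//.
  by apply: sumr_ge0 => j _; rewrite mulr_ge0 ?sqr_ge0.
have cs x : cvgn (s ^~ x).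
  have [Dx|nDx] := pselect (D x); last first.
    rewrite (_ : s ^~ x = fun=> 0); first exact: is_cvg_cst.
    by apply/funext => m; rewrite /s indicE memNset// mul0r.
  rewrite (_ : s ^~ x = series (fun j => p j * g j x)); last first.
    by apply/funext => m; rewrite /s indicE mem_set// mul1r /S /series /= big_mkord.
  apply: normed_cvg; apply: nondecreasing_is_cvgn.
    by apply: nondecreasing_series => m _ _; exact: normr_ge0.
  exists (2 + fine (H x)) => _ [m _ <-].
  rewrite -[leLHS]/(series (fun j => `|p j * g j x|) m) seriesEord /=.
  apply: (@le_trans _ _ (\sum_(j < m) (p j + p j * g j x ^+ 2))).
    apply: ler_sum => j _; rewrite normrM (ger0_norm (p0 _)) -[X in X + _]mulr1 -mulrDr.
    rewrite ler_wpM2l// -[in leRHS](real_normK (num_real (g j x))).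
    have := sqr_ge0 (`|g j x| - 1); rewrite sqrrB1; have := normr_ge0 (g j x); nra.
  rewrite big_split /= lerD// ?geo_sum//.
  by rewrite -lee_fin fineK// -sumEFin; exact: Hm.
pose v x := limn (s ^~ x).
have sv x : s ^~ x @ \oo --> v x by exact: cs.
have mv : measurable_fun setT v by apply: measurable_fun_cvg (fun x _ => sv x).
have vb x : ((v x ^+ 2)%:E <= 2%:E * H x)%E.
  have sb m : ((s m x ^+ 2)%:E <= 2%:E * H x)%E.
    rewrite (@le_trans _ _ (S m x ^+ 2)%:E)//.
      rewrite lee_fin /s exprMn indicE; case: (_ \in _); rewrite ?expr1n ?mul1r//.
      by rewrite expr0n mul0r sqr_ge0.
    rewrite (@le_trans _ _ (2 * \sum_(j < m) p j * g j x ^+ 2)%:E)// ?lee_fin//.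
    by rewrite EFinM lee_pmul2l// -sumEFin; exact: Hm.
  have hc : (EFin \o (fun m => s m x ^+ 2)) @ \oo --> (v x ^+ 2)%:E.
    apply: cvg_EFin; first by apply: nearW.
    rewrite expr2 (_ : fine \o _ = (fun m => s m x * s m x)); first exact: cvgM.
    by apply/funext => m /=; rewrite expr2.
  by apply: cvge_le hc; apply: nearW => m; exact: sb.
have Lv : L2r v.
  split=> //; apply: (le_integrable measurableT _ _ (integrableZl measurableT 2 Hi)) => //.
    by apply/measurable_EFinP; apply: measurable_funX.
  move=> x _ /=; rewrite (ger0_norm (sqr_ge0 _)) gee0_abs ?mule_ge0//; exact: vb.
exists v; split=> // f Lf; have [mf fi] := Lf.
have Gi : mu.-integrable setT (fun x => (f x ^+ 2)%:E + (2%:E * H x))%E.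
  exact: (integrableD measurableT fi (integrableZl measurableT 2 Hi)).
have aecv : {ae mu, forall x, [set: T] x ->
    (fun m => (f x * S m x)%:E) @ \oo --> (f x * v x)%:E}.
  apply: filterS aeD => x Dx _; apply: cvg_EFin; first exact: nearW.
  rewrite (_ : fine \o _ = fun m => f x * s m x).
    by apply: cvgM; [exact: cvg_cst|exact: sv].
  by apply/funext => m; rewrite /s /= indicE mem_set// mul1r.
(* [|f S_m| <= f^2 + S_m^2 <= f^2 + 2 H]. *)
have aeb : {ae mu, forall x m, [set: T] x ->
    (`|(f x * S m x)%:E| <= (f x ^+ 2)%:E + (2%:E * H x))%E}.
  apply: aeW => x m _.
  rewrite (@le_trans _ _ ((f x ^+ 2)%:E + (S m x ^+ 2)%:E)%E)//.
    rewrite -EFinD lee_fin normrM.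
    rewrite -(real_normK (num_real (f x))) -(real_normK (num_real (S m x))).
    have := sqr_ge0 (`|f x| - `|S m x|); rewrite sqrrB.
    by have := sqr_ge0 `|f x|; have := sqr_ge0 `|S m x|; lra.
  rewrite leeD2l// (@le_trans _ _ (2 * \sum_(j < m) p j * g j x ^+ 2)%:E)// ?lee_fin//.
  by rewrite EFinM lee_pmul2l// -sumEFin; exact: Hm.
have [_ _ dct] := @dominated_convergence _ T R mu setT measurableT
  (fun m x => (f x * S m x)%:E) (fun x => (f x * v x)%:E) _
  (fun m => (measurable_EFinP _ _).2 (measurable_funM mf (mS m)))
  ((measurable_EFinP _ _).2 (measurable_funM mf mv)) aecv Gi aeb.
have fin : (\int[mu]_x (f x * v x)%:E)%E \is a fin_num.
  by apply: integrable_fin_num => //; exact: L2r_mul.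
move: dct; rewrite -(fineK fin) => /fine_cvgP[_]; exact.
Qed.

Theorem weakly_null_bounded (f : nat -> T -> R) : (forall n, L2r (f n)) ->
  (forall v, L2r v -> (fun n => I (fun x => f n x * v x)) @ \oo --> (0 : R)) ->
  exists C : R, forall n, I (fun x => f n x ^+ 2) <= C.
Proof.
move=> Lf fv; apply: contrapT => /forallNP nC.
pose N n := I (fun x => f n x ^+ 2).
have unb (C : R) (m : nat) : exists n, (m <= n)%N /\ C < N n.
  apply: contrapT => /forallNP h.
  apply: (nC (Num.max C (\sum_(i < m) N i))) => n.
  have N0 i : 0 <= N i by apply: Rintegral_ge0 => x _; exact: sqr_ge0.
  rewrite le_max; have [mn|nm] := leqP m n.
    by have := h n; rewrite mn /= => /not_andP[//|/negP]; rewrite -leNgt => ->.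
  by rewrite (bigD1 (Ordinal nm))//= lerDl sumr_ge0 ?orbT// => i _; exact: N0.
(* With [a k] the norm of the k-th chosen function, the diagonal term [4^-k * a k] exceeds
   [2 (k + 2)]. The earlier terms cost at most 4/3 in all, and the later ones at most [a k] times
   the sum of [4^-j] over [j > k], a third of the diagonal term. At least
   [2/3 * 2 (k + 2) - 4/3 >= k] remains. *)
pose B k : R := (4 ^+ k * (2 * (k%:R + 2))) ^+ 2.
(* Testing on the finitely many functions already chosen makes the cross terms at most 1 beyond some
   index; unboundedness gives a large norm beyond that index. *)
have nx (s : seq nat) : exists n, B (size s) < N n /\
    forall j, j \in s -> `|I (fun x => f n x * f j x)| <= 1.
  have : \forall n \near \oo, forall j, j \in s -> `|I (fun x => f n x * f j x)| <= 1.
    elim: s => [|i s ih]; first by apply: nearW.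
    have hi : \forall n \near \oo, `|I (fun x => f n x * f i x)| <= 1.
      have /cvgrPdist_le/(_ 1 ltr01) := fv _ (Lf i).
      by apply: filterS => n; rewrite sub0r normrN.
    apply: filterS2 hi ih => n h1 h2 j; rewrite inE => /orP[/eqP ->//|]; exact: h2.
  move=> [m _ hm]; have [n [mn Bn]] := unb (B (size s)) m.
  by exists n; split=> //; exact: hm.
have [nxt hnxt] := choice nx.
(* Each choice depends on all the previous ones, so the recursion carries the list of them. *)
pose hist := fix hist k := if k is k'.+1 then rcons (hist k') (nxt (hist k')) else [::].
pose nn k := nxt (hist k).
have szh k : size (hist k) = k by elim: k => //= k ih; rewrite size_rcons ih.
have memh k j : (j < k)%N -> nn j \in hist k.
  elim: k => // k ih; rewrite ltnS leq_eqVlt => /orP[/eqP ->|jk] /=.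
    by rewrite mem_rcons mem_head.
  by rewrite mem_rcons inE ih ?orbT.
have NB k : B k < N (nn k) by have [] := hnxt (hist k); rewrite szh.
have small k j : (j < k)%N -> `|I (fun x => f (nn k) x * f (nn j) x)| <= 1.
  by move=> jk; have [_] := hnxt (hist k); apply; exact: memh.
pose a k := Num.sqrt (N (nn k)).
have B0 k : 0 <= 4 ^+ k * (2 * (k%:R + 2)) :> R by rewrite !mulr_ge0// addr_ge0.
have N0 k : 0 <= N k by apply: Rintegral_ge0 => x _; exact: sqr_ge0.
have aB k : 4 ^+ k * (2 * (k%:R + 2)) <= a k.
  rewrite -[leLHS](ger0_norm (B0 k)) -sqrtr_sqr; apply: ler_wsqrtr.
  exact: ltW (NB k).
have a1 k : 1 <= a k.
  apply: le_trans (aB k).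
  have h4 : 1 <= 4 ^+ k :> R by rewrite exprn_ege1// ler1n.
  have hk : 0 <= k%:R :> R by [].
  by nra.
have a0 k : 0 < a k by exact: lt_le_trans (a1 k).
have a2 k : I (fun x => f (nn k) x ^+ 2) = a k ^+ 2 by rewrite sqr_sqrtr.
pose g k x := (a k)^-1 * f (nn k) x.
have Zi (c : R) h : mu.-integrable setT (EFin \o h) ->
    mu.-integrable setT (EFin \o (fun x => c * h x)) by exact: integrableZl.
have gE k x : g k x ^+ 2 = (a k)^-1 ^+ 2 * f (nn k) x ^+ 2 by rewrite exprMn.
have Lg k : L2r (g k).
  have [mf fi] := Lf (nn k); split; first exact: measurable_funM.
  by under eq_fun do rewrite /= gE; exact: Zi.
have g1 k : I (fun x => g k x ^+ 2) = 1.
  under eq_Rintegral do rewrite gE.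
  rewrite RintegralZl//; last by case: (Lf (nn k)).
  by rewrite a2 -exprMn mulVf ?expr1n// gt_eqF.
have [v [Lv cv]] := lacunary_series Lg g1.
pose p j : R := (4^-1) ^+ j.
pose t k j := p j / a j * I (fun x => f (nn k) x * f (nn j) x).
have p0 j : 0 <= p j by rewrite exprn_ge0.
have Lfg k j : mu.-integrable setT (EFin \o (fun x => p j / a j * (f (nn k) x * f (nn j) x))).
  by apply: Zi; exact: L2r_mul.
have fgE k m x : f (nn k) x * \sum_(j < m) p j * g j x =
    \sum_(j < m) p j / a j * (f (nn k) x * f (nn j) x).
  by rewrite mulr_sumr; apply: eq_bigr => j _; rewrite /g; ring.
have Iti k m : mu.-integrable setT (EFin \o (fun x => \sum_(j < m) p j / a j * (f (nn k) x * f
  (nn j) x))).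
  rewrite (_ : _ \o _ = fun x => (\sum_(j < m) (p j / a j * (f (nn k) x * f (nn j) x))%:E)%E).
    by apply: integrable_sum => // j _; exact: Lfg.
  by apply/funext => x /=; rewrite sumEFin.
have It k m : I (fun x => f (nn k) x * \sum_(j < m) p j * g j x) = \sum_(j < m) t k j.
  under eq_Rintegral do rewrite fgE.
  elim: m => [|m ih].
    by rewrite big_ord0 /Rintegral integral0_eq// => x _; rewrite big_ord0.
  rewrite big_ord_recr /= -ih.
  under eq_Rintegral do rewrite big_ord_recr /=.
  rewrite (RintegralD measurableT (Iti k m) (Lfg k m)).
  by rewrite [X in _ + X = _]RintegralZl//; exact: L2r_mul.
have tb k j (y : R) : `|I (fun x => f (nn k) x * f (nn j) x)| <= y * a j -> - (p j * y) <= t k j.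
  move=> h; rewrite lerNl (le_trans (ler_norm _))// normrN /t normrM.
  rewrite ger0_norm ?divr_ge0 ?(ltW (a0 _))// -mulrA ler_wpM2l//.
  by rewrite mulrC ler_pdivrMr.
have t1 k j : (j < k)%N -> - p j <= t k j.
  move=> jk; rewrite -[p j]mulr1; apply: tb; rewrite mul1r.
  exact: le_trans (small _ _ jk) (a1 j).
have t2 k : t k k = p k * a k.
  rewrite /t; have := a2 k; under eq_Rintegral do rewrite expr2.
  by move=> ->; field; rewrite gt_eqF.
have t3 k j : - (p j * a k) <= t k j.
  by apply: tb; exact: L2r_cauchy_schwarz.
(* [4/3 (1 - p m)] is the sum of [4^-j] over [j < m]; in [s2], [4/3 (p k.+1 - p m)] is the sum over
   [k < j < m]. *)
have s1 k m : (m <= k)%N -> - (4 / 3 * (1 - p m)) <= \sum_(j < m) t k j.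
  elim: m => [|m ih] mk; first by rewrite big_ord0 /p expr0 subrr mulr0 oppr0.
  rewrite big_ord_recr /=; have := ih (ltnW mk); have := t1 k m mk.
  by rewrite /p exprS; lra.
have s2 k m : (k < m)%N ->
    p k * a k - 4 / 3 * (1 - p k) - a k * (4 / 3 * (p k.+1 - p m)) <= \sum_(j < m) t k j.
  elim: m => // m ih; rewrite ltnS leq_eqVlt => /orP[/eqP <-|km].
    by rewrite big_ord_recr /= t2 subrr mulr0 mulr0 subr0; have := s1 k k (leqnn _); lra.
  rewrite big_ord_recr /=; have := ih km; have := t3 k m.
  have -> : p m.+1 = p m / 4 by rewrite /p exprS mulrC.
  by nra.
have low k : k%:R <= I (fun x => f (nn k) x * v x).
  rewrite -(cvg_lim (@Rhausdorff R) (cv _ (Lf (nn k)))).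
  apply: limr_ge; first by apply/cvg_ex; eexists; exact: (cv _ (Lf (nn k))).
  exists k.+1 => // m /= km; rewrite It; apply: le_trans (s2 _ _ km).
  have pa : 2 * (k%:R + 2) <= p k * a k.
    rewrite (@le_trans _ _ (p k * (4 ^+ k * (2 * (k%:R + 2)))))//.
      by rewrite mulrA /p -exprMn mulVf// expr1n mul1r.
    by rewrite ler_wpM2l.
  have -> : p k.+1 = p k / 4 by rewrite /p exprS mulrC.
  have := p0 k; have : 0 <= a k * p m by rewrite mulr_ge0 ?(ltW (a0 k)).
  have hk : 0 <= k%:R :> R by [].
  move: pa; rewrite !mulrBr [a k * (4 / 3 * (p k / 4))](_ : _ = (p k * a k) / 3); last by field.
  rewrite [a k * (4 / 3 * p m)](_ : _ = 4 / 3 * (a k * p m)); last by ring.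
  by lra.
have /cvgrPdist_le/(_ 1 ltr01)[M _ hM] := fv v Lv.
pose C := 1 + \sum_(i < M) `|I (fun x => f i x * v x)|.
have bC n : I (fun x => f n x * v x) <= C.
  have [Mn|nM] := leqP M n.
    have := hM n Mn; rewrite sub0r normrN => h.
    rewrite (le_trans (ler_norm _))// (le_trans h)// lerDl sumr_ge0//.
  rewrite (le_trans (ler_norm _))// /C (bigD1 (Ordinal nM))//= addrCA lerDl.
  by rewrite addr_ge0// sumr_ge0.
have := le_trans (low (Num.truncn C).+1) (bC _).
by rewrite leNgt truncnS_gt.
Qed.

End uniform_boundedness.

(** * Smooth functions and their Fourier transforms *)

Section directional.
Context {R : realType} {d : nat}.
Local Notation E := 'rV[R]_d.
Local Notation C := R[i].
Local Notation e i := (delta_mx ord0 i : E).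
Implicit Types (f g : E -> C).

(** Restriction to a line gives access to one-variable calculus: chain rule, inverses,
    differentiation under the integral. *)
Lemma is_derive_line (V : normedModType R) (f : V -> R) (x v : V) (l : R) :
  is_derive (0 : R) 1 (fun t : R => f (t *: v + x)) l <-> is_derive x v f l.
Proof.
have E0 : (fun h : R => h^-1 *: (((fun t : R => f (t *: v + x)) \o +%R^~ 0) (h *: 1) -
    (fun t : R => f (t *: v + x)) 0)) =
  (fun h : R => h^-1 *: ((f \o +%R^~ x) (h *: v) - f x)).
  by apply/funext => h /=; rewrite addr0 scale0r add0r [h *: 1]mulr1.
split=> -[h1 h2].
  by split; [move: h1; rewrite /derivable E0|move: h2; rewrite /derive E0].
by split; [rewrite /derivable E0|rewrite /derive E0].
Qed.

(** [cpartial] has a value even where there is no derivative; this relation carries the existence as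
    well. *)
Definition cderiv (i : 'I_d) f (x : E) (l : C) :=
  is_derive x (e i) (re \o f) (re l) /\ is_derive x (e i) (im \o f) (im l).

Lemma cderiv_cpartial i f x l : cderiv i f x l -> cpartial i f x = l.
Proof.
by move=> [h1 h2]; apply: complex_eqP; rewrite /cpartial /=;
  [rewrite (@derive_val _ _ _ _ _ _ _ h1)|rewrite (@derive_val _ _ _ _ _ _ _ h2)].
Qed.

Lemma cderiv_lineP i f x l : cderiv i f x l <->
  is_derive (0 : R) 1 (fun t : R => re (f (t *: e i + x))) (re l) /\
  is_derive (0 : R) 1 (fun t : R => im (f (t *: e i + x))) (im l).
Proof.
by split=> -[h1 h2]; split; [exact/(is_derive_line (re \o f))|
  exact/(is_derive_line (im \o f))|exact/(is_derive_line (re \o f))|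
  exact/(is_derive_line (im \o f))].
Qed.

Lemma cderivM i f g x l m : cderiv i f x l -> cderiv i g x m ->
  cderiv i (fun y => f y * g y) x (l * g x + f x * m).
Proof.
move=> [f1 f2] [g1 g2]; split.
  rewrite (_ : _ \o _ = (re \o f) * (re \o g) - (im \o f) * (im \o g)); last first.
    by apply/funext => y /=; rewrite reM.
  apply: is_derive_eq; rewrite reD !reM /= /GRing.scale /=; ring.
rewrite (_ : _ \o _ = (re \o f) * (im \o g) + (im \o f) * (re \o g)); last first.
  by apply/funext => y /=; rewrite imM.
apply: is_derive_eq; rewrite imD !imM /= /GRing.scale /=; ring.
Qed.

Lemma cderivD i f g x l m : cderiv i f x l -> cderiv i g x m ->
  cderiv i (fun y => f y + g y) x (l + m).
Proof.
move=> [f1 f2] [g1 g2]; split.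
  rewrite (_ : _ \o _ = (re \o f) + (re \o g)); last first.
    by apply/funext => y /=; rewrite reD.
  by apply: is_derive_eq; rewrite reD.
rewrite (_ : _ \o _ = (im \o f) + (im \o g)); last first.
  by apply/funext => y /=; rewrite imD.
by apply: is_derive_eq; rewrite imD.
Qed.

Lemma cderivJ i f x l : cderiv i f x l -> cderiv i (fun y => conjc (f y)) x (conjc l).
Proof.
move=> [f1 f2]; split.
  rewrite reJ (_ : _ \o _ = re \o f)//.
  by apply/funext => y /=; rewrite reJ.
rewrite imJ (_ : _ \o _ = - (im \o f)); last first.
  by apply/funext => y /=; rewrite imJ.
by apply: is_derive_eq.
Qed.

Lemma cderiv_cst i (z : C) x : cderiv i (fun=> z) x 0.
Proof. by split; exact: is_derive_cst. Qed.

Lemma cderiv_coord i j x : cderiv i (fun y : E => (y ord0 j)%:C) x (i == j)%:R.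
Proof.
apply/cderiv_lineP; split; last first.
  rewrite (_ : im _ = 0); last by case: eqP.
  exact: is_derive_cst.
rewrite (_ : (fun t : R => _) = fun t : R => (i == j)%:R * t + x ord0 j); last first.
  by apply/funext => t; rewrite !mxE /= eq_sym mulrC.
rewrite (_ : re _ = (i == j)%:R); last by case: eqP.
apply: is_derive_eq; rewrite /GRing.scale /= addr0.
by rewrite mulr1.
Qed.

(** The class C^k, by recursion on the order so that closure properties follow by induction;
    [csmoothP] relates it to the formulation by sequences of directions. *)
Fixpoint csm (k : nat) f : Prop :=
  continuous (f : E -> C^o) /\
  if k is k'.+1 then forall i, (forall x, exists l, cderiv i f x l) /\ csm k' (cpartial i f)
  else True.

Lemma csm_cont k f : csm k f -> continuous (f : E -> C^o).
Proof. by case: k => [|k] []. Qed.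

Lemma csmS k f (f' : 'I_d -> E -> C) : continuous (f : E -> C^o) ->
  (forall i x, cderiv i f x (f' i x)) -> (forall i, csm k (f' i)) -> csm k.+1 f.
Proof.
move=> cf df sf'; split => // i; split; first by move=> x; exists (f' i x).
rewrite (_ : cpartial i f = f' i)//; apply/funext => x; exact: cderiv_cpartial.
Qed.

Lemma csm_cderiv k f i x : csm k.+1 f -> cderiv i f x (cpartial i f x).
Proof. by move=> [_ /(_ i) [/(_ x) [l h] _]]; rewrite (cderiv_cpartial h). Qed.

Lemma csm_cpartial k f i : csm k.+1 f -> csm k (cpartial i f).
Proof. by move=> [_ /(_ i) []]. Qed.

Lemma csmW k f : csm k.+1 f -> csm k f.
Proof.
elim: k f => [|k ih] f; first by case.
move=> [cf h]; split=> // i; have [h1 h2] := h i; split=> //; exact: ih.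
Qed.

Lemma csm_cpartials k f (s : seq 'I_d) : csm (size s + k) f -> csm k (cpartials s f).
Proof.
elim: s k => // i s ih k h /=.
by apply: csm_cpartial; apply: ih; rewrite addnS.
Qed.

Lemma csmoothP f : csmooth f <-> forall k, csm k f.
Proof.
split=> [h k|h s].
  elim: k f h => [|k ih] f h; first by split=> //; case: (h [::]).
  split; first by case: (h [::]).
  move=> i; split=> [x|].
    exists (cpartial i f x); have [_ /(_ i x) [h1 h2]] := h [::].
    by split; apply: DeriveDef.
  apply: ih => s; have := h (rcons s i).
  by rewrite /cpartials -!cats1 foldr_cat.
have hs : csm 1 (cpartials s f) by apply: csm_cpartials; exact: h.
split; first exact: csm_cont hs.
by move=> i x; have [[h1 _] [h2 _]] := csm_cderiv i x hs.
Qed.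

Lemma csmD k f g : csm k f -> csm k g -> csm k (fun x => f x + g x).
Proof.
elim: k f g => [|k ih] f g sf sg.
  by split=> //; apply: ccontD; [case: sf|case: sg].
apply: (csmS (f' := fun i x => cpartial i f x + cpartial i g x)).
- by apply: ccontD; [case: sf|case: sg].
- by move=> i x; apply: cderivD; [exact: (csm_cderiv i x sf)|exact: (csm_cderiv i x sg)].
- by move=> i; apply: ih; exact: csm_cpartial.
Qed.

Lemma csmM k f g : csm k f -> csm k g -> csm k (fun x => f x * g x).
Proof.
elim: k f g => [|k ih] f g sf sg.
  by split=> //; apply: ccontM; [case: sf|case: sg].
apply: (csmS (f' := fun i x => cpartial i f x * g x + f x * cpartial i g x)).
- by apply: ccontM; [case: sf|case: sg].
- by move=> i x; apply: cderivM; [exact: (csm_cderiv i x sf)|exact: (csm_cderiv i x sg)].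
- by move=> i; apply: csmD; apply: ih; by [exact: csm_cpartial|exact: csmW].
Qed.

Lemma csmJ k f : csm k f -> csm k (fun x => conjc (f x)).
Proof.
elim: k f => [|k ih] f sf.
  by split=> //; apply: ccontJ; case: sf.
apply: (csmS (f' := fun i x => conjc (cpartial i f x))).
- by apply: ccontJ; case: sf.
- by move=> i x; apply: cderivJ; exact: (csm_cderiv i x sf).
- by move=> i; apply: ih; exact: csm_cpartial.
Qed.

Lemma csm_cst k (z : C) : csm k (fun=> z).
Proof.
elim: k z => [|k ih] z; first by split=> //; exact: ccont_cst.
apply: (csmS (f' := fun _ _ => 0)) => //; first exact: ccont_cst.
by move=> i x; exact: cderiv_cst.
Qed.

Lemma csm_coord k j : csm k (fun x : E => (x ord0 j)%:C).
Proof.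
have cc : continuous ((fun x : E => (x ord0 j)%:C) : E -> C^o).
  by apply: ccont_real; exact: coord_continuous.
case: k => [|k]; first by split.
apply: (csmS (f' := fun i _ => (i == j)%:R)) => //.
- by move=> i x; exact: cderiv_coord.
- by move=> i; exact: csm_cst.
Qed.

Lemma csm_sum k I (s : seq I) (P : pred I) (F : I -> E -> C) :
  (forall i, P i -> csm k (F i)) -> csm k (fun x => \sum_(i <- s | P i) F i x).
Proof.
move=> h; elim: s => [|i s ih].
  by under eq_fun do rewrite big_nil; exact: csm_cst.
under eq_fun do rewrite big_cons.
by case Pi: (P i) => //; apply: csmD => //; exact: h.
Qed.

Lemma csm_prod k I (s : seq I) (P : pred I) (F : I -> E -> C) :
  (forall i, P i -> csm k (F i)) -> csm k (fun x => \prod_(i <- s | P i) F i x).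
Proof.
move=> h; elim: s => [|i s ih].
  by under eq_fun do rewrite big_nil; exact: csm_cst.
under eq_fun do rewrite big_cons.
by case Pi: (P i) => //; apply: csmM => //; exact: h.
Qed.

Lemma csmX k f n : csm k f -> csm k (fun x => f x ^+ n).
Proof.
move=> h; elim: n => [|n ih]; first exact: csm_cst.
by under eq_fun do rewrite exprS; exact: csmM.
Qed.

Lemma cderiv_inv i (F : E -> R) x l : F x != 0 ->
  cderiv i (fun y => (F y)%:C) x l ->
  cderiv i (fun y => (F y)^-1%:C) x (- (l * ((F x)^-1%:C * (F x)^-1%:C))).
Proof.
move=> F0 [h1 h2].
have l0 : im l = 0.
  have := @derive_val _ _ _ _ _ _ _ h2; rewrite (_ : _ \o _ = fun=> 0)//.
  by rewrite derive_cst => <-.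
split; last first.
  rewrite imN imM imM /= l0 !(mul0r, mulr0, addr0) oppr0.
  exact: is_derive_cst.
rewrite (_ : _ \o _ = fun y => (F y)^-1)//.
apply/is_derive_line.
have h1' : is_derive (0 : R) 1 (fun t : R => F (t *: e i + x)) (re l).
  exact/is_derive_line.
have F0' : (fun t : R => F (t *: e i + x)) 0 != 0 by rewrite scale0r add0r.
have := @is_deriveV R (fun t : R => F (t *: e i + x)) 0 (re l) 1 F0' h1'.
rewrite scale0r add0r => h; apply: is_derive_eq.
rewrite reN !reM /= l0 /GRing.scale /= -exprVn expr2; ring.
Qed.

Lemma csm_inv k (F : E -> R) : (forall x, F x != 0) ->
  csm k (fun x => (F x)%:C) -> csm k (fun x => (F x)^-1%:C).
Proof.
move=> F0; have cF : continuous ((fun x => (F x)%:C) : E -> C^o) ->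
    continuous ((fun x => (F x)^-1%:C) : E -> C^o).
  move=> /ccontP[h _]; apply: ccont_real => x.
  by apply: (@continuous_comp _ _ _ F (@GRing.inv R)); [exact: (h x)|exact: inv_continuous].
elim: k => [|k ih] sF; first by split=> //; apply: cF; case: sF.
apply: (csmS (f' := fun i x => - (cpartial i (fun x => (F x)%:C) x * ((F x)^-1%:C * (F x)^-1%:C)))).
- by apply: cF; case: sF.
- by move=> i x; apply: cderiv_inv => //; exact: (csm_cderiv i x sF).
- move=> i; under eq_fun do rewrite -mulN1r.
  apply: csmM; first exact: csm_cst.
  have h := ih (csmW sF); apply: csmM; first exact: csm_cpartial.
  exact: csmM.
Qed.

(** The sequence [h] lists the successive derivatives of [h 0]; the induction is on all members of
    the sequence at once. *)
Lemma csm_fun_coord k j (h : nat -> R -> R) (a b : R) :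
  (forall n (t : R), is_derive t 1 (h n) (h n.+1 t)) ->
  csm k (fun x : E => (h 0%N (a * x ord0 j + b))%:C).
Proof.
move=> dh; suff: forall n, csm k (fun x : E => (h n (a * x ord0 j + b))%:C) by [].
have cc n : continuous ((fun x : E => (h n (a * x ord0 j + b))%:C) : E -> C^o).
  apply: ccont_real => x.
  apply: (@continuous_comp _ _ _ (fun x : E => a * x ord0 j + b) (h n)); last first.
    by apply: differentiable_continuous; apply/derivable1_diffP; case: (dh n (a * x ord0 j + b)).
  have h1 : (fun x1 : E => a * x1 ord0 j) @ x --> a * x ord0 j.
    exact: (cvgM (cvg_cst a) (@coord_continuous _ 1 d ord0 j x)).
  exact: (cvgD h1 (cvg_cst b)).
elim: k => [|k ih] n; first by split.
apply: (csmS (f' := fun i x => (i == j)%:R * (a%:C * (h n.+1 (a * x ord0 j + b))%:C))) => //.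
- move=> i x; apply/cderiv_lineP; split; last first.
    rewrite (_ : im _ = 0); last by rewrite imM imM /=; case: eqP => _; rewrite /=; ring.
    exact: is_derive_cst.
  rewrite (_ : (fun t : R => _) = h n \o (fun t : R => (a * (i == j)%:R) * t + (a * x ord0 j +
    b))); last first.
    by apply/funext => t /=; rewrite !mxE /= [j == i]eq_sym; congr (h n _); ring.
  have hd : is_derive (0 : R) 1 (fun t : R => (a * (i == j)%:R) * t + (a * x ord0 j + b)) (a * (i
    == j)%:R).
    by apply: is_derive_eq; rewrite /GRing.scale /= addr0 mulr1.
  have := @is_derive1_comp R (h n) _ 0 _ _ (dh n _) hd.
  rewrite mulr0 add0r => h'; apply: is_derive_eq.
  by rewrite reM reM /=; case: eqP => _ /=; ring.
- move=> i; apply: csmM; first exact: csm_cst.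
  by apply: csmM; [exact: csm_cst|exact: ih].
Qed.

End directional.

Section fourier_smooth.
Context {R : realType} {d : nat}.
Local Notation E := 'rV[R]_d.
Local Notation C := R[i].
Local Notation e i := (delta_mx ord0 i : E).
Local Notation leb := (lebesgue_rV R d).
Implicit Types (f g w : E -> C).

Lemma dotrDr (x y z : E) : dotr x (y + z) = dotr x y + dotr x z.
Proof. by rewrite /dotr -big_split; apply: eq_bigr => i _; rewrite mxE mulrDr. Qed.

Lemma dotrNr (x y : E) : dotr x (- y) = - dotr x y.
Proof. by rewrite /dotr -sumrN; apply: eq_bigr => i _; rewrite mxE mulrN. Qed.

Lemma dotr_delta (x : E) i (t : R) : dotr x (t *: e i) = t * x ord0 i.
Proof.
rewrite /dotr (bigD1 i)//= !mxE !eqxx mulr1 big1 ?addr0; first by rewrite mulrC.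
by move=> j ji; rewrite !mxE (negbTE ji) !mulr0.
Qed.

Lemma dotr_le (M : R) (x y : E) : (forall i, `|x ord0 i| <= M) ->
  `|dotr x y| <= d%:R * M * `|y|.
Proof.
move=> xM; rewrite /dotr (le_trans (ler_norm_sum _ _ _))//.
rewrite (le_trans (y := \sum_(i < d) M * `|y|))//.
  apply: ler_sum => i _; rewrite normrM ler_pM//; exact: mx_norm_coord.
by rewrite sumr_const card_ord -mulrA mulr_natl.
Qed.

Lemma cos_sin_lipschitz (a b : R) : cmod (expi a - expi b) <= 2 * `|a - b|.
Proof.
wlog ab : a b / a <= b.
  move=> h; have [|/ltW] := leP a b; first exact: h.
  by move=> ba; rewrite cmodB distrC; exact: h.
have [c1 _ h1] := @MVT_segment R cos (fun x => - sin x) a b ab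
  (fun x _ => is_derive_cos x) (continuous_subspaceT (@continuous_cos R)).
have [c2 _ h2] := @MVT_segment R sin (@cos R) a b ab
  (fun x _ => is_derive_sin x) (continuous_subspaceT (@continuous_sin R)).
rewrite cmodB (le_trans (cmod_le_reim _))// reB imB /= h1 h2 !normrM normrN.
rewrite mulr_natl mulr2n [`|a - b|]distrC lerD// ler_piMl//.
  by rewrite ler_norml sin_geN1 sin_le1.
by rewrite ler_norml cos_geN1 cos_le1.
Qed.

(** Integrable with bounded support: the support lies in the cube of half-side [M] about 0. The
    class is stable under multiplication by coordinates, which makes the Fourier transforms of its
    members smooth. *)
Definition ibs (M : R) w := cinteg leb w /\
  forall x : E, ~ (forall i, `|x ord0 i| <= M) -> w x = 0.

Lemma continuous_fourier M w : ibs M w -> continuous (fourier w : E -> C^o).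
Proof.
move=> [iw w0] xi; apply/(@ccvg_cmodP R E (nbhs xi) _).
have [mw cw] := (cintegP _ _).1 iw.
pose B := (\int[leb]_x cmod (w x))%R.
(* A Lipschitz constant of [fourier w]: one 2 comes from [cmod_cI_le], the next from
   [cos_sin_lipschitz], [2 pi] from the kernel, and [d |M|] bounds the scalar product on the
   support. *)
pose L := 2 * (2 * (2 * pi * (d%:R * `|M|)) * B).
have B0 : 0 <= B by apply: Rintegral_ge0 => x _; exact: cmod_ge0.
have L0 : 0 <= L by rewrite !mulr_ge0// pi_ge0.
have lip eta : cmod (fourier w eta - fourier w xi) <= L * `|eta - xi|.
  have ie z := cinteg_kernel z iw.
  rewrite /fourier -[X in X - _]/(cI _ _) -[X in _ - X]/(cI _ _) -cIB//.
  have := cmod_cI_le (cintegB (ie eta) (ie xi)).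
  rewrite -lee_fin => /le_trans; apply.
  rewrite /L -mulrA EFinM lee_pmul2l//.
  have Bfin : (\int[leb]_x (cmod (w x))%:E)%E = B%:E.
    by rewrite /B /Rintegral fineK// integrable_fin_num.
  rewrite [X in (_ <= X%:E)%E](_ : _ = (2 * (2 * pi * (d%:R * `|M|)) * `|eta - xi|) * B); last by ring.
  rewrite EFinM -Bfin -ge0_integralZl//; first last.
  - by rewrite lee_fin !mulr_ge0// pi_ge0.
  - by move=> x _; rewrite lee_fin cmod_ge0.
  - by apply/measurable_EFinP; exact: measurable_cmod.
  apply: ge0_le_integral => //.
  - by move=> x _; rewrite lee_fin cmod_ge0.
  - apply/measurable_EFinP; apply: measurable_cmod.
    by case/cintegP: (cintegB (ie eta) (ie xi)).
  - by apply: measurable_funeM; apply/measurable_EFinP; exact: measurable_cmod.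
  move=> x _; rewrite -EFinM lee_fin -mulrBl cmodM.
  have [xM|/w0 ->] := pselect (forall i, `|x ord0 i| <= M); last by rewrite cmod0 !mulr0.
  rewrite ler_wpM2r ?cmod_ge0// (le_trans (cos_sin_lipschitz _ _))//.
  have -> : - (2 * pi * dotr x eta) - - (2 * pi * dotr x xi) = 2 * pi * dotr x (xi - eta).
    by rewrite dotrDr dotrNr; ring.
  rewrite normrM (@ger0_norm _ (2 * pi)) ?mulr_ge0 ?pi_ge0// -!mulrA ler_pM2l// ler_pM2l//.
  rewrite ler_pM2l ?pi_gt0//.
  have xM' i : `|x ord0 i| <= `|M| by rewrite (le_trans (xM i))// ler_norm.
  by rewrite (le_trans (dotr_le _ xM'))// distrC mulrA.
have h : (fun eta : E => L * `|eta - xi|) @ xi --> (0 : R).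
  have h1 : (fun eta : E => `|eta - xi|) @ xi --> (0 : R).
    have h0 : (fun eta : E => eta - xi) @ xi --> xi - xi by exact: (cvgB (@cvg_id _ (nbhs xi))
      (cvg_cst xi)).
    have h2 : (fun eta : E => `|eta - xi|) @ xi --> `|xi - xi| by exact: cvg_norm h0.
    by rewrite subrr normr0 in h2.
  by rewrite -(mulr0 L); exact: (cvgM (cvg_cst L) h1).
apply: (squeeze_cvgr _ (cvg_cst 0) h); apply: nearW => eta.
by rewrite cmod_ge0 lip.
Qed.

Let is_derive_expi (a b : R) (z : C) (t : R) :
  is_derive t 1 (fun t : R => re (expi (a * t + b) * z))
    (re ((0 +i* a) * (expi (a * t + b) * z))) /\
  is_derive t 1 (fun t : R => im (expi (a * t + b) * z))
    (im ((0 +i* a) * (expi (a * t + b) * z))).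
Proof.
have lin : is_derive t 1 (fun t : R => a * t + b) a.
  by apply: is_derive_eq; rewrite /GRing.scale /= addr0 mulr1.
have hc := @is_derive1_comp R cos _ t _ _ (is_derive_cos _) lin.
have hs := @is_derive1_comp R sin _ t _ _ (is_derive_sin _) lin.
split.
  rewrite (_ : (fun t : R => _) = (re z \*: (cos \o (fun t : R => a * t + b))) -
     (im z \*: (sin \o (fun t : R => a * t + b)))); last first.
    by apply/funext => s; rewrite reM /= /GRing.scale /= [X in _ = X - _]mulrC [X in _ = _ - X]mulrC.
  by apply: is_derive_eq; rewrite !reM !imM /= /GRing.scale /=; ring.
rewrite (_ : (fun t : R => _) = (im z \*: (cos \o (fun t : R => a * t + b))) +
     (re z \*: (sin \o (fun t : R => a * t + b)))); last first.
  by apply/funext => s; rewrite imM /= /GRing.scale /= [X in _ = X + _]mulrC [X in _ = _ + X]mulrC.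
by apply: is_derive_eq; rewrite !imM !reM /= /GRing.scale /=; ring.
Qed.

Lemma ibs_mul_coord M i w : ibs M w ->
  ibs M (fun x => (0 +i* (- (2 * pi * x ord0 i))) * w x).
Proof.
move=> [iw w0]; split; last by move=> x /w0 ->; rewrite mulr0.
have [mw cw] := (cintegP _ _).1 iw.
apply: (cinteg_le _ (cintegZ (2 * pi * `|M|)%:C iw)).
  apply: cmeasM => //; split; first exact: measurable_cst.
  apply: measurable_funN; apply: measurable_funM => //; exact: measurable_rV_coord.
move=> x; rewrite !cmodM.
have [xM|/w0 ->] := pselect (forall i, `|x ord0 i| <= M); last by rewrite cmod0 !mulr0.
rewrite ler_wpM2r ?cmod_ge0// cmod_real (le_trans (cmod_le_reim _))//= normr0 add0r.
rewrite normrN normrM [leRHS]normrM ler_pM// normr_id.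
by rewrite (le_trans (xM i))// ler_norm.
Qed.

(** Differentiation under the integral along the line through [xi]. Since the support is bounded,
    the derivative of the integrand is dominated by [2 pi |M| |w|], uniformly in the parameter. Real
    and imaginary parts are treated separately. *)
Lemma cderiv_fourier M i w xi : ibs M w ->
  cderiv i (fourier w) xi
    (fourier (fun x => (0 +i* (- (2 * pi * x ord0 i))) * w x) xi).
Proof.
move=> bw; have [iw w0] := bw; have [iw' _] := ibs_mul_coord i bw.
have [mw cw] := (cintegP _ _).1 iw.
have kE (y : E) (t : R) : expi (- (2 * pi * dotr y (t *: e i + xi))) * w y =
    expi ((- (2 * pi * y ord0 i)) * t + (- (2 * pi * dotr y xi))) * w y.
  by congr (expi _ * _); rewrite dotrDr dotr_delta; ring.
pose Gd (y : E) := 2 * pi * `|M| * cmod (w y).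
have Gi : leb.-integrable setT (EFin \o Gd) by exact: (integrableZl measurableT (2 * pi * `|M|) cw).
have Gb (y : E) (t : R) : cmod ((0 +i* (- (2 * pi * y ord0 i))) *
    (expi ((- (2 * pi * y ord0 i)) * t + (- (2 * pi * dotr y xi))) * w y)) <= Gd y.
  have [xM|/w0 ->] := pselect (forall i, `|y ord0 i| <= M); last first.
    by rewrite !mulr0 cmod0 /Gd !mulr_ge0 ?pi_ge0 ?cmod_ge0.
  rewrite /Gd cmodM cmodM cmod_expi mul1r ler_wpM2r ?cmod_ge0//.
  rewrite (le_trans (cmod_le_reim _))//= normr0 add0r normrN normrM.
  rewrite ger0_norm ?mulr_ge0 ?pi_ge0// ler_wpM2l ?mulr_ge0 ?pi_ge0//.
  by rewrite (le_trans (xM i))// ler_norm.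
have Gd0 y : 0 <= Gd y by rewrite /Gd !mulr_ge0 ?pi_ge0 ?cmod_ge0.
have I0 : (`]-1, 1[%classic : set R) 0 by rewrite /= in_itv /= ltrN10 ltr01.
apply/cderiv_lineP; split.
  pose f (t : R) (y : E) := re (expi ((- (2 * pi * y ord0 i)) * t + (- (2 * pi * dotr y xi))) * w y).
  have fd (y : E) (t : R) : is_derive t 1 (f ^~ y) _ := (is_derive_expi _ _ _ _).1.
  have fE : (fun t : R => re (fourier w (t *: e i + xi))) = fun t : R => (\int[leb]_y f t y)%R.
    by apply/funext => t; rewrite /fourier /cint /=; apply: eq_Rintegral => y _; rewrite kE.
  have fi (t : R) : `]-1, 1[%classic t -> leb.-integrable setT (EFin \o f t).
    move=> _; have [h _] := cinteg_kernel (t *: e i + xi) iw.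
    by move: h; congr (_.-integrable _ _); apply/funext => y; rewrite /f /= kE.
  have fder (t : R) (y : E) : `]-1, 1[%classic t -> setT y -> derivable (f ^~ y) t 1.
    by move=> _ _; case: (fd y t).
  have fub (t : R) (y : E) : `]-1, 1[%classic t -> setT y -> `|partial1of2 f t y| <= Gd y.
    move=> _ _; rewrite partial1of2E (@derive_val _ _ _ _ _ _ _ (fd y t)).
    exact: le_trans (re_le_cmod _) (Gb _ _).
  rewrite fE; apply: DeriveDef.
    exact: (@derivable_under_integral _ _ _ leb f setT measurableT 0 (-1) 1 I0 fi fder Gd Gd0 Gi fub).
  rewrite -derive1E (@differentiation_under_integral _ _ _ leb f setT measurableT 0 (-1) 1 I0 fi
    fder Gd Gd0 Gi fub).
  rewrite /fourier /cint /=; apply: eq_Rintegral => y _.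
  rewrite partial1of2E (@derive_val _ _ _ _ _ _ _ (fd y 0)) mulr0 add0r.
  by congr re; ring.
pose f (t : R) (y : E) := im (expi ((- (2 * pi * y ord0 i)) * t + (- (2 * pi * dotr y xi))) * w y).
have fd (y : E) (t : R) : is_derive t 1 (f ^~ y) _ := (is_derive_expi _ _ _ _).2.
have fE : (fun t : R => im (fourier w (t *: e i + xi))) = fun t : R => (\int[leb]_y f t y)%R.
  by apply/funext => t; rewrite /fourier /cint /=; apply: eq_Rintegral => y _; rewrite kE.
have fi (t : R) : `]-1, 1[%classic t -> leb.-integrable setT (EFin \o f t).
  move=> _; have [_ h] := cinteg_kernel (t *: e i + xi) iw.
  by move: h; congr (_.-integrable _ _); apply/funext => y; rewrite /f /= kE.
have fder (t : R) (y : E) : `]-1, 1[%classic t -> setT y -> derivable (f ^~ y) t 1.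
  by move=> _ _; case: (fd y t).
have fub (t : R) (y : E) : `]-1, 1[%classic t -> setT y -> `|partial1of2 f t y| <= Gd y.
  move=> _ _; rewrite partial1of2E (@derive_val _ _ _ _ _ _ _ (fd y t)).
  exact: le_trans (im_le_cmod _) (Gb _ _).
rewrite fE; apply: DeriveDef.
  exact: (@derivable_under_integral _ _ _ leb f setT measurableT 0 (-1) 1 I0 fi fder Gd Gd0 Gi fub).
rewrite -derive1E (@differentiation_under_integral _ _ _ leb f setT measurableT 0 (-1) 1 I0 fi
  fder Gd Gd0 Gi fub).
rewrite /fourier /cint /=; apply: eq_Rintegral => y _.
rewrite partial1of2E (@derive_val _ _ _ _ _ _ _ (fd y 0)) mulr0 add0r.
by congr im; ring.
Qed.

Lemma csm_fourier k M w : ibs M w -> csm k (fourier w).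
Proof.
elim: k w => [|k ih] w bw; first by split=> //; exact: continuous_fourier bw.
apply: (csmS (f' := fun i => fourier (fun x => (0 +i* (- (2 * pi * x ord0 i))) * w x))).
- exact: continuous_fourier bw.
- by move=> i xi; exact: cderiv_fourier bw.
- by move=> i; apply: ih; exact: ibs_mul_coord.
Qed.

End fourier_smooth.

(** * Smooth bumps and compactly supported functions *)

Section bump.
Context {R : realType}.

(* [exp_inv p t = p(1/t) exp(-1/t)] for [t > 0]; the class is closed under
   derivation, by [p |-> X^2 (p - p')]. *)
Definition exp_inv (p : {poly R}) (t : R) : R :=
  if 0 < t then p.[t^-1] * expR (- t^-1) else 0.

Lemma exp_inv_small (p : {poly R}) : exists C : R, forall t, 0 < t <= 1 ->
  `|exp_inv p t| <= C * t.
Proof.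
have pow_exp (n : nat) : exists C : R, forall y, 1 <= y -> y ^+ n * expR (- y) <= C * y^-1.
  (* From [y/(n+1) <= exp (y/(n+1))], raised to the power [n+1]. *)
  exists (n.+1%:R ^+ n.+1) => y y1.
  have y0 : 0 < y by exact: lt_le_trans y1.
  rewrite ler_pdivlMr// mulrAC -exprSr expRN ler_pdivrMr ?expR_gt0//.
  have -> : expR y = expR (y / n.+1%:R) ^+ n.+1.
    by rewrite -expRM_natl; congr expR; field.
  rewrite -exprMn ler_pXn2r//; last 2 first.
    by rewrite nnegrE ltW.
    by rewrite nnegrE mulr_ge0 ?expR_ge0.
  by rewrite mulrC -ler_pdivrMr// (le_trans _ (expR_ge1Dx _))// lerDr.
have [C hC] := choice pow_exp.
exists (\sum_(i < size p) `|p`_i| * C i) => t /andP[t0 t1].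
rewrite /exp_inv t0 normrM (ger0_norm (expR_ge0 _)) horner_coef.
rewrite (le_trans (ler_wpM2r (expR_ge0 _) (ler_norm_sum _ _ _)))//.
rewrite !mulr_suml; apply: ler_sum => i _.
rewrite normrM -!mulrA ler_wpM2l// (@ger0_norm _ (t^-1 ^+ i)); last first.
  by rewrite exprn_ge0// invr_ge0 ltW.
by have := hC i t^-1; rewrite invrK; apply; rewrite invf_ge1.
Qed.

Lemma exp_invX (p : {poly R}) (t : R) : t^-1 * exp_inv p t = exp_inv (p * 'X) t.
Proof.
rewrite /exp_inv; case: ifP; rewrite ?mulr0// hornerMX => _; ring.
Qed.

Lemma is_derive_exp_inv p (t : R) :
  is_derive t 1 (exp_inv p) (exp_inv ('X^2 * (p - p^`())) t).
Proof.
have [t0|t0|->] := ltgtP t 0.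
- rewrite {2}/exp_inv ltNge (ltW t0) /=.
  apply: (near_eq_is_derive _ (is_derive_cst (0 : R) t 1)).
  near=> s; rewrite /exp_inv ltNge (_ : s <= 0)//; apply: ltW; near: s.
  exact: lt_nbhsl.
- rewrite {2}/exp_inv t0.
  have tn0 : t != 0 by rewrite gt_eqF.
  have dV : is_derive t 1 (fun s : R => s^-1) (- t ^- 2).
    by have := @is_deriveV R idfun t 1 1 tn0 (is_derive_id _ _); rewrite /GRing.scale /= mulr1.
  have dp := @is_derive1_comp R (horner p) _ t _ _ (is_derive_poly p _) dV.
  have dN : is_derive t 1 (fun s : R => - s^-1) (t ^- 2).
    by apply: is_derive_eq; rewrite opprK.
  have de := @is_derive1_comp R (@expR R) _ t _ _ (is_derive_expR _) dN.
  have dM : is_derive t 1 ((horner p \o (fun s : R => s^-1)) * (@expR R \o (fun s : R => -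
    s^-1))) (('X^2 * (p - p^`())).[t^-1] * expR (- t^-1)).
    apply: is_derive_eq; rewrite /GRing.scale /= hornerM hornerXn hornerD hornerN -exprVn.
    ring.
  apply: (near_eq_is_derive _ dM).
  by near=> s; rewrite /exp_inv (_ : 0 < s)//; near: s; exact: lt_nbhsr.
rewrite {2}/exp_inv ltxx.
(* At 0 the difference quotient is again a function of the class, [exp_inv (p * 'X)], and is bounded
   by a multiple of its argument. *)
have h : (fun h : R => h^-1 *: ((exp_inv p \o +%R^~ 0) (h *: 1) - exp_inv p 0)) @ 0^' --> (0 : R).
  have [C hC] := exp_inv_small (p * 'X).
  have hz : (fun h : R => `|C| * `|h|) @ 0^' --> (0 : R).
    have h1 : (fun h : R => `|h|) @ 0^' --> `|0 : R|.
      by apply: cvg_norm; apply: cvg_within.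
    have h2 : (fun h : R => `|C| * `|h|) @ 0^' --> `|C| * `|0 : R| by exact: cvgM (cvg_cst _) h1.
    by rewrite normr0 mulr0 in h2.
  apply/norm_cvg0P; apply: (squeeze_cvgr _ (cvg_cst 0) hz).
  near=> z; rewrite normr_ge0 /= addr0 [z *: 1]mulr1 /exp_inv ltxx subr0 -/(exp_inv p z).
  rewrite /GRing.scale /= exp_invX.
  have [z0|z0] := ltP 0 z; last by rewrite /exp_inv ltNge z0 /= normr0 mulr_ge0.
  apply: (le_trans (hC z _)).
    rewrite z0 /= ltW//; near: z; apply: nbhs_dnbhs.
    by apply: lt_nbhsl; exact: ltr01.
  by rewrite (ger0_norm (ltW z0)) ler_wpM2r ?(ltW z0)// ler_norm.
by apply: DeriveDef; [apply/cvg_ex; exists 0|exact: cvg_lim h].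
Unshelve. all: by end_near. Qed.

Definition exp_inv_der (n : nat) := iter n (fun p : {poly R} => 'X^2 * (p - p^`())) 1.

Lemma exp_inv1_gt0 (t : R) : (0 < exp_inv 1 t) = (0 < t).
Proof.
rewrite /exp_inv; case: ifP => t0; last by rewrite ltxx.
by rewrite hornerC mul1r expR_gt0.
Qed.

Lemma exp_inv1_ge0 (t : R) : 0 <= exp_inv 1 t.
Proof.
rewrite /exp_inv; case: ifP => t0; last by rewrite lexx.
by rewrite hornerC mul1r expR_ge0.
Qed.

Lemma exp_inv1_le1 (t : R) : exp_inv 1 t <= 1.
Proof.
rewrite /exp_inv; case: ifP => t0; last by rewrite ler01.
by rewrite hornerC mul1r -expR0 ler_expR oppr_le0 invr_ge0 ltW.
Qed.

Section box_bump.
Context {d : nat}.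
Local Notation E := 'rV[R]_d.

(** In each coordinate, [exp(-1/t) exp(-1/(1-t))] on []0, 1[], rescaled: the box has lowest corner
    [a] and side [h]. *)
Definition box_bump (a : E) (h : R) (x : E) : R :=
  \prod_i (exp_inv 1 ((x ord0 i - a ord0 i) / h) * exp_inv 1 (1 - (x ord0 i - a ord0 i) / h)).

Lemma csm_box_bump k (a : E) (h : R) : csm k (fun x => (box_bump a h x)%:C).
Proof.
rewrite (_ : (fun _ => _) = fun x : E => \prod_i
  ((exp_inv 1 (h^-1 * x ord0 i + (- (a ord0 i / h))))%:C *
   (exp_inv 1 (- h^-1 * x ord0 i + (1 + a ord0 i / h)))%:C)); last first.
  apply/funext => x; rewrite /box_bump rmorph_prod; apply: eq_bigr => i _ /=.
  by rewrite realcM; congr ((exp_inv 1 _)%:C * (exp_inv 1 _)%:C); ring.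
apply: csm_prod => i _; apply: csmM.
  by apply: (csm_fun_coord k i (h := fun n => exp_inv (exp_inv_der n))) => n t;
    exact: is_derive_exp_inv.
by apply: (csm_fun_coord k i (h := fun n => exp_inv (exp_inv_der n))) => n t; exact: is_derive_exp_inv.
Qed.

Lemma box_bump_ge0 a h x : 0 <= box_bump a h x.
Proof. by apply: prodr_ge0 => i _; apply: mulr_ge0; exact: exp_inv1_ge0. Qed.

Lemma box_bump_le1 a h x : box_bump a h x <= 1.
Proof.
rewrite [leRHS](_ : 1 = \prod_(i < d) 1); last by rewrite big1.
apply: ler_prod => i _; rewrite mulr_ge0 ?exp_inv1_ge0//=.
by rewrite mulr_ile1 ?exp_inv1_ge0 ?exp_inv1_le1.
Qed.

Lemma box_bump_gt0 (a : E) h (x : E) : 0 < h ->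
  (forall i, a ord0 i < x ord0 i < a ord0 i + h) -> 0 < box_bump a h x.
Proof.
move=> h0 H; apply: prodr_gt0 => i _; rewrite mulr_gt0 ?exp_inv1_gt0//.
  by case/andP: (H i) => H1 _; rewrite divr_gt0// subr_gt0.
by case/andP: (H i) => _ H2; rewrite subr_gt0 ltr_pdivrMr// mul1r ltrBlDl.
Qed.

Lemma box_bump_eq0 (a : E) h (x : E) : 0 < h ->
  ~ (forall i, a ord0 i <= x ord0 i <= a ord0 i + h) -> box_bump a h x = 0.
Proof.
move=> h0 /existsNP[i /negP ni]; apply/eqP; rewrite prodf_seq_eq0; apply/hasP.
exists i; rewrite ?mem_index_enum//= mulf_eq0.
move: ni; rewrite negb_and -!ltNge => /orP[n1|n2]; apply/orP; [left|right].
  by rewrite /exp_inv ltNge pmulr_lle0 ?invr_gt0// subr_le0 (ltW n1).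
rewrite /exp_inv ltNge subr_le0 ler_pdivlMr// mul1r lerBrDl (ltW n2)//.
Qed.

Lemma continuous_box_bump a h : continuous (box_bump a h).
Proof. by have /ccontP[] := csm_cont (csm_box_bump 0 a h). Qed.

End box_bump.

End bump.

Section real_continuity.
Context {R : realType} {T : topologicalType}.
Implicit Types f g : T -> R.

Lemma cont_cst (c : R) : continuous (fun _ : T => c).
Proof. by move=> x; exact: cvg_cst. Qed.

Lemma contM f g : continuous f -> continuous g -> continuous (fun x => f x * g x).
Proof. by move=> cf cg x; exact: (cvgM (cf x) (cg x)). Qed.

Lemma contD f g : continuous f -> continuous g -> continuous (fun x => f x + g x).
Proof. by move=> cf cg x; exact: (cvgD (cf x) (cg x)). Qed.

Lemma contX n f : continuous f -> continuous (fun x => f x ^+ n).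
Proof.
move=> cf; elim: n => [|n ih].
  by rewrite (_ : (fun _ => _) = fun=> 1)//; exact: cont_cst.
by under eq_fun do rewrite exprS; exact: contM.
Qed.

Lemma cont_sum I (s : seq I) (P : pred I) (F : I -> T -> R) :
  (forall i, P i -> continuous (F i)) -> continuous (fun x => \sum_(i <- s | P i) F i x).
Proof.
move=> h; elim: s => [|i s ih].
  by under eq_fun do rewrite big_nil; exact: cont_cst.
under eq_fun do rewrite big_cons.
by case Pi: (P i) => //; apply: contD => //; exact: h.
Qed.

End real_continuity.

Section compact_support.
Context {R : realType} {d : nat}.
Local Notation E := 'rV[R]_d.
Local Notation C := R[i].
Implicit Types (f g : E -> C).

Definition cube (N : R) : set E := [set x | forall i, `|x ord0 i| <= N].

Lemma compact_cube (N : R) : compact (cube N).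
Proof.
have := @rV_compact R d (fun=> `[- N, N]%classic) (fun=> @segment_compact R (- N) N).
congr compact; apply/seteqP; split=> x /= h i; have := h i;
  by rewrite in_itv /= ler_norml.
Qed.

Arguments compact_cube : clear implicits.

Lemma cpartial_vanish (K : set E) f i : closed K -> (forall x, ~ K x -> f x = 0) ->
  forall x, ~ K x -> cpartial i f x = 0.
Proof.
move=> cK f0 x nKx.
have nx : \near x, f x = 0.
  have : nbhs x (~` K) by apply: open_nbhs_nbhs; split => //; exact: closed_openC.
  by apply: filterS => y; exact: f0.
apply: complex_eqP; rewrite /cpartial /=.
  rewrite (@near_eq_derive _ _ _ _ (fun=> 0)) ?derive_cst//.
  by near=> y; rewrite /= (near nx y).
rewrite (@near_eq_derive _ _ _ _ (fun=> 0)) ?derive_cst//.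
by near=> y; rewrite /= (near nx y).
Unshelve. all: by end_near. Qed.

Lemma cpartials_vanish (K : set E) f s : closed K -> (forall x, ~ K x -> f x = 0) ->
  forall x, ~ K x -> cpartials s f x = 0.
Proof. by move=> cK f0; elim: s => //= i s ih; exact: cpartial_vanish. Qed.

Lemma continuous_enorm : continuous (@enorm R d).
Proof.
move=> x; apply: (@continuous_comp _ _ _ (fun x : E => \sum_i x ord0 i ^+ 2) Num.sqrt);
  last exact: sqrt_continuous.
have h : continuous (fun x : E => \sum_i x ord0 i ^+ 2).
  by apply: cont_sum => i _; apply: contX; exact: coord_continuous.
exact: (h x).
Qed.

Lemma compact_support_bounded (K : set E) (h : E -> R) : compact K -> continuous h ->
  (forall x, ~ K x -> h x = 0) -> exists M : R, forall x, `|h x| <= M.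
Proof.
move=> cK ch h0.
have : compact (h @` K).
  by apply: continuous_compact => //; exact: continuous_subspaceT.
move=> /compact_bounded[M [_ hM]]; exists (`|M| + 1) => x.
have [Kx|/h0 ->] := pselect (K x); last by rewrite normr0 addr_ge0.
apply: hM; last by exists x.
by rewrite (le_lt_trans (ler_norm M))// ltrDl.
Qed.

Lemma schwartz_compact (K : set E) f : compact K -> (forall k, csm k f) ->
  (forall x, ~ K x -> f x = 0) -> schwartz f.
Proof.
move=> cK sf f0; split; first exact/csmoothP.
have clK : closed K by apply: compact_closed.
move=> k s; have cs : continuous (cpartials s f : E -> C^o).
  by apply: (@csm_cont _ _ 0); apply: csm_cpartials.
have ch : continuous (fun x => (1 + enorm x) ^+ k * cmod (cpartials s f x)).
  apply: contM; last exact: cont_cmod.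
  by apply: contX; apply: contD; [exact: cont_cst|exact: continuous_enorm].
have [|M hM] := @compact_support_bounded K _ cK ch.
  by move=> x nx; rewrite (cpartials_vanish s clK f0 nx) cmod0 mulr0.
by exists M => x; rewrite (le_trans (ler_norm _)).
Qed.

Lemma ibs_compact (N : R) f : continuous (f : E -> C^o) ->
  (forall x, ~ cube N x -> f x = 0) -> ibs N f.
Proof.
move=> cf f0; split=> //.
have mf : cmeas f by exact: ccont_cmeas.
have [M hM] := compact_support_bounded (compact_cube N) (cont_cmod cf)
  (fun x nx => etrans (congr1 (@cmod R) (f0 x nx)) cmod0).
have mK := compact_measurable_rV (compact_cube N).
have iI : (lebesgue_rV R d).-integrable setT (EFin \o (fun x => M * \1_(cube N) x)).
  have i1 : (lebesgue_rV R d).-integrable setT (EFin \o \1_(cube N)).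
    apply/integrableP; split; first by apply/measurable_EFinP; exact: measurable_indic.
    rewrite (eq_integral (fun x => (\1_(cube N) x)%:E)); last first.
      by move=> x _ /=; rewrite ger0_norm.
    by rewrite integral_indic// setIT lebesgue_rV_compact_lty//; exact: compact_cube.
  exact: (integrableZl measurableT M i1).
apply: (le_cinteg mf iI) => x.
have [xK|/f0 ->] := pselect (cube N x).
  by rewrite indicE mem_set// mulr1; have := hM x; rewrite ger0_norm ?cmod_ge0.
rewrite cmod0 mulr_ge0// ?indicE//.
by apply: le_trans (hM 0).
Qed.

End compact_support.
Arguments compact_cube {R d} N.

(** * The localised equation on the Fourier side *)

Section weighted_duality.
Context {R : realType} {d : nat}.
Local Notation E := 'rV[R]_d.
Local Notation C := R[i].
Local Notation leb := (lebesgue_rV R d).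

Let chi (N : nat) (x : E) : R := box_bump (const_mx (- N.+1%:R)) (2 * N.+1%:R) x.

(** The cut-offs [chi N] are dilations of one bump and tend pointwise to its value at the centre.
    That value is not normalised to 1 and remains as a constant in [weighted_duality]. *)
Definition bump_center : R := box_bump (const_mx (-1) : E) 2 0.

Lemma bump_center_gt0 : 0 < bump_center.
Proof. by apply: box_bump_gt0 => // i; rewrite !mxE; lra. Qed.

Let chiE N x : chi N x = box_bump (const_mx (-1) : E) 2 (N.+1%:R^-1 *: x).
Proof.
rewrite /chi /box_bump; apply: eq_bigr => i _; rewrite !mxE.
have -> : (x ord0 i - - N.+1%:R) / (2 * N.+1%:R) = (N.+1%:R^-1 * x ord0 i - -1) / 2 :> R.
  by field.
by [].
Qed.

Let chi_cvg x : chi ^~ x @ \oo --> bump_center.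
Proof.
rewrite (_ : chi ^~ x = fun N => box_bump (const_mx (-1) : E) 2 (N.+1%:R^-1 *: x)); last first.
  by apply/funext => N; rewrite chiE.
have h : (fun N => (N.+1%:R^-1 : R) *: x) @ \oo --> (0 : E).
  rewrite -(scale0r x); apply: cvgZr_tmp; exact: cvg_harmonic.
exact: (continuous_cvg _ (@continuous_box_bump R d _ _ 0) h).
Qed.

(* Tested on [chi_N conj(G) / Q], the pairing with [g] only sees [|G|^2 / Q] on
   larger and larger cubes. *)
Lemma weighted_duality (g G : E -> C) (Q : E -> R) : cmeas g ->
  (forall k, csm k G) -> (forall k, csm k (fun x => (Q x)%:C)) -> (forall x, 0 < Q x) ->
  (forall (M : R) eta, schwartz eta -> ibs M eta ->
     cintegrable (fun x => g x * eta x) /\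
     cint (fun x => g x * eta x) = cint (fun x => G x * eta x)) ->
  (bump_center%:E * \int[leb]_x (cmod (G x) ^+ 2 / Q x)%:E <=
     \int[leb]_x (cmod (g x) ^+ 2 / Q x)%:E)%E.
Proof.
move=> mg sG sQ Q0 hyp.
have mG : cmeas G by apply: ccont_cmeas; exact: csm_cont (sG 0%N).
have mQ : measurable_fun setT (fun x => (Q x)^-1).
  have := csm_cont (csm_inv (fun x => lt0r_neq0 (Q0 x)) (sQ 0%N)).
  by move=> /ccontP[h _]; exact: continuous_measurable_rV.
pose B := (\int[leb]_x (cmod (g x) ^+ 2 / Q x)%:E)%E.
have B0 : (0 <= B)%E by apply: integral_ge0 => x _; rewrite lee_fin divr_ge0 ?sqr_ge0// ltW.
rewrite -/B; have [Boo|] := ltP B +oo%E; last by rewrite leye_eq => /eqP ->; rewrite leey.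
have mgQ : measurable_fun setT (fun x => cmod (g x) ^+ 2 / Q x).
  by apply: measurable_funM => //; exact: measurable_cmod2.
have mGQ : measurable_fun setT (fun x => cmod (G x) ^+ 2 / Q x).
  by apply: measurable_funM => //; exact: measurable_cmod2.
have mchi N : measurable_fun setT (chi N).
  by apply: continuous_measurable_rV; exact: continuous_box_bump.
have T_le N : (\int[leb]_x (chi N x * (cmod (G x) ^+ 2 / Q x))%:E <= B)%E.
  pose eta x := (chi N x)%:C * (conjc (G x) * (Q x)^-1%:C).
  have eta0 x : ~ cube (N.+1%:R) x -> eta x = 0.
    move=> nx; rewrite /eta /chi box_bump_eq0 ?mul0r// ?mulr_gt0//.
    move=> h; apply: nx => i; have := h i; rewrite !mxE ler_norml => /andP[h1 h2].
    by apply/andP; split; lra.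
  have seta k : csm k eta.
    apply: csmM; first exact: csm_box_bump.
    apply: csmM; first exact: csmJ.
    by apply: csm_inv => // x; exact: lt0r_neq0.
  have [ig ige] := hyp N.+1%:R eta (schwartz_compact (compact_cube _) seta eta0)
    (ibs_compact (csm_cont (seta 0%N)) eta0).
  have GE x : G x * eta x = (chi N x * (cmod (G x) ^+ 2 / Q x))%:C.
    by rewrite /eta realcM [((cmod (G x) ^+ 2) * _)%:C]realcM -mulJ_cmod; ring.
  have iGe : cinteg leb (fun x => G x * eta x).
    have := ibs_compact (N := N.+1%:R) (f := fun x => G x * eta x).
    case=> //; last by move=> x /eta0 ->; rewrite mulr0.
    by apply: ccontM; [exact: csm_cont (sG 0%N)|exact: csm_cont (seta 0%N)].
  pose t x := chi N x * (cmod (G x) ^+ 2 / Q x).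
  have t0 x : 0 <= t x.
    by rewrite /t mulr_ge0 ?box_bump_ge0// divr_ge0 ?sqr_ge0// ltW.
  have ti : leb.-integrable setT (EFin \o t).
    by case: iGe => h _; move: h; rewrite (_ : _ \o _ = EFin \o t)//; apply/funext => x /=; rewrite GE.
  pose T := (\int[leb]_x t x)%R.
  have TE : (\int[leb]_x (t x)%:E)%E = T%:E.
    by rewrite /T /Rintegral fineK// integrable_fin_num.
  have ib : leb.-integrable setT (EFin \o (fun x => cmod (g x) ^+ 2 / Q x)).
    apply/integrableP; split; first exact/measurable_EFinP.
    under eq_integral do rewrite gee0_abs ?lee_fin ?divr_ge0 ?sqr_ge0 ?(ltW (Q0 _))//.
    exact: Boo.
  have BE : B = (\int[leb]_x (cmod (g x) ^+ 2 / Q x))%R%:E.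
    by rewrite /B /Rintegral fineK// integrable_fin_num.
  rewrite -/t TE BE lee_fin.
  have T1 : T = (\int[leb]_x re (g x * eta x))%R.
    have := congr1 re ige; rewrite /cint /= => ->.
    by apply: eq_Rintegral => x _; rewrite GE.
  (* AM-GM with [chi^2 <= chi]. The second half is [T / 2], finite because of the cut-off, and is
     absorbed by the left-hand side. *)
  have T2 : T <= (\int[leb]_x (2^-1 * (cmod (g x) ^+ 2 / Q x) + 2^-1 * t x))%R.
    rewrite T1; apply: le_Rintegral => //; first by case: ig.
      by apply: (integrableD measurableT (integrableZl measurableT _ ib) (integrableZl
        measurableT _ ti)).
    move=> x _; apply: (le_trans (ler_norm _)); apply: (le_trans (re_le_cmod _)).
    rewrite /eta !cmodM !cmod_real cmodJ (ger0_norm (box_bump_ge0 _ _ _)).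
    rewrite ger0_norm ?invr_ge0 ?(ltW (Q0 x))// /t.
    have c0 := box_bump_ge0 (const_mx (- N.+1%:R)) (2 * N.+1%:R) x.
    have c1 := box_bump_le1 (const_mx (- N.+1%:R)) (2 * N.+1%:R) x.
    rewrite -/(chi N x) in c0 c1 *.
    set a := cmod (g x); set b := cmod (G x); set c := chi N x in c0 c1 *.
    have q0 : 0 <= (Q x)^-1 by rewrite invr_ge0 ltW.
    have -> : a * (c * (b * (Q x)^-1)) = (a * (c * b)) * (Q x)^-1 by ring.
    have -> : 2^-1 * (a ^+ 2 / Q x) + 2^-1 * (c * (b ^+ 2 / Q x)) =
       (2^-1 * a ^+ 2 + 2^-1 * (c * b ^+ 2)) * (Q x)^-1 by ring.
    rewrite ler_wpM2r//.
    have h1 := sqr_ge0 (a - c * b); rewrite sqrrB in h1.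
    have h2 : (c * b) ^+ 2 <= c * b ^+ 2.
      by rewrite exprMn ler_wpM2r ?sqr_ge0// expr2 ler_piMl.
    by lra.
  move: T2; rewrite RintegralD//; first last.
  - exact: (integrableZl measurableT _ ti).
  - exact: (integrableZl measurableT _ ib).
  by rewrite !RintegralZl// -/T; lra.
pose F N x := (chi N x * (cmod (G x) ^+ 2 / Q x))%:E.
have mF N : measurable_fun setT (F N).
  by apply/measurable_EFinP; exact: measurable_funM.
have G0 x : 0 <= cmod (G x) ^+ 2 / Q x by rewrite divr_ge0 ?sqr_ge0// ltW.
have F0 N x : setT x -> (0 <= F N x)%E.
  by move=> _; rewrite lee_fin mulr_ge0// box_bump_ge0.
(* Fatou removes the cut-off, the bound [B] being independent of [N]. *)
have := @fatou _ _ _ leb setT measurableT F mF F0.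
have -> : (fun x => limn_einf (F ^~ x)) = fun x => (bump_center%:E * (cmod (G x) ^+ 2 / Q x)%:E)%E.
  apply/funext => x.
  have hc : F ^~ x @ \oo --> (bump_center%:E * (cmod (G x) ^+ 2 / Q x)%:E)%E.
    apply: cvg_EFin; first exact: nearW.
    rewrite (_ : fine \o _ = fun N => chi N x * (cmod (G x) ^+ 2 / Q x))//.
    exact: (cvgM (chi_cvg x) (cvg_cst _)).
  rewrite is_cvg_limn_einfE; first exact: cvg_lim hc.
  by apply/cvg_ex; eexists; exact: hc.
rewrite ge0_integralZl//; first last.
- by rewrite lee_fin ltW// bump_center_gt0.
- by move=> x _; rewrite lee_fin.
- exact/measurable_EFinP.
move=> /le_trans; apply; rewrite limn_einf_lim; apply: lime_le; first exact: is_cvg_einfs.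
apply: nearW => n; apply: (le_trans _ (T_le n)).
by apply: ereal_inf_lbound; exists n => /=.
Qed.

End weighted_duality.

Section leibniz.
Context {R : realType} {d : nat}.
Local Notation E := 'rV[R]_d.
Local Notation C := R[i].
Local Notation leb := (lebesgue_rV R d).
Implicit Types (f g w zeta : E -> C).

(** All distributions of the letters of [s] over two complementary subwords, with repetitions: the
    terms of Leibniz' rule without binomial coefficients. *)
Fixpoint splits (s : seq 'I_d) : seq (seq 'I_d * seq 'I_d) :=
  if s is i :: s' then
    [seq (i :: p.1, p.2) | p <- splits s'] ++ [seq (p.1, i :: p.2) | p <- splits s']
  else [:: ([::], [::])].

Lemma cderiv_sum i I (s : seq I) (F : I -> E -> C) (l : I -> C) x :
  (forall p, cderiv i (F p) x (l p)) ->
  cderiv i (fun y => \sum_(p <- s) F p y) x (\sum_(p <- s) l p).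
Proof.
move=> h; elim: s => [|p s ih].
  rewrite big_nil; under eq_fun do rewrite big_nil; exact: cderiv_cst.
by rewrite big_cons; under eq_fun do rewrite big_cons; exact: cderivD.
Qed.

Lemma leibniz f g s : (forall k, csm k f) -> (forall k, csm k g) ->
  cpartials s (fun y => f y * g y) =
  fun x => \sum_(p <- splits s) cpartials p.1 f x * cpartials p.2 g x.
Proof.
move=> sf sg; elim: s => [|i s ih] /=.
  by apply/funext => x; rewrite big_seq1.
rewrite ih; apply/funext => x; apply: cderiv_cpartial.
rewrite big_cat !big_map /= -big_split /=; apply: cderiv_sum => p.
have hf : cderiv i (cpartials p.1 f) x (cpartial i (cpartials p.1 f) x).
  by apply: (@csm_cderiv _ _ 0); apply: csm_cpartials; exact: sf.
have hg : cderiv i (cpartials p.2 g) x (cpartial i (cpartials p.2 g) x).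
  by apply: (@csm_cderiv _ _ 0); apply: csm_cpartials; exact: sg.
exact: cderivM.
Qed.

(** What [cpartials s] becomes under the Fourier transform: the product of the factors
    [-2 pi i xi_j], for [j] in [s]. *)
Definition mul_coords (s : seq 'I_d) zeta (xi : E) : C :=
  (\prod_(i <- s) (0 +i* (- (2 * pi * xi ord0 i)))) * zeta xi.

Lemma mul_coords_cons i s zeta :
  mul_coords (i :: s) zeta = fun xi => (0 +i* (- (2 * pi * xi ord0 i))) * mul_coords s zeta xi.
Proof. by apply/funext => xi; rewrite /mul_coords big_cons mulrA. Qed.

Lemma ibs_mul_coords M s zeta : ibs M zeta -> ibs M (mul_coords s zeta).
Proof.
move=> bz; elim: s => [|i s ih].
  by rewrite (_ : mul_coords _ _ = zeta)//; apply/funext => x; rewrite /mul_coords big_nil mul1r.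
by rewrite mul_coords_cons; exact: ibs_mul_coord.
Qed.

Lemma cpartials_fourier M s zeta : ibs M zeta ->
  cpartials s (fourier zeta) = fourier (mul_coords s zeta).
Proof.
move=> bz; elim: s => [|i s ih] /=.
  by congr fourier; apply/funext => x; rewrite /mul_coords big_nil mul1r.
rewrite ih mul_coords_cons; apply/funext => xi; apply: cderiv_cpartial.
exact: (cderiv_fourier _ _ (ibs_mul_coords s bz)).
Qed.

Lemma cmod_fourier_le w xi : cinteg leb w ->
  cmod (fourier w xi) <= 2 * (\int[leb]_x cmod (w x))%R.
Proof.
move=> iw; have [mw cw] := (cintegP _ _).1 iw.
have := cmod_cI_le (cinteg_kernel xi iw).
under eq_integral do rewrite cmodM cmod_expi mul1r.
rewrite -(@fineK _ (\int[leb]_x (cmod (w x))%:E)%E); last exact: integrable_fin_num.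
by rewrite -EFinM lee_fin.
Qed.

Lemma cinteg_mul_fourier w zeta : cinteg leb w -> cinteg leb zeta ->
  cinteg leb (fun x => w x * fourier zeta x).
Proof.
move=> iw iz; have [mw _] := (cintegP _ _).1 iw; have [mz _] := (cintegP _ _).1 iz.
apply: (cinteg_le _ (cintegZ (2 * (\int[leb]_x cmod (zeta x))%R)%:C iw)).
  by apply: cmeasM => //; exact: cmeas_fourier.
move=> x; rewrite !cmodM mulrC ler_wpM2r ?cmod_ge0//.
by rewrite cmod_real (le_trans (cmod_fourier_le x iz))// ler_norm.
Qed.

Lemma fourier_multiplication w zeta : cinteg leb w -> cinteg leb zeta ->
  cint (fun x => w x * fourier zeta x) = cint (fun xi => fourier w xi * zeta xi).
Proof.
move=> iw iz.
have k1 (z : E * E) : cmod (expi (- (2 * pi * dotr z.1 z.2))) <= 1 by rewrite cmod_expi.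
have iF := cinteg_prod iw iz (cmeas_kernel d) k1.
have := cfubini iF => /= F.
transitivity (cI leb (fun x => cI leb (fun y => expi (- (2 * pi * dotr x y)) * (w x * zeta y)))).
  apply: eq_cI => x; rewrite -cIZ; last exact: cinteg_kernel.
  by apply: eq_cI => y; rewrite dotrC; ring.
rewrite F; apply: eq_cI => y; rewrite -cIZr; last exact: cinteg_kernel.
by apply: eq_cI => x; ring.
Qed.

End leibniz.

Section pde_symbol.
Context {R : realType} {d m : nat}.
Local Notation E := 'rV[R]_d.
Local Notation C := R[i].
Local Notation leb := (lebesgue_rV R d).
Variables (P : pred (multiindex d m)) (coef : multiindex d m -> C)
  (w : multiindex d m -> E -> C) (phi : E -> C) (M : R).
Hypothesis sphi : forall k, csm k phi.
Hypothesis bw : forall a s, P a -> ibs M (fun x => cpartials s phi x * w a x).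

Definition mseq (a : multiindex d m) : seq 'I_d :=
  flatten [seq nseq (a i) i | i <- enum 'I_d].

(** The Fourier transform of [phi] times the left-hand side of the equation: in each Leibniz term
    the derivatives [p.1] fall on the cut-off, and [p.2] turns into a multiplier. The sign is that
    of [dist_partial]. *)
Definition pde_symbol (xi : E) : C :=
  \sum_(a | P a) coef a * (-1) ^+ mlen a *
    \sum_(p <- splits (mseq a)) mul_coords p.2 (fourier (fun x => cpartials p.1 phi x * w a x)) xi.

Lemma csm_pde_symbol k : csm k pde_symbol.
Proof.
apply: csm_sum => a Pa; apply: csmM; first exact: csm_cst.
apply: csm_sum => p _; apply: csmM; last exact: csm_fourier (bw p.1 Pa).
apply: csm_prod => i _.
rewrite (_ : (fun _ => _) = fun x : E => (0 +i* (- (2 * pi))) * (x ord0 i)%:C).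
  by apply: csmM; [exact: csm_cst|exact: csm_coord].
by apply/funext => x; apply: complex_eqP; rewrite ?reM ?imM /=; ring.
Qed.

(** The equation is tested on [phi * fourier eta], which lies in [Ccinf Omega] because [eta] has
    bounded support and [phi] is a test function; then the transform is moved from [eta] to the
    coefficients by [fourier_multiplication]. *)
Lemma pde_fourier (Omega : set E) (T : (E -> C) -> C) (g : E -> C) : Ccinf Omega phi ->
  (forall theta, Ccinf Omega theta ->
     \sum_(a | P a) coef a * dist_partial a (dist_of_fun (w a)) theta = T theta) ->
  is_fourier (cutoff phi T) g ->
  forall (N : R) eta, schwartz eta -> ibs N eta ->
    cintegrable (fun xi => g xi * eta xi) /\
    cint (fun xi => g xi * eta xi) = cint (fun xi => pde_symbol xi * eta xi).
Proof.
move=> [_ [K [cK KO phi0]]] TE [_ hg] N eta se be.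
have [ig <-] := hg eta se; split=> //.
rewrite /cutoff -TE; last first.
  split; last by exists K; split=> // x /phi0 ->; rewrite mul0r.
  by apply/csmoothP => k; apply: csmM => //; exact: csm_fourier be.
have bm p := ibs_mul_coords p be.
have i1 a p : P a -> cinteg leb (fun x => (cpartials p.1 phi x * w a x) * fourier (mul_coords p.2
  eta) x).
  by move=> Pa; apply: cinteg_mul_fourier; [case: (bw p.1 Pa)|case: (bm p.2)].
have i2 a p : P a -> cinteg leb (fun xi => fourier (fun x => cpartials p.1 phi x * w a x) xi *
  mul_coords p.2 eta xi).
  move=> Pa; have [h1 _] := bm p.2; have [h2 _] := bw p.1 Pa.
  by under eq_fun do rewrite mulrC; exact: cinteg_mul_fourier.
rewrite /pde_symbol.
transitivity (cI leb (fun xi => \sum_(a | P a) coef a * (-1) ^+ mlen a *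
    \sum_(p <- splits (mseq a)) fourier (fun x => cpartials p.1 phi x * w a x) xi * mul_coords
      p.2 eta xi)); last first.
  apply: eq_cI => xi; rewrite mulr_suml; apply: eq_bigr => a _.
  rewrite -[RHS]mulrA; congr (_ * _); rewrite mulr_suml; apply: eq_bigr => p _.
  by rewrite /mul_coords; ring.
rewrite cI_sum; last first.
  by move=> a Pa; apply: cintegZ; apply: cinteg_sum => p _; exact: i2.
apply: eq_bigr => a Pa; rewrite cIZ; last by apply: cinteg_sum => p _; exact: i2.
rewrite /dist_partial mulrA; congr (_ * _).
rewrite cI_sum; last by move=> p _; exact: i2.
transitivity (cI leb (fun x => \sum_(p <- splits (mseq a))
   (cpartials p.1 phi x * w a x) * fourier (mul_coords p.2 eta) x)).
  apply: eq_cI => x; rewrite /mpartial -/(mseq a) leibniz//; last first.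
    by move=> k; exact: csm_fourier be.
  rewrite mulr_sumr; apply: eq_bigr => p _.
  by rewrite (cpartials_fourier p.2 be); ring.
rewrite cI_sum; last by move=> p _; exact: i1.
apply: eq_bigr => p _; apply: fourier_multiplication; first by case: (bw p.1 Pa).
by case: (bm p.2).
Qed.

End pde_symbol.

(** * Vanishing sequences and products with local coefficients *)

Section vanishing_sequences.
Context {R : realType}.
Implicit Types (a b : nat -> \bar R).

(** Convergence to 0 for squared norms in [[0, oo]], stated as an upper bound only, so that it
    passes to smaller sequences and needs no finiteness. *)
Definition enull a := forall e : R, 0 < e -> \forall n \near \oo, (a n <= e%:E)%E.

Lemma enull_le a b : (\forall n \near \oo, (a n <= b n)%E) -> enull b -> enull a.
Proof.
move=> ab hb e e0; have := hb e e0.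
by apply: filterS2 ab => n; exact: le_trans.
Qed.

Lemma enullD a b : enull a -> enull b -> enull (fun n => a n + b n)%E.
Proof.
move=> ha hb e e0; have e2 : 0 < e / 2 by rewrite divr_gt0.
have := hb _ e2; apply: filterS2 (ha _ e2) => n an bn.
by rewrite [e]splitr EFinD leeD.
Qed.

Lemma enullZ (c : R) a : 0 <= c -> enull a -> enull (fun n => c%:E * a n)%E.
Proof.
move=> c0 ha e e0; have c1 : 0 < c + 1 by rewrite ltr_wpDl.
have := ha (e / (c + 1)) (divr_gt0 e0 c1); apply: filterS => n an.
have : (c%:E * a n <= c%:E * (e / (c + 1))%:E)%E by rewrite lee_wpmul2l// lee_fin.
move/le_trans; apply; rewrite -EFinM lee_fin mulrA ler_pdivrMr// mulrC ler_wpM2l ?(ltW e0)//.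
by rewrite lerDl.
Qed.

Lemma enull_sum I (s : seq I) (P : pred I) (a : I -> nat -> \bar R) :
  (forall i, P i -> enull (a i)) -> enull (fun n => \sum_(i <- s | P i) a i n)%E.
Proof.
move=> ha; elim: s => [|i s ih].
  by move=> e e0; apply: nearW => n; rewrite big_nil lee_fin ltW.
have [Pi|Pi] := boolP (P i); last first.
  by apply: enull_le ih; apply: nearW => n; rewrite big_cons (negbTE Pi).
by apply: enull_le (enullD (ha i Pi) ih); apply: nearW => n; rewrite big_cons Pi.
Qed.

Lemma enull_cvg0 a : a @ \oo --> 0%E -> enull a.
Proof.
move=> a0 e e0; have : \forall n \near \oo, (a n < e%:E)%E.
  apply: (a0 [set y | (y < e%:E)%E]); apply: open_nbhs_nbhs; split; last by rewrite /= lte_fin.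
  exact: open_ereal_lt_ereal.
by apply: filterS => n; exact: ltW.
Qed.

Lemma enull_real (a : nat -> R) : a @ \oo --> (0 : R) -> enull (fun n => (a n)%:E).
Proof.
move=> a0 e e0; have : \forall n \near \oo, a n < e by exact: (cvgr_lt 0).
by apply: filterS => n; rewrite lee_fin; exact: ltW.
Qed.

Lemma ccvg_enull (z : nat -> R[i]) a : (\forall n \near \oo, ((cmod (z n))%:E <= a n)%E) ->
  enull a -> (z : nat -> R[i]^o) @ \oo --> (0 : R[i]^o).
Proof.
move=> za ha; apply/ccvg_cmodP; apply/cvgrPdist_le => e e0.
have := ha e e0; apply: filterS2 za => n zn an.
have := le_trans zn an; rewrite lee_fin subr0 sub0r normrN ger0_norm ?cmod_ge0//.
Qed.

End vanishing_sequences.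

Section complex_limits.
Context {R : realType} {T : Type} {F : set_system T} {FF : Filter F}.
Implicit Types (f g : T -> R[i]).

Lemma ccvgM f g (a b : R[i]) : (f : T -> R[i]^o) @ F --> (a : R[i]^o) ->
  (g : T -> R[i]^o) @ F --> (b : R[i]^o) ->
  ((fun t => f t * g t) : T -> R[i]^o) @ F --> (a * b : R[i]^o).
Proof.
move=> /ccvgP[f1 f2] /ccvgP[g1 g2]; apply/ccvgP; split.
  rewrite reM (_ : (fun _ => _) = fun t => re (f t) * re (g t) - im (f t) * im (g t)).
    exact: cvgB (cvgM f1 g1) (cvgM f2 g2).
  by apply/funext => t; rewrite reM.
rewrite imM (_ : (fun _ => _) = fun t => re (f t) * im (g t) + im (f t) * re (g t)).
  exact: cvgD (cvgM f1 g2) (cvgM f2 g1).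
by apply/funext => t; rewrite imM.
Qed.

Lemma ccvgD f g (a b : R[i]) : (f : T -> R[i]^o) @ F --> (a : R[i]^o) ->
  (g : T -> R[i]^o) @ F --> (b : R[i]^o) ->
  ((fun t => f t + g t) : T -> R[i]^o) @ F --> (a + b : R[i]^o).
Proof.
move=> /ccvgP[f1 f2] /ccvgP[g1 g2]; apply/ccvgP; split.
  rewrite reD (_ : (fun _ => _) = fun t => re (f t) + re (g t)); first exact: cvgD f1 g1.
  by apply/funext => t; rewrite reD.
rewrite imD (_ : (fun _ => _) = fun t => im (f t) + im (g t)); first exact: cvgD f2 g2.
by apply/funext => t; rewrite imD.
Qed.

Lemma ccvg_cst (a : R[i]) : ((fun=> a) : T -> R[i]^o) @ F --> (a : R[i]^o).
Proof. by apply/ccvgP; split; exact: cvg_cst. Qed.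

Lemma ccvg_sum I (s : seq I) (P : pred I) (f : I -> T -> R[i]) (a : I -> R[i]) :
  (forall i, P i -> (f i : T -> R[i]^o) @ F --> (a i : R[i]^o)) ->
  ((fun t => \sum_(i <- s | P i) f i t) : T -> R[i]^o) @ F --> (\sum_(i <- s | P i) a i : R[i]^o).
Proof.
move=> fa; elim: s => [|i s ih].
  rewrite big_nil (_ : (fun _ => _) = fun=> 0); first exact: ccvg_cst.
  by apply/funext => t; rewrite big_nil.
rewrite big_cons; case Pi: (P i).
  rewrite (_ : (fun _ => _) = fun t => f i t + \sum_(j <- s | P j) f j t).
    exact: ccvgD (fa i Pi) ih.
  by apply/funext => t; rewrite big_cons Pi.
rewrite (_ : (fun _ => _) = fun t => \sum_(j <- s | P j) f j t); first exact: ih.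
by apply/funext => t; rewrite big_cons Pi.
Qed.

End complex_limits.

Section local_products.
Context {R : realType} {d r : nat}.
Local Notation E := 'rV[R]_d.
Local Notation C := R[i].
Local Notation leb := (lebesgue_rV R d).
Variables (Omega : set E) (K : set E).
Hypotheses (oO : open Omega) (cK : compact K) (KO : K `<=` Omega).

Lemma compact_closed_rV : closed K.
Proof. exact: (compact_closed (@norm_hausdorff _ _) cK). Qed.

(** [g] is controlled on [Omega] only; near any point off [Omega] the product is identically 0, as
    [K] is closed. *)
Lemma continuous_mul_local (f g : E -> C) : continuous (f : E -> C^o) ->
  (forall x, ~ K x -> f x = 0) -> {within Omega, continuous (g : E -> C^o)} ->
  continuous (fun x => f x * g x : C^o).
Proof.
move=> cf f0 cg x; have [Ox|nOx] := pselect (Omega x).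
  have gx : {for x, continuous (g : E -> C^o)}.
    by move: cg; rewrite continuous_open_subspace// => /(_ x); apply; rewrite inE.
  exact: (@ccvgM R E (nbhs x) _ _ _ _ _ (cf x) gx).
have nK : ~ K x by move/KO.
have nx : nbhs x (~` K) by apply: open_nbhs_nbhs; split=> //; apply: closed_openC;
  exact: compact_closed_rV.
have z y : (~` K) y -> f y * g y = 0 by move=> /f0 ->; rewrite mul0r.
apply/(@ccvg_cmodP R E (nbhs x) _); rewrite (f0 x nK) mul0r.
apply: (@cvg_trans _ ((fun=> 0 : R) @ nbhs x)); last exact: cvg_cst.
by apply: near_eq_cvg; apply: filterS nx => y /z ->; rewrite subr0 cmod0.
Qed.

Lemma locally_uniform_cmod (F : nat -> E -> C) (G : E -> C) (e : R) :
  locally_uniform_cvg Omega F G -> 0 < e ->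
  \forall n \near \oo, forall x, K x -> cmod (F n x - G x) < e.
Proof.
move=> /(_ K cK KO) h e0.
have : \forall n \near \oo, [set h : E -> C^o | forall y, K y ->
  ball (G y : C^o) e%:C (h y : C^o)] (F n).
  apply: h; apply/uniform_nbhs.
  exists [set xy : C^o * C^o | ball xy.1 e%:C xy.2]; split=> //.
  by rewrite -entourage_ballE; exists e%:C => //=; rewrite ltcR.
apply: filterS => n hn x Kx; have := hn x Kx.
by rewrite /ball /= norm_cmod ltcR -cmodN opprB.
Qed.

Lemma ccont_uniform_limit (F : nat -> E -> C) (G : E -> C) :
  (forall n, continuous (F n : E -> C^o)) ->
  (forall e : R, 0 < e -> \forall n \near \oo, forall x, cmod (F n x - G x) < e) ->
  continuous (G : E -> C^o).
Proof.
move=> cF FG x; apply/(@ccvg_cmodP R E (nbhs x) _); apply/cvgrPdist_le => e e0.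
have [N _ hN] := FG _ (divr_gt0 e0 (ltr0n _ 3)).
have {}hN y : cmod (F N y - G y) < e / 3%:R by apply: hN => /=.
have /(@ccvg_cmodP R E (nbhs x) _)/cvgrPdist_le/(_ _ (divr_gt0 e0 (ltr0n _ 3))) := cF N x.
apply: filterS => y; rewrite !sub0r !normrN !ger0_norm ?cmod_ge0// => hy.
rewrite (_ : G y - G x = - (F N y - G y) + (F N y - F N x) + (F N x - G x)); last by ring.
apply: le_trans (cmodD _ _) _; apply: le_trans (lerD (cmodD _ _) (lexx _)) _.
have := hN y; have := hN x; rewrite cmodN; lra.
Qed.

Lemma cmod_compact_bound (f : E -> C) : continuous (f : E -> C^o) ->
  (forall x, ~ K x -> f x = 0) -> exists2 c : R, 0 <= c & forall x, cmod (f x) <= c.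
Proof.
move=> cf f0.
have n0 x : ~ K x -> cmod (f x) = 0 by move=> /f0 ->; rewrite cmod0.
have [M hM] := compact_support_bounded cK (cont_cmod cf) n0.
exists `|M|; first exact: normr_ge0.
by move=> x; rewrite (le_trans _ (le_trans (hM x) (ler_norm M)))// ler_norm.
Qed.

End local_products.

(** * Convergence of the principal part *)

Section local_L2.
Context {R : realType} {d r : nat}.
Local Notation E := 'rV[R]_d.
Local Notation C := R[i].
Local Notation leb := (lebesgue_rV R d).
Variables (Omega K : set E) (u : nat -> E -> 'cV[C]_r).
Hypotheses (cK : compact K) (KO : K `<=` Omega) (hu : weakly_null_L2loc Omega u).
Implicit Types (beta : 'I_r -> E -> C).

Let uK n j (x : E) : C := (\1_K x)%:C * u n x j ord0.

Let cmeas_uK n j : cmeas (uK n j).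
Proof. by have [h _] := hu; have [] := h n K cK KO j. Qed.

Let sqn_uK n j : (sqn leb (uK n j) < +oo)%E.
Proof. by have [h _] := hu; have [] := h n K cK KO j. Qed.

Let cmeas_1K : cmeas (fun x : E => (\1_K x)%:C : C).
Proof.
apply: cmeas_real; apply: measurable_indic; exact: compact_measurable_rV.
Qed.

Let weak_uK j (v : E -> R) : L2r leb v ->
  (fun n => cI leb (fun x => uK n j x * (v x)%:C) : C^o) @ \oo --> (0 : C^o).
Proof.
move=> [mv iv]; have [_ h] := hu.
pose w (x : E) : 'cV[C]_r := \col_k (if k == j then (\1_K x)%:C * (v x)%:C else 0).
have wE x k : w x k ord0 = if k == j then (\1_K x)%:C * (v x)%:C else 0 by rewrite mxE.
have := h K w cK KO; rewrite (_ : (fun n => cint _) = fun n => cI leb (fun x => uK n j x * (v x)%:C)).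
  apply; last by move=> x nKx; apply/matrixP => k k0; rewrite (ord1 k0) wE mxE indicE memNset//
    mul0r if_same.
  move=> k; under eq_fun do rewrite wE.
  have [_|_] := eqVneq k j; last first.
    split; first exact: cmeas_cst.
    by under eq_integral do rewrite cmod0 expr0n /=; rewrite integral0.
  split; first exact: cmeasM cmeas_1K (cmeas_real mv).
  apply: le_lt_trans (_ : (\int[leb]_x (v x ^+ 2)%:E < +oo)%E).
    apply: ge0_le_integral => //.
    - by move=> x _; rewrite lee_fin sqr_ge0.
    - by apply/measurable_EFinP; apply: measurable_cmod2; exact: cmeasM cmeas_1K (cmeas_real mv).
    - by apply/measurable_EFinP; apply: measurable_funX.
    move=> x _; rewrite lee_fin cmodM !cmod_real exprMn !real_normK ?num_real//.
    by rewrite ler_piMl ?sqr_ge0// indicE; case: (_ \in _); rewrite ?expr1n ?expr0n.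
  move/integrableP : iv => [_]; under eq_integral do rewrite gee0_abs ?lee_fin ?sqr_ge0//.
  by [].
apply/funext => n; apply: eq_cI => x.
rewrite (bigD1 j)//= wE eqxx big1 => [|k /negbTE kj]; last by rewrite wE kj conjc0 mulr0.
by rewrite /uK addr0 -realcM conjc_real realcM; ring.
Qed.

(** [weakly_null_bounded] concerns real functions; real test functions, placed in the component [j],
    separate the real and imaginary parts. *)
Let bounded_uK j : exists B : R, forall n, (sqn leb (uK n j) <= B%:E)%E.
Proof.
have L2re n : L2r leb (fun x => re (uK n j x)).
  have [m1 m2] := cmeas_uK n j; split=> //.
  apply: (le_integrable measurableT _ _ (sqn_integrable (cmeas_uK n j) (sqn_uK n j))) => //=.
    by apply/measurable_EFinP; exact: measurable_funX.
  move=> x _; rewrite lee_fin !ger0_norm ?sqr_ge0// sqr_cmod.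
  by rewrite lerDl sqr_ge0.
have L2im n : L2r leb (fun x => im (uK n j x)).
  have [m1 m2] := cmeas_uK n j; split=> //.
  apply: (le_integrable measurableT _ _ (sqn_integrable (cmeas_uK n j) (sqn_uK n j))) => //=.
    by apply/measurable_EFinP; exact: measurable_funX.
  move=> x _; rewrite lee_fin !ger0_norm ?sqr_ge0// sqr_cmod.
  by rewrite lerDr sqr_ge0.
have [|B1 hB1] := weakly_null_bounded L2re.
  move=> v /(weak_uK j)/ccvgP[+ _]; rewrite (_ : (fun t => re _) =
    fun n => (\int[leb]_x (re (uK n j x) * v x))%R)//.
  by apply/funext => n; apply: eq_Rintegral => x _; rewrite reM /= mulr0 subr0.
have [|B2 hB2] := weakly_null_bounded L2im.
  move=> v /(weak_uK j)/ccvgP[_]; rewrite (_ : (fun t => im _) =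
    fun n => (\int[leb]_x (im (uK n j x) * v x))%R)//.
  by apply/funext => n; apply: eq_Rintegral => x _; rewrite imM /= mulr0 add0r.
exists (B1 + B2) => n; rewrite /sqn.
have [_ i1] := L2re n; have [_ i2] := L2im n.
have E1 := fineK (integrable_fin_num measurableT i1).
have E2 := fineK (integrable_fin_num measurableT i2).
under eq_integral do rewrite sqr_cmod EFinD.
rewrite integralD//= -E1 -E2 -EFinD lee_fin.
by apply: lerD; [exact: hB1|exact: hB2].
Qed.

(** With [beta k x = phi x * A x i k], the component [i] of [phi A u_n]. *)
Definition lin beta n (x : E) : C := \sum_k beta k x * u n x k ord0.

Let linE beta n : (forall k x, ~ K x -> beta k x = 0) ->
  lin beta n = fun x => \sum_k beta k x * uK n k x.
Proof.
move=> b0; apply/funext => x; apply: eq_bigr => k _; rewrite /uK indicE.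
have [Kx|/b0 ->] := pselect (K x); last by rewrite !mul0r.
by rewrite mem_set// mul1r.
Qed.

Lemma lin_eq0 beta n x : (forall k y, ~ K y -> beta k y = 0) -> ~ K x -> lin beta n x = 0.
Proof. by move=> b0 nK; rewrite /lin big1// => k _; rewrite b0// mul0r. Qed.

Lemma cmeas_lin beta n : (forall k, cmeas (beta k)) -> (forall k x, ~ K x -> beta k x = 0) ->
  cmeas (lin beta n).
Proof.
move=> mb b0; rewrite linE//; apply: cmeas_sum => k _; exact: cmeasM (mb k) (cmeas_uK n k).
Qed.

(** [N] is chosen before [beta], [c] and [n]: with [c] fixed this is a uniform bound, with [c] small
    it makes the replacement of [A_n] by its limit negligible. *)
Lemma sqn_lin_le : exists2 N : R, 0 <= N & forall beta (c : R) n, 0 <= c ->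
  (forall k, cmeas (beta k)) -> (forall k x, ~ K x -> beta k x = 0) ->
  (forall k x, cmod (beta k x) <= c) -> (sqn leb (lin beta n) <= (N * c ^+ 2)%:E)%E.
Proof.
have /choice[B hB] := bounded_uK.
exists (2 ^+ size (index_enum 'I_r) * \sum_k `|B k|).
  by rewrite mulr_ge0 ?exprn_ge0// sumr_ge0.
move=> beta c n c0 mb b0 bc; rewrite linE//.
apply: le_trans (sqn_sum _ _ _) _ => [k _|]; first exact: cmeasM (mb k) (cmeas_uK n k).
rewrite -mulrA EFinM lee_wpmul2l// ?lee_fin ?exprn_ge0// mulr_suml -sumEFin.
apply: lee_sum => k _; rewrite mulrC EFinM.
apply: le_trans (le_sqn _ (sqr_ge0 c) _ (cmeas_uK n k) _) _.
- exact: cmeasM (mb k) (cmeas_uK n k).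
- move=> x; rewrite cmodM exprMn ler_wpM2r ?sqr_ge0// lerXn2r ?nnegrE ?cmod_ge0//.
rewrite lee_wpmul2l ?lee_fin ?sqr_ge0// (le_trans (hB k n))// lee_fin; exact: ler_norm.
Qed.

Lemma cinteg_lin beta (c : R) n : 0 <= c ->
  (forall k, cmeas (beta k)) -> (forall k x, ~ K x -> beta k x = 0) ->
  (forall k x, cmod (beta k x) <= c) -> cinteg leb (lin beta n).
Proof.
move=> c0 mb b0 bc; have [N _ hN] := sqn_lin_le.
apply: (@cinteg_sqn_off _ _ _ _ K).
- exact: compact_measurable_rV.
- exact: lebesgue_rV_compact_lty.
- exact: cmeas_lin.
- by move=> x; exact: lin_eq0.
by apply: le_lt_trans (hN beta c n c0 mb b0 bc) _; exact: ltry.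
Qed.

(** At a fixed frequency the transform is the pairing of [u_n] with an L2 function supported in [K],
    namely the conjugate of the kernel times [beta]. *)
Lemma fourier_lin_cvg0 beta (c : R) xi : 0 <= c ->
  (forall k, cmeas (beta k)) -> (forall k x, ~ K x -> beta k x = 0) ->
  (forall k x, cmod (beta k x) <= c) ->
  (fun n => fourier (lin beta n) xi : C^o) @ \oo --> (0 : C^o).
Proof.
move=> c0 mb b0 bc; have [_ h] := hu.
pose v (x : E) : 'cV[C]_r := \col_k conjc (expi (- (2 * pi * dotr x xi)) * beta k x).
have vE x k : v x k ord0 = conjc (expi (- (2 * pi * dotr x xi)) * beta k x) by rewrite mxE.
have := h K v cK KO; rewrite (_ : (fun n => cint _) = fun n => fourier (lin beta n) xi).
  apply; last by move=> x nKx; apply/matrixP => k k0; rewrite (ord1 k0) vE mxE b0// mulr0 conjc0.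
  move=> k; under eq_fun do rewrite vE.
  have mk : cmeas (fun x : E => expi (- (2 * pi * dotr x xi)) * beta k x).
    exact: cmeasM (cmeas_kernelr xi) (mb k).
  split; first exact: cmeasJ mk.
  have : (\int[leb]_x ((\1_K x)%:E * (c ^+ 2)%:E) < +oo)%E.
    rewrite ge0_integralZr//; last 2 first.
    - by apply/measurable_EFinP; apply: measurable_indic; exact: compact_measurable_rV.
    - by rewrite lee_fin sqr_ge0.
    rewrite integral_indic ?setIT//; last exact: compact_measurable_rV.
    have Kf : leb K \is a fin_num by rewrite ge0_fin_numE//; exact: lebesgue_rV_compact_lty.
    by apply: lte_mul_pinfty; rewrite ?measure_ge0// ltry.
  apply: le_lt_trans; apply: ge0_le_integral => //.
  - by move=> x _; rewrite lee_fin sqr_ge0.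
  - by apply/measurable_EFinP; apply: measurable_cmod2; exact: cmeasJ mk.
  - apply: emeasurable_funM; last exact: measurable_cst.
    by apply/measurable_EFinP; apply: measurable_indic; exact: compact_measurable_rV.
  move=> x _; rewrite -EFinM lee_fin cmodJ cmodM cmod_expi mul1r indicE.
  have [Kx|nKx] := pselect (K x); last by rewrite memNset// mul0r b0// cmod0 expr0n.
  by rewrite mem_set// mul1r lerXn2r ?nnegrE ?cmod_ge0.
apply/funext => n; apply: eq_cI => x; rewrite /lin mulr_sumr.
by apply: eq_bigr => k _; rewrite vE conjcK; ring.
Qed.

(** The L1 norm is bounded through [|w| <= 1_K + |w|^2], valid for [w] vanishing off [K]. *)
Lemma fourier_lin_bounded beta (c : R) : 0 <= c ->
  (forall k, cmeas (beta k)) -> (forall k x, ~ K x -> beta k x = 0) ->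
  (forall k x, cmod (beta k x) <= c) ->
  exists2 M : R, 0 <= M & forall n xi, cmod (fourier (lin beta n) xi) <= M.
Proof.
move=> c0 mb b0 bc; have [N N0 hN] := sqn_lin_le.
have Kf : leb K \is a fin_num by rewrite ge0_fin_numE//; exact: lebesgue_rV_compact_lty.
exists (2 * (fine (leb K) + N * c ^+ 2)).
  by rewrite mulr_ge0// addr_ge0 ?mulr_ge0 ?sqr_ge0// fine_ge0.
move=> n xi; apply: le_trans (cmod_fourier_le xi (cinteg_lin n c0 mb b0 bc)) _.
rewrite ler_pM2l// -lee_fin.
have [ml il] := (cintegP _ _).1 (cinteg_lin n c0 mb b0 bc).
rewrite [X in (X <= _)%E](fineK (integrable_fin_num measurableT il)) EFinD fineK//.
apply: (@le_trans _ _ (leb K + sqn leb (lin beta n))%E); last by rewrite leeD2l// hN.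
have mK : measurable K by exact: compact_measurable_rV.
have -> : leb K = (\int[leb]_x (\1_K x)%:E)%E by rewrite integral_indic ?setIT.
rewrite -ge0_integralD//; last 3 first.
- by apply/measurable_EFinP; exact: measurable_indic.
- by move=> x _; rewrite lee_fin sqr_ge0.
- by apply/measurable_EFinP; exact: measurable_cmod2.
apply: ge0_le_integral => //.
- by move=> x _; rewrite lee_fin cmod_ge0.
- by apply/measurable_EFinP; exact: measurable_cmod.
- apply: emeasurable_funD; apply/measurable_EFinP; [exact: measurable_indic|exact: measurable_cmod2].
move=> x _; rewrite -EFinD lee_fin indicE.
have [Kx|nKx] := pselect (K x); last by rewrite memNset// lin_eq0// cmod0 expr0n add0r.
rewrite mem_set//; have := sqr_ge0 (cmod (lin beta n x) - 1); have := sqr_ge0 (cmod (lin beta n x)).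
by rewrite sqrrB expr1n (_ : true%:R = 1 :> R)//; lra.
Qed.

(** Dominated convergence: pointwise convergence, and a bound uniform in [n] and [xi] on a set of
    finite measure. *)
Lemma low_frequency beta (c : R) (D : set E) : measurable D -> (leb D < +oo)%E -> 0 <= c ->
  (forall k, cmeas (beta k)) -> (forall k x, ~ K x -> beta k x = 0) ->
  (forall k x, cmod (beta k x) <= c) ->
  enull (fun n => sqn leb (fun xi => (\1_D xi)%:C * fourier (lin beta n) xi)).
Proof.
move=> mD Doo c0 mb b0 bc; have [M M0 hM] := fourier_lin_bounded c0 mb b0 bc.
have m1 : cmeas (fun x : E => (\1_D x)%:C : C) by apply: cmeas_real; exact: measurable_indic.
have mf n : cmeas (fun xi => (\1_D xi)%:C * fourier (lin beta n) xi).
  by apply: cmeasM => //; apply: cmeas_fourier; exact: cmeas_lin.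
have iD : leb.-integrable setT (fun x => (M ^+ 2)%:E * (\1_D x)%:E)%E.
  apply: integrableZl => //; apply/integrableP; split.
    by apply/measurable_EFinP; exact: measurable_indic.
  by under eq_integral do rewrite gee0_abs ?lee_fin//; rewrite integral_indic// setIT.
pose F n xi := (\1_D xi)%:C * fourier (lin beta n) xi.
have mF n : measurable_fun setT (fun xi => (cmod (F n xi) ^+ 2)%:E).
  by apply/measurable_EFinP; exact: measurable_cmod2 (mf n).
have aF : {ae leb, forall xi, setT xi -> (fun n => (cmod (F n xi) ^+ 2)%:E) @ \oo --> (0%:E : \bar R)}.
  apply: aeW => xi _; apply: cvg_EFin; first exact: nearW.
  have : (F ^~ xi : nat -> C^o) @ \oo --> ((\1_D xi)%:C * 0 : C^o).
    have h1 : ((fun=> (\1_D xi)%:C) : nat -> C^o) @ \oo --> ((\1_D xi)%:C : C^o) by exact: ccvg_cst.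
    have h2 := fourier_lin_cvg0 xi c0 mb b0 bc.
    exact: ccvgM h1 h2.
  rewrite mulr0 => /ccvg_cmodP h.
  rewrite (_ : _ \o _ = fun n => cmod (F n xi - 0) * cmod (F n xi - 0)).
    by rewrite -[X in _ --> X](mulr0 0); exact: (cvgM h h).
  by apply/funext => n /=; rewrite subr0 expr2.
have bF : {ae leb, forall xi n, setT xi ->
  (`|(cmod (F n xi) ^+ 2)%:E| <= (M ^+ 2)%:E * (\1_D xi)%:E)%E}.
  apply: aeW => xi n _; rewrite gee0_abs; last by rewrite lee_fin sqr_ge0.
  rewrite -EFinM lee_fin /F cmodM cmod_real indicE.
  case: (_ \in _); last by rewrite normr0 mul0r expr0n mulr0.
  by rewrite normr1 mul1r mulr1 lerXn2r ?nnegrE ?cmod_ge0.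
have [_ _] := @dominated_convergence _ _ _ leb setT measurableT
  (fun n xi => (cmod (F n xi) ^+ 2)%:E) (fun=> 0%:E) _ mF (@measurable_cst _ _ _ _ setT _) aF iD bF.
rewrite integral0; exact: enull_cvg0.
Qed.

End local_L2.

(** * Estimates of the symbol and of the weights *)

Section symbol_identities.
Context {R : realType} {d m : nat}.
Local Notation E := 'rV[R]_d.
Local Notation C := R[i].
Local Notation leb := (lebesgue_rV R d).
Implicit Types (zeta : E -> C) (a : multiindex d m) (xi : E).

(** The splits with at least one derivative on the cut-off; [splitsE] sets apart the remaining one,
    which gives the principal part. *)
Fixpoint lower_splits (s : seq 'I_d) : seq (seq 'I_d * seq 'I_d) :=
  if s is i :: s' then
    [seq (i :: p.1, p.2) | p <- splits s'] ++ [seq (p.1, i :: p.2) | p <- lower_splits s']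
  else [::].

Lemma splitsE (s : seq 'I_d) : splits s = rcons (lower_splits s) ([::], s).
Proof. by elim: s => //= i s ih; rewrite {2}ih map_rcons rcons_cat. Qed.

Lemma size_splits (s : seq 'I_d) p : p \in splits s -> (size p.2 <= size s)%N.
Proof.
elim: s p => [|i s ih] p /=; first by rewrite inE => /eqP ->.
by rewrite mem_cat => /orP[] /mapP[q qs ->] /=; have := ih q qs => //; exact: leqW.
Qed.

Lemma size_lower_splits (s : seq 'I_d) p : p \in lower_splits s -> (size p.2 < size s)%N.
Proof.
elim: s p => [|i s ih] p //=.
rewrite mem_cat => /orP[] /mapP[q qs ->] /=; first by rewrite ltnS; exact: size_splits.
by rewrite ltnS; exact: ih.
Qed.

Lemma size_mseq a : size (mseq a) = mlen a.
Proof.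
rewrite /mseq /mlen size_flatten /shape -map_comp sumnE big_map big_enum /=.
by apply: eq_bigr => i _; rewrite size_nseq.
Qed.

Lemma enorm_ge0 xi : 0 <= enorm xi.
Proof. exact: sqrtr_ge0. Qed.

Lemma sqr_enorm xi : enorm xi ^+ 2 = \sum_i xi ord0 i ^+ 2.
Proof. by rewrite sqr_sqrtr// sumr_ge0// => i _; rewrite sqr_ge0. Qed.

Lemma coord_le_enorm xi i : `|xi ord0 i| <= enorm xi.
Proof.
rewrite -(@ler_sqr R) ?nnegrE ?normr_ge0 ?enorm_ge0// sqr_enorm real_normK ?num_real//.
by rewrite (bigD1 i)//= lerDl sumr_ge0// => j _; rewrite sqr_ge0.
Qed.

Lemma enormZ (t : R) xi : 0 <= t -> enorm (t *: xi) = t * enorm xi.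
Proof.
move=> t0; rewrite /enorm; under eq_bigr do rewrite mxE exprMn.
by rewrite -mulr_sumr sqrtrM ?sqr_ge0// sqrtr_sqr ger0_norm.
Qed.

Lemma mpow_le a xi : `|mpow a xi| <= enorm xi ^+ mlen a.
Proof.
rewrite /mpow normr_prod /mlen -prodrXr; apply: ler_prod => i _.
by rewrite normr_ge0 normrX lerXn2r ?nnegrE ?normr_ge0 ?enorm_ge0// coord_le_enorm.
Qed.

Lemma mpowZ (t : R) a xi : mpow a (t *: xi) = t ^+ mlen a * mpow a xi.
Proof.
rewrite /mpow /mlen -prodrXr -big_split /=; apply: eq_bigr => i _.
by rewrite mxE exprMn.
Qed.

(** The sign from integration by parts cancels the one in [-2 pi i]. *)
Lemma mul_coords_mseq a zeta xi :
  (-1) ^+ mlen a * mul_coords (mseq a) zeta xi =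
  (0 +i* (2 * pi)) ^+ mlen a * (mpow a xi)%:C * zeta xi.
Proof.
rewrite /mul_coords mulrA; congr (_ * _).
have -> : \prod_(i <- mseq a) (0 +i* (- (2 * pi * xi ord0 i))) =
    (0 +i* (- (2 * pi))) ^+ mlen a * (mpow a xi)%:C :> C.
  rewrite /mseq big_flatten /= big_map big_enum /= /mlen -prodrXr /mpow.
  rewrite (_ : (\prod_i xi ord0 i ^+ a i)%:C = \prod_i ((xi ord0 i)%:C ^+ a i)); last first.
    elim/big_ind2: _ => // [x1 x2 y1 y2 <- <-|i _]; [by rewrite realcM|by rewrite realcX].
  rewrite -big_split /=; apply: eq_bigr => i _.
  rewrite big_nseq -exprMn iter_mulr_1; congr (_ ^+ _).
  by apply: complex_eqP; rewrite ?reM ?imM /=; ring.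
rewrite mulrA -exprMn; congr (_ ^+ _ * _).
by apply: complex_eqP; rewrite ?reM ?imM /=; ring.
Qed.

Lemma cmod_mul_coords_le s zeta xi :
  cmod (mul_coords s zeta xi) <= (2 * pi * enorm xi) ^+ size s * cmod (zeta xi).
Proof.
rewrite /mul_coords cmodM ler_wpM2r ?cmod_ge0//.
elim: s => [|i s ih]; first by rewrite big_nil cmod1 expr0.
rewrite big_cons cmodM /= exprS ler_pM ?cmod_ge0//.
rewrite (_ : cmod _ = 2 * pi * `|xi ord0 i|).
  by rewrite ler_wpM2l ?mulr_ge0 ?pi_ge0// coord_le_enorm.
rewrite cmodE /= expr0n /= add0r sqrtr_sqr normrN normrM ger0_norm//.
by rewrite mulr_ge0 ?pi_ge0.
Qed.

End symbol_identities.

Section symbol_estimates.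
Context {R : realType} {d m : nat}.
Local Notation E := 'rV[R]_d.
Local Notation C := R[i].
Variables (l : nat) (hl : (l <= m)%N) (e w lam B : R).
Hypotheses (e0 : 0 < e) (w0 : 0 < w) (lam0 : 0 <= lam).
Hypothesis lamB : forall s, (l <= s <= m)%N -> lam * (e / w) ^+ (s - l) <= B.
Implicit Types (a : multiindex d m) (xi : E).

Lemma exprn_le_interp (t : R) (k n : nat) : 0 <= t -> (k <= n)%N -> t ^+ k <= 1 + t ^+ n.
Proof.
move=> t0 kn; have [t1|t1] := leP t 1.
  by rewrite (le_trans (exprn_ile1 k t0 t1))// lerDl exprn_ge0.
rewrite (le_trans (_ : _ <= t ^+ n)) ?lerDr//.
by rewrite ler_weXn2l// ltW.
Qed.

(** The denominator of [weight l a] at [w *: xi], divided by [w ^+ l]. *)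
Definition den xi : R := enorm xi ^+ l + w ^+ (m - l) * enorm xi ^+ m.

Lemma den_gt0 xi : 0 < enorm xi -> 0 < den xi.
Proof.
by move=> x0; rewrite ltr_pwDl ?exprn_gt0// mulr_ge0 ?exprn_ge0 ?ltW.
Qed.

Lemma B_ge0 : 0 <= B.
Proof.
have := @lamB l; rewrite leqnn hl subnn expr0 mulr1 => /(_ isT).
exact: le_trans.
Qed.

(** The left-hand side is [lam (e/w)^(s-l)], at most [B], times [|xi|^l (w |xi|)^(s-l)]; the
    intermediate power of [w |xi|] is at most 1 plus the power [m - l]. *)
Lemma lam_power_le s xi : (l <= s <= m)%N -> lam * (e ^+ (s - l) * enorm xi ^+ s) <= B * den xi.
Proof.
move=> /andP[ls sm]; have x0 := enorm_ge0 xi.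
have -> : lam * (e ^+ (s - l) * enorm xi ^+ s) =
   (lam * (e / w) ^+ (s - l)) * (enorm xi ^+ l * (w * enorm xi) ^+ (s - l)).
  rewrite (_ : enorm xi ^+ s = enorm xi ^+ l * enorm xi ^+ (s - l)); last by rewrite -exprD subnKC.
  rewrite !exprMn exprVn.
  have : w ^+ (s - l) != 0 by rewrite expf_neq0// gt_eqF.
  by move=> ?; field.
have wx : 0 <= w * enorm xi by rewrite mulr_ge0// ltW.
apply: ler_pM.
- by rewrite mulr_ge0// exprn_ge0// divr_ge0// ltW.
- by rewrite mulr_ge0// exprn_ge0.
- by apply: lamB; rewrite ls.
rewrite (_ : den xi = enorm xi ^+ l * (1 + (w * enorm xi) ^+ (m - l))).
  by rewrite ler_wpM2l ?exprn_ge0// exprn_le_interp// leq_sub2r.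
by rewrite /den -{2}(subnK hl) exprD exprMn; ring.
Qed.

Lemma lam_le_den xi : 1 <= enorm xi -> lam <= B * den xi.
Proof.
move=> x1; have x0 := enorm_ge0 xi.
have lB : lam <= B.
  by have := @lamB l; rewrite leqnn hl subnn expr0 mulr1; apply.
apply: le_trans lB _; rewrite ler_peMr ?B_ge0//.
rewrite /den (le_trans (_ : 1 <= enorm xi ^+ l))//; first exact: exprn_ege1.
by rewrite lerDl mulr_ge0// exprn_ge0// ltW.
Qed.

(** Squares the terms of [Dsum], the denominator in the hypothesis on [f], one by one: only even
    powers of [|xi|] remain, so the result is a polynomial, hence smooth at the origin. *)
Definition Qsum xi : R :=
  1 + \sum_(l <= s < m.+1) e ^+ (s - l) ^+ 2 * (\sum_i xi ord0 i ^+ 2) ^+ s.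

Definition Dsum xi : R := 1 + \sum_(l <= s < m.+1) e ^+ (s - l) * enorm xi ^+ s.

Let QsumE xi : Qsum xi = 1 + \sum_(l <= s < m.+1) (e ^+ (s - l) * enorm xi ^+ s) ^+ 2.
Proof.
congr (1 + _); apply: eq_bigr => s _; rewrite -sqr_enorm.
by rewrite [RHS]exprMn; congr (_ * _); exact: exprAC.
Qed.

Lemma Qsum_gt0 xi : 0 < Qsum xi.
Proof. by rewrite QsumE ltr_pwDl// sumr_ge0// => s _; rewrite sqr_ge0. Qed.

Lemma csm_Qsum k : csm k (fun xi : E => (Qsum xi)%:C).
Proof.
rewrite (_ : (fun _ => _) = fun xi : E => 1 + \sum_(l <= s < m.+1)
   (e ^+ (s - l) ^+ 2)%:C * (\sum_i (xi ord0 i)%:C ^+ 2) ^+ s).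
  apply: csmD; first exact: csm_cst.
  apply: csm_sum => s _; apply: csmM; first exact: csm_cst.
  apply: csmX; apply: csm_sum => i _; apply: csmX; exact: csm_coord.
apply/funext => xi; rewrite /Qsum realcD raddf_sum /=; congr (_ + _).
apply: eq_bigr => s _; rewrite realcM [X in _ * X]realcX; congr (_ * _ ^+ _).
by rewrite raddf_sum /=; apply: eq_bigr => i _; rewrite realcX.
Qed.

(** [m.+2] counts the constant term and at most [m.+1] powers. Only the constant term needs
    [|xi| >= 1], since [den] may vanish at 0. *)
Lemma lam_Qsum_le xi : 1 <= enorm xi ->
  lam ^+ 2 * Qsum xi <= m.+2%:R * (B * den xi) ^+ 2.
Proof.
move=> x1; rewrite QsumE mulrDr mulr1 mulr_sumr.
have Bd : 0 <= B * den xi by rewrite (le_trans lam0)// lam_le_den.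
rewrite -natr1 mulrDl mul1r addrC lerD//; last first.
  by rewrite lerXn2r ?nnegrE// lam_le_den.
apply: (@le_trans _ _ (\sum_(l <= s < m.+1) (B * den xi) ^+ 2)).
  rewrite big_nat_cond [leRHS]big_nat_cond; apply: ler_sum => s /andP[/andP[ls sm] _].
  rewrite -exprMn lerXn2r ?nnegrE//; last by apply: lam_power_le; rewrite ls.
  by rewrite mulr_ge0// mulr_ge0// exprn_ge0// ?enorm_ge0// ltW.
rewrite sumr_const_nat -[leLHS]mulr_natl ler_wpM2r ?sqr_ge0//.
by rewrite ler_nat leq_subr.
Qed.

Lemma Dsum_ge1 xi : 1 <= Dsum xi.
Proof.
rewrite lerDl sumr_ge0// => s _; apply: mulr_ge0; apply: exprn_ge0; [exact: ltW|exact: enorm_ge0].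
Qed.

Lemma Dsum_le xi : Dsum xi ^+ 2 <= 2 ^+ m.+2 * Qsum xi.
Proof.
rewrite QsumE /Dsum; set s1 := \sum_(_ <= _ < _) _; set s2 := \sum_(_ <= _ < _) _.
have h : s1 ^+ 2 <= 2 ^+ m.+1 * s2.
  have := sqr_cmod_sum (index_iota l m.+1) xpredT (fun s => (e ^+ (s - l) * enorm xi ^+ s)%:C).
  rewrite -raddf_sum /= cmod_real real_normK ?num_real// -/s1 => /le_trans; apply.
  rewrite (_ : \sum_(_ <- _ | _) _ = s2).
    rewrite ler_wpM2r//; first by rewrite sumr_ge0// => s _; rewrite sqr_ge0.
    by rewrite ler_weXn2l ?ler1n// size_iota leq_subr.
  by apply: eq_bigr => s _; rewrite cmod_real real_normK ?num_real.
have p1 : 1 <= 2 ^+ m.+1 :> R by rewrite exprn_ege1// ler1n.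
have := sqr_ge0 (1 - s1); rewrite [2 ^+ m.+2]exprS; nra.
Qed.

(** The coefficients [e^(|a|-l) xi^a] of the equation, multiplied by [lam / den], become the
    rescaled weights with bounded factors. *)
Lemma weight_scaled a xi : 0 < enorm xi -> (l <= mlen a <= m)%N ->
  lam * (e / w) ^+ (mlen a - l) * weight l a (w *: xi) =
  lam / den xi * (e ^+ (mlen a - l) * mpow a xi).
Proof.
move=> x0 /andP[la am]; rewrite /weight mpowZ (enormZ _ (ltW w0)) /den.
have wl : w ^+ l != 0 by rewrite expf_neq0// gt_eqF.
have ws : w ^+ (mlen a - l) != 0 by rewrite expf_neq0// gt_eqF.
have d0 := den_gt0 x0; move: d0; rewrite /den => d0.
have -> : (w * enorm xi) ^+ l + (w * enorm xi) ^+ m =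
    w ^+ l * (enorm xi ^+ l + w ^+ (m - l) * enorm xi ^+ m).
  by rewrite !exprMn mulrDr mulrA -exprD subnKC.
rewrite -{2}(subnKC la) exprD !exprMn exprVn.
have d1 := gt_eqF d0; have {}d1 : enorm xi ^+ l + w ^+ (m - l) * enorm xi ^+ m != 0 by rewrite d1.
by field; rewrite d1 wl ws.
Qed.

End symbol_estimates.

Lemma weight_le1 {R : realType} {d m : nat} l (a : multiindex d m) (xi : 'rV[R]_d) :
  (l <= mlen a <= m)%N -> `|weight l a xi| <= 1.
Proof.
move=> /andP[la am]; rewrite /weight normrM normfV.
have x0 := enorm_ge0 xi.
have s0 : 0 <= enorm xi ^+ l + enorm xi ^+ m by rewrite addr_ge0// exprn_ge0.
rewrite (ger0_norm s0).
(* At the origin, if [l > 0], the quotient is 0 by convention. *)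
have [->|sn0] := eqVneq (enorm xi ^+ l + enorm xi ^+ m) 0; first by rewrite invr0 mulr0.
rewrite ler_pdivrMr ?lt0r ?sn0// mul1r (le_trans (mpow_le a xi))//.
have lm := leq_trans la am.
have xs k : (l <= k)%N -> enorm xi ^+ k = enorm xi ^+ l * enorm xi ^+ (k - l).
  by move=> lk; rewrite -exprD subnKC.
rewrite (xs _ la) (xs _ lm) -{2}[enorm xi ^+ l]mulr1 -mulrDr.
by rewrite ler_wpM2l ?exprn_ge0// exprn_le_interp// leq_sub2r.
Qed.

Lemma measurable_invr d (T : measurableType d) (R : realType) (f : T -> R) :
  measurable_fun setT f -> measurable_fun setT (fun x => (f x)^-1).
Proof.
suff h : measurable_fun [set: measurableTypeR R] (fun y : R => y^-1).
  by move=> mf; exact: (measurableT_comp h mf).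
have m0 : measurable [set (0 : measurableTypeR R)] by exact: measurable_set1.
rewrite -(setvU [set (0 : measurableTypeR R)]).
apply/measurable_funU => //; first exact: measurableC.
split; last exact: measurable_fun_set1.
apply: subspace_continuous_measurable_fun; first exact: measurableC.
apply: continuous_in_subspaceT => y; rewrite inE => y0.
by apply: inv_continuous; apply/eqP.
Qed.

Section fourier_approximation.
Context {R : realType} {d r : nat}.
Local Notation E := 'rV[R]_d.
Local Notation C := R[i].
Local Notation leb := (lebesgue_rV R d).
Variables (Omega K : set E) (c0 : E) (u : nat -> E -> 'cV[C]_r).
Hypotheses (cK : compact K) (KO : K `<=` Omega) (hu : weakly_null_L2loc Omega u).
Hypothesis Kc : K `<=` unit_cube c0.
Variables (bn : nat -> 'I_r -> E -> C) (b : 'I_r -> E -> C).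
Hypotheses (cbn : forall n k, continuous (bn n k : E -> C^o)).
Hypotheses (cb : forall k, continuous (b k : E -> C^o)).
Hypotheses (bn0 : forall n k x, ~ K x -> bn n k x = 0) (b0 : forall k x, ~ K x -> b k x = 0).
Hypothesis bnb : forall e : R, 0 < e -> \forall n \near \oo, forall k x, cmod (bn n k x - b k x) <= e.

Let bnd (h : 'I_r -> E -> C) : (forall k, continuous (h k : E -> C^o)) ->
  (forall k x, ~ K x -> h k x = 0) -> exists2 c : R, 0 <= c & forall k x, cmod (h k x) <= c.
Proof.
move=> ch h0.
have /choice[c hc] : forall k, exists c : R, 0 <= c /\ forall x, cmod (h k x) <= c.
  by move=> k; have [c ? ?] := cmod_compact_bound cK (ch k) (h0 k); exists c.
exists (\sum_k c k); first by apply: sumr_ge0 => k _; case: (hc k).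
move=> k x; have [_ h1] := hc k; apply: le_trans (h1 x) _.
by rewrite (bigD1 k)//= lerDl sumr_ge0// => j _; case: (hc j).
Qed.

Lemma cinteg_linc (h : 'I_r -> E -> C) n : (forall k, continuous (h k : E -> C^o)) ->
  (forall k x, ~ K x -> h k x = 0) -> cinteg leb (lin u h n).
Proof.
move=> ch h0; have [c c_ge0 hc] := bnd ch h0.
by apply: (cinteg_lin cK KO hu n c_ge0 _ h0 hc) => k; exact: ccont_cmeas.
Qed.

Lemma sqn_fourier_lin_le (h : 'I_r -> E -> C) n : (forall k, continuous (h k : E -> C^o)) ->
  (forall k x, ~ K x -> h k x = 0) -> (sqn leb (fourier (lin u h n)) <= sqn leb (lin u h n))%E.
Proof.
move=> ch h0; apply: (@plancherel_le _ _ c0).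
  by apply: (cmeas_lin cK KO hu) => // k; exact: ccont_cmeas.
by move=> x nx; apply: (lin_eq0 _ _ h0) => /Kc.
Qed.

Lemma sqn_fourier_lin_bounded : exists M : R, \forall n \near \oo,
  (sqn leb (fourier (lin u (bn n) n)) <= M%:E)%E.
Proof.
have [N N0 hN] := sqn_lin_le cK KO hu; have [c c_ge0 hc] := bnd cb b0.
exists (N * (c + 1) ^+ 2); have := bnb ltr01; apply: filterS => n hn.
apply: le_trans (@sqn_fourier_lin_le (bn n) n (@cbn n) (@bn0 n)) _.
apply: (hN (bn n) (c + 1) n _ _ (@bn0 n)); first by rewrite addr_ge0.
  by move=> k; exact: ccont_cmeas.
move=> k x; rewrite -(subrK (b k x) (bn n k x)) addrC.
by apply: le_trans (cmodD _ _) _; rewrite lerD// ?hc// hn.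
Qed.

Lemma fourier_lin_approx :
  enull (fun n => sqn leb (fun xi => fourier (lin u (bn n) n) xi - fourier (lin u b n) xi)).
Proof.
have [N N0 hN] := sqn_lin_le cK KO hu.
(* As [t <= 1], [N t^2 <= (N + 1) t <= e]. *)
move=> e e0; pose t := Num.min 1 (e / (N + 1)).
have N1 : 0 < N + 1 by rewrite ltr_wpDl.
have t0 : 0 < t by rewrite lt_min ltr01 divr_gt0.
have := bnb t0; apply: filterS => n hn.
pose g k x := bn n k x - b k x.
have cg k : continuous (g k : E -> C^o).
  rewrite (_ : g k = fun x => bn n k x + (-1) * b k x).
    by apply: ccontD; [exact: cbn|apply: ccontM; [exact: ccont_cst|exact: cb]].
  by apply/funext => x; rewrite mulN1r.
have g0 k x : ~ K x -> g k x = 0 by move=> nK; rewrite /g bn0// b0// subr0.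
rewrite (_ : (fun xi => _) = fourier (lin u g n)); last first.
  apply/funext => xi; rewrite /fourier -!/(cI _ _) -cIB.
  - apply: eq_cI => x; rewrite -mulrBr /lin -sumrB; congr (_ * _).
    by apply: eq_bigr => k _; rewrite mulrBl.
  - exact: (cinteg_kernel xi (cinteg_linc n (@cbn n) (@bn0 n))).
  - exact: (cinteg_kernel xi (cinteg_linc n cb b0)).
apply: le_trans (@sqn_fourier_lin_le g n cg g0) _.
apply: le_trans (hN g t n (ltW t0) _ g0 hn) _; first by move=> k; exact: ccont_cmeas.
rewrite lee_fin (@le_trans _ _ ((N + 1) * t))//.
  rewrite ler_pM ?sqr_ge0 ?lerDl// expr2 ler_piMl ?(ltW t0)//.
  by rewrite /t ge_min lexx.
by rewrite mulrC -ler_pdivlMr// /t ge_min lexx orbT.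
Qed.

Lemma low_frequency_approx (D : set E) : measurable D -> (leb D < +oo)%E ->
  enull (fun n => sqn leb (fun xi => (\1_D xi)%:C * fourier (lin u (bn n) n) xi)).
Proof.
move=> mD Doo; have [c c_ge0 hc] := bnd cb b0.
have mb k : cmeas (b k) by exact: ccont_cmeas.
have mbn n k : cmeas (bn n k) by exact: ccont_cmeas.
have m1 : cmeas (fun x : E => (\1_D x)%:C : C) by apply: cmeas_real; exact: measurable_indic.
have mF n : cmeas (fourier (lin u b n)) by apply: cmeas_fourier; exact: (cmeas_lin cK KO hu n mb b0).
have mFn n : cmeas (fourier (lin u (bn n) n)).
  by apply: cmeas_fourier; exact: (cmeas_lin cK KO hu n (mbn n) (@bn0 n)).
have h1 := low_frequency cK KO hu mD Doo c_ge0 mb b0 hc.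
apply: enull_le (enullD (enullZ (ler0n _ 2) fourier_lin_approx) (enullZ (ler0n _ 2) h1)).
apply: nearW => n.
have m2 : cmeas (fun xi => fourier (lin u (bn n) n) xi - fourier (lin u b n) xi) by exact: cmeasB.
rewrite (_ : (fun xi => _) = fun xi => (\1_D xi)%:C * (fourier (lin u (bn n) n) xi - fourier (lin
  u b n) xi)
   + (\1_D xi)%:C * fourier (lin u b n) xi).
  apply: le_trans (sqnD _ _ _) _; [exact: cmeasM|exact: cmeasM|].
  rewrite leeD2r// lee_pmul2l// -[leRHS]mul1e; apply: le_sqn => //; first exact: cmeasM.
  move=> x; rewrite mul1r cmodM exprMn ler_piMl ?sqr_ge0// cmod_real indicE.
  by case: (_ \in _); rewrite ?normr1 ?normr0 ?expr1n ?expr0n.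
by apply/funext => xi; ring.
Qed.

End fourier_approximation.

Section enorm_balls.
Context {R : realType} {d : nat}.
Local Notation E := 'rV[R]_d.

Lemma measurable_enorm_ball (rho : R) : measurable [set xi : E | enorm xi <= rho].
Proof.
apply: closed_measurable_rV.
rewrite (_ : [set _ | _] = (@enorm R d) @^-1` [set t | t <= rho])//.
by apply: closed_comp; [move=> ? _; exact: continuous_enorm|exact: closed_le].
Qed.

Lemma lebesgue_enorm_ball_lty (rho : R) : (lebesgue_rV R d [set xi : E | (enorm xi <= rho)%R] < +oo)%E.
Proof.
apply: le_lt_trans (lebesgue_rV_compact_lty (@compact_cube R d rho)).
apply: le_measure; rewrite ?inE.
- exact: measurable_enorm_ball.
- by apply: compact_measurable_rV; exact: compact_cube.
by move=> xi /= h i; exact: le_trans (coord_le_enorm xi i) h.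
Qed.

End enorm_balls.

Section eventually_bounded.
Context {R : realType}.
Implicit Types (a b : nat -> \bar R).

Definition ebounded a := exists M : R, \forall n \near \oo, (a n <= M%:E)%E.

Lemma ebounded_sum I (s : seq I) (P : pred I) (a : I -> nat -> \bar R) :
  (forall i, P i -> ebounded (a i)) -> ebounded (fun n => \sum_(i <- s | P i) a i n)%E.
Proof.
move=> h; elim: s => [|i s [M hM]].
  by exists 0; apply: nearW => n; rewrite big_nil.
case Pi: (P i); last by exists M; apply: filterS hM => n; rewrite big_cons Pi.
have [N hN] := h i Pi; exists (N + M); move: hM; apply: filterS2 hN => n h1 h2.
by rewrite big_cons Pi EFinD leeD.
Qed.

Lemma eboundedZ (c : R) a : 0 <= c -> ebounded a -> ebounded (fun n => c%:E * a n)%E.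
Proof.
move=> c0 [M hM]; exists (c * M); apply: filterS hM => n h.
by rewrite EFinM lee_wpmul2l// lee_fin.
Qed.

(** The vanishing error [z] may depend on [e], as the low-frequency part does on the radius chosen
    for [e]. *)
Lemma enull_approx a b : ebounded b ->
  (forall e : R, 0 < e -> exists2 z, enull z & \forall n \near \oo, (a n <= z n + e%:E * b n)%E) ->
  enull a.
Proof.
move=> [M hM] h e e0; have N0 : 0 < `|M| + 1 by rewrite ltr_wpDl.
have [z hz az] := h _ (divr_gt0 (divr_gt0 e0 (ltr0n _ 2)) N0).
have := hz _ (divr_gt0 e0 (ltr0n _ 2)); apply: filterS3 az hM => n an bn zn.
apply: le_trans an _; rewrite [e in leRHS]splitr EFinD leeD//.
apply: le_trans (_ : _ <= (e / 2 / (`|M| + 1))%:E * M%:E)%E _.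
  by rewrite lee_wpmul2l// lee_fin ltW// divr_gt0// divr_gt0.
rewrite -EFinM lee_fin mulrAC ler_pdivrMr// ler_wpM2l//.
  by rewrite ltW// divr_gt0.
by rewrite (le_trans (ler_norm M))// lerDl.
Qed.

Lemma enullM (c : nat -> R) a : (forall n, 0 <= c n) -> c @ \oo --> (0 : R) ->
  ebounded a -> enull (fun n => (c n)%:E * a n)%E.
Proof.
move=> c0 hc [M hM] e e0; have N0 : 0 < `|M| + 1 by rewrite ltr_wpDl.
have := (enull_real hc) _ (divr_gt0 e0 N0); apply: filterS2 hM => n an; rewrite lee_fin => cn.
apply: le_trans (_ : _ <= (c n)%:E * M%:E)%E _; first by rewrite lee_wpmul2l// lee_fin.
rewrite -EFinM lee_fin (@le_trans _ _ (c n * (`|M| + 1)))//.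
  by rewrite ler_wpM2l// (le_trans (ler_norm M))// lerDl.
by rewrite -ler_pdivlMr.
Qed.

End eventually_bounded.

(** * From the equation to its rescaled principal part *)

Section principal_part.
Context {R : realType} {d q r m : nat}.
Local Notation E := 'rV[R]_d.
Local Notation C := R[i].
Local Notation leb := (lebesgue_rV R d).
Variables (l : nat) (hl : (l <= m)%N) (Omega K : set E) (c0 : E) (u : nat -> E -> 'cV[C]_r).
Hypotheses (oO : open Omega) (cK : compact K) (KO : K `<=` Omega)
  (hu : weakly_null_L2loc Omega u) (Kc : K `<=` unit_cube c0).
Variables (phi : E -> C) (sphi : forall k, csm k phi) (phi0 : forall x, ~ K x -> phi x = 0).
Variables (A : nat -> multiindex d m -> E -> 'M[C]_(q, r))
  (Alim : multiindex d m -> E -> 'M[C]_(q, r)) (i : 'I_q).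
Local Notation P := (fun a : multiindex d m => (l <= mlen a <= m)%N).
Hypothesis hA : forall n a, P a -> forall i k,
    {within Omega, continuous (fun x => A n a x i k : C^o)}.
Hypothesis hAlim : forall a, P a -> forall i k,
    locally_uniform_cvg Omega (fun n x => A n a x i k) (fun x => Alim a x i k).
Variables (eps omega lam : nat -> R) (B : R).
Hypotheses (eps0 : forall n, 0 < eps n) (omega0 : forall n, 0 < omega n)
  (lam0 : forall n, 0 <= lam n).
Hypothesis lamB : forall n s, (l <= s <= m)%N -> lam n * (eps n / omega n) ^+ (s - l) <= B.
Variable f : nat -> 'I_q -> (E -> C) -> C.
Hypothesis hf0 : weighted_null Omega l m eps f.
Hypothesis hpde : forall n i theta, Ccinf Omega theta ->
    \sum_(a : multiindex d m | P a)
      (eps n ^+ (mlen a - l))%:C *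
      dist_partial a (dist_of_fun (fun x => (A n a x *m u n x) i ord0)) theta
    = f n i theta.

(** [bet n s a k] is the coefficient of the component [k] of [u_n] in the row [i] of
    [cpartials s phi] times [A_n^a u_n]; [betl] is its uniform limit. *)
Let par s := cpartials s phi.
Let bet n s a k x : C := par s x * A n a x i k.
Let betl s a k x : C := par s x * Alim a x i k.

Let cpar s : continuous (par s : E -> C^o).
Proof. exact: (csm_cont (csm_cpartials (sphi (size s + 0)))). Qed.

Let par0 s x : ~ K x -> par s x = 0.
Proof. by apply: cpartials_vanish => //; exact: compact_closed_rV cK. Qed.

Let cbet n s a k : P a -> continuous (bet n s a k : E -> C^o).
Proof. by move=> Pa; exact: (continuous_mul_local oO cK KO (@cpar s) (@par0 s) (@hA n a Pa i k)). Qed.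

Let bet0 n s a k x : ~ K x -> bet n s a k x = 0.
Proof. by move=> /(par0 s) h; rewrite /bet h mul0r. Qed.

Let betl0 s a k x : ~ K x -> betl s a k x = 0.
Proof. by move=> /(par0 s) h; rewrite /betl h mul0r. Qed.

Let betb s a (e : R) : P a -> 0 < e ->
  \forall n \near \oo, forall k x, cmod (bet n s a k x - betl s a k x) <= e.
Proof.
move=> Pa e0; apply: filter_forall => k.
have [c c_ge0 hc] := cmod_compact_bound cK (@cpar s) (@par0 s).
have c1 : 0 < c + 1 by rewrite ltr_wpDl.
have := locally_uniform_cmod cK KO (@hAlim a Pa i k) (divr_gt0 e0 c1).
apply: filterS => n hn x.
have [Kx|nKx] := pselect (K x); last by rewrite bet0// betl0// subr0 cmod0 ltW.
rewrite /bet /betl -mulrBr cmodM.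
apply: le_trans (_ : (c + 1) * (e / (c + 1)) <= _); last by rewrite mulrC divfK// gt_eqF.
by rewrite ler_pM ?cmod_ge0//; [rewrite (le_trans (hc x))// lerDl|exact: ltW (hn x Kx)].
Qed.

Let cbetl s a k : P a -> continuous (betl s a k : E -> C^o).
Proof.
move=> Pa; apply: (@ccont_uniform_limit _ _ (fun n => bet n s a k)).
  by move=> n; exact: cbet.
move=> e e0; have := betb s Pa (divr_gt0 e0 (ltr0n _ 2)).
by apply: filterS => n h x; apply: le_lt_trans (h k x) _; rewrite ltr_pdivrMr// ltr_pMr// ltr1n.
Qed.

Let Fou n s a := fourier (lin u (bet n s a) n).
Let Fl n a := fourier (lin u (betl [::] a) n).

Let mFou n s a : P a -> cmeas (Fou n s a).
Proof.
move=> Pa; apply: cmeas_fourier.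
apply: (cmeas_lin cK KO hu n _ (@bet0 n s a)) => k; apply: ccont_cmeas; exact: cbet.
Qed.

Let mFl n a : P a -> cmeas (Fl n a).
Proof.
move=> Pa; apply: cmeas_fourier.
apply: (cmeas_lin cK KO hu n _ (@betl0 [::] a)) => k; apply: ccont_cmeas; exact: cbetl.
Qed.

Let Fou_bounded s a : P a -> ebounded (fun n => sqn leb (Fou n s a)).
Proof.
move=> Pa; apply: (sqn_fourier_lin_bounded cK KO hu Kc (fun n k => @cbet n s a k Pa)
  (fun k => @cbetl s a k Pa) (fun n => @bet0 n s a) (@betl0 s a)).
by move=> e; exact: betb.
Qed.

Let Fou_low a (D : set E) : P a -> measurable D -> (leb D < +oo)%E ->
  enull (fun n => sqn leb (fun xi => (\1_D xi)%:C * Fou n [::] a xi)).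
Proof.
move=> Pa mD Doo.
apply: (low_frequency_approx cK KO hu Kc (fun n k => @cbet n [::] a k Pa)
  (fun k => @cbetl [::] a k Pa) (fun n => @bet0 n [::] a) (@betl0 [::] a) _ mD Doo).
by move=> e; exact: betb.
Qed.

Let Fou_approx a : P a -> enull (fun n => sqn leb (fun xi => Fou n [::] a xi - Fl n a xi)).
Proof.
move=> Pa.
apply: (fourier_lin_approx cK KO hu Kc (fun n k => @cbet n [::] a k Pa)
  (fun k => @cbetl [::] a k Pa) (fun n => @bet0 n [::] a) (@betl0 [::] a)).
by move=> e; exact: betb.
Qed.

Let wn n a x : C := (A n a x *m u n x) i ord0.

Let linE n s a : (fun x => cpartials s phi x * wn n a x) = lin u (bet n s a) n.
Proof.
apply/funext => x; rewrite /lin /wn mxE mulr_sumr; apply: eq_bigr => k _.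
by rewrite mulrA.
Qed.

(** The unit cube at [c0] lies in the cube of half-side [M0] about 0. *)
Let M0 : R := 1 + \sum_j `|c0 ord0 j|.

Let ibs_bet n a s : P a -> ibs M0 (fun x => cpartials s phi x * wn n a x).
Proof.
move=> Pa; rewrite linE; split.
  exact: (cinteg_linc cK KO hu n (fun k => @cbet n s a k Pa) (@bet0 n s a)).
move=> x nx; apply: (lin_eq0 u n (@bet0 n s a)) => Kx; apply: nx => j.
have := Kc Kx j; have : `|c0 ord0 j| <= \sum_j `|c0 ord0 j|.
  by rewrite [leRHS](bigD1 j)//= lerDl sumr_ge0.
have := ler_norm (c0 ord0 j); have := ler_norm (- c0 ord0 j); rewrite normrN /M0.
by move=> h1 h2 h3 /andP[h4 h5]; rewrite ler_norml; apply/andP; split; lra.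
Qed.

Let coef n (a : multiindex d m) : C := (eps n ^+ (mlen a - l))%:C.
Let G n := pde_symbol P (coef n) (wn n) phi.
Local Notation Q n := (@Qsum R d m l (eps n)).
Local Notation D n := (@Dsum R d m l (eps n)).

Let sG n k : csm k (G n).
Proof. by apply: (@csm_pde_symbol _ _ _ _ _ _ _ M0) => a s; exact: ibs_bet. Qed.

Let phiO : Ccinf Omega phi.
Proof. by split; [exact/csmoothP|exists K]. Qed.

Let measurable_GQ n : measurable_fun [set: E] (fun xi => cmod (G n xi) ^+ 2 / Q n xi).
Proof.
apply: measurable_funM.
  by apply: measurable_cmod2; apply: ccont_cmeas; exact: (csm_cont (sG n 0)).
by apply: measurable_invr; have [] := ccont_cmeas (csm_cont (@csm_Qsum R d m l (eps n) 0)).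
Qed.

(** Duality passes from [G] to [g], at the cost of the inverse of [bump_center]; [Dsum_le] then
    passes from the smooth weight to the given one, at the cost of [2 ^+ m.+2]. *)
Let G_null : enull (fun n => \int[leb]_xi (cmod (G n xi) ^+ 2 / Q n xi)%:E)%E.
Proof.
have [g [hg g0]] := hf0 phiO.
have b0 := @bump_center_gt0 R d.
apply: enull_le (enullZ _ (enull_cvg0 g0)); last first.
  by apply: (_ : 0 <= (@bump_center R d)^-1 * 2 ^+ m.+2); rewrite mulr_ge0 ?exprn_ge0// invr_ge0 ltW.
apply: nearW => n.
have h1 := weighted_duality (g := g n i) (G := G n) (Q := Q n) (hg n i).1 (sG n)
  (@csm_Qsum R d m l (eps n)) (@Qsum_gt0 R d m l (eps n))
  (pde_fourier sphi (@ibs_bet n) phiO (hpde n i) (hg n i)).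
have h2 : (\int[leb]_xi (cmod (g n i xi) ^+ 2 / Q n xi)%:E <= (2 ^+ m.+2)%:E *
    \int[leb]_xi (\sum_(i < q) (cmod (g n i xi) / D n xi) ^+ 2)%:E)%E.
  have mD : measurable_fun [set: E] (D n).
    apply: measurable_funD => //; apply: measurable_sum => s; apply: measurable_funM => //.
    by apply: measurable_funX; exact: continuous_measurable_rV (@continuous_enorm R d).
  have mS : measurable_fun [set: E] (fun xi => \sum_(i < q) (cmod (g n i xi) / D n xi) ^+ 2).
    apply: measurable_sum => j; apply: measurable_funX; apply: measurable_funM.
      exact: measurable_cmod (hg n j).1.
    exact: measurable_invr.
  have S0 xi : 0 <= \sum_(i < q) (cmod (g n i xi) / D n xi) ^+ 2.
    by apply: sumr_ge0 => j _; rewrite sqr_ge0.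
  rewrite -ge0_integralZl//; last 2 first.
  - exact/measurable_EFinP.
  - by move=> x _; rewrite lee_fin.
  apply: ge0_le_integral => //.
  - by move=> x _; rewrite lee_fin mulr_ge0 ?sqr_ge0// invr_ge0 ltW// Qsum_gt0.
  - apply/measurable_EFinP; apply: measurable_funM; first exact: measurable_cmod2 (hg n i).1.
    by apply: measurable_invr; have [] := ccont_cmeas (csm_cont (@csm_Qsum R d m l (eps n) 0)).
  - by apply/measurable_EFinP; apply: measurable_funM.
  move=> xi _; rewrite -EFinM lee_fin.
  have D1 : 0 < D n xi by rewrite (lt_le_trans ltr01)// Dsum_ge1.
  apply: le_trans (_ : 2 ^+ m.+2 * (cmod (g n i xi) / D n xi) ^+ 2 <= _).
    rewrite exprMn exprVn mulrCA ler_wpM2l ?sqr_ge0//.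
    rewrite ler_pdivlMr ?exprn_gt0// mulrC ler_pdivrMr ?Qsum_gt0//.
    exact: Dsum_le.
  rewrite ler_wpM2l ?exprn_ge0// [leRHS](bigD1 i)//= lerDl.
  by apply: sumr_ge0 => j _; rewrite sqr_ge0.
have := le_trans h1 h2; rewrite -lee_pdivlMl// => /le_trans; apply.
by rewrite EFinM muleA.
Qed.

Let T0 : C := 0 +i* (2 * pi).
Let kap n s := lam n * (eps n / omega n) ^+ (s - l).
Let wgt n (a : multiindex d m) (xi : E) : R := weight l a (omega n *: xi).

Let mwgt n a : measurable_fun [set: E] (wgt n a).
Proof.
have me : measurable_fun [set: E] (fun xi => enorm (omega n *: xi)).
  under eq_fun do rewrite (enormZ _ (ltW (omega0 n))).
  by apply: measurable_funM => //; exact: continuous_measurable_rV (@continuous_enorm R d).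
apply: measurable_funM; last first.
  by apply: measurable_invr; apply: measurable_funD; exact: measurable_funX.
under eq_fun do rewrite mpowZ.
apply: measurable_funM => //; apply: measurable_prod => j _; apply: measurable_funX.
exact: measurable_rV_coord.
Qed.

Let kap_bound n a : P a -> 0 <= kap n (mlen a) <= B.
Proof.
by move=> Pa; rewrite lamB// andbT mulr_ge0// exprn_ge0// divr_ge0// ltW.
Qed.

Let B0 : 0 <= B.
Proof. by have := @lamB 0%N l; rewrite leqnn hl => /(_ isT); apply: le_trans; rewrite subnn mulr1. Qed.

Let cT0 : cmod T0 = 2 * pi.
Proof. by rewrite cmodE /= expr0n /= add0r sqrtr_sqr ger0_norm// mulr_ge0// pi_ge0. Qed.

Let pi1 : 1 <= 2 * pi :> R.
Proof. have := pi_ge2 R; lra. Qed.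

Let cTpow s : (s <= m)%N -> cmod (T0 ^+ s) <= (2 * pi) ^+ m.
Proof. by move=> sm; rewrite cmodX cT0 ler_weXn2l. Qed.

Let term n a xi := T0 ^+ mlen a * (kap n (mlen a) * wgt n a xi)%:C.

Let mterm n a : cmeas (term n a).
Proof.
apply: cmeasM; first exact: cmeas_cst.
by apply: cmeas_real; apply: measurable_funM.
Qed.

Let term_bound n a xi : P a -> cmod (term n a xi) <= (2 * pi) ^+ m * B.
Proof.
move=> Pa; have /andP[la am] := Pa; rewrite /term cmodM cmod_real normrM.
have /andP[k0 kB] := kap_bound n Pa.
rewrite ler_pM ?cmod_ge0 ?mulr_ge0//; first exact: cTpow.
by rewrite (ger0_norm k0) -[leRHS]mulr1 ler_pM//; exact: weight_le1.
Qed.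

Let Pn n xi := \sum_(a | P a) term n a xi * Fou n [::] a xi.

Let eball rho : set E := [set xi : E | enorm xi <= rho].

(** A Leibniz term, normalised like the principal part and restricted to [|xi| > rho]. *)
Let lower rho n a p xi : C :=
  ((\1_(~` eball rho) xi) * (lam n / @den R d m l (omega n) xi))%:C *
  (coef n a * (-1) ^+ mlen a * mul_coords p.2 (Fou n p.1 a) xi).

Let mden n : measurable_fun [set: E] (@den R d m l (omega n)).
Proof.
have me := continuous_measurable_rV (@continuous_enorm R d).
apply: measurable_funD; first exact: measurable_funX.
by apply: measurable_funM => //; exact: measurable_funX.
Qed.

Let mmul_coords s zeta : cmeas zeta -> cmeas (@mul_coords R d s zeta).
Proof.
move=> mz; apply: cmeasM => //; apply: cmeas_prod => j _; split => //=.
  exact: measurable_cst.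
by apply: measurable_funN; apply: measurable_funM => //; exact: measurable_rV_coord.
Qed.

Let mballC rho : measurable (~` eball rho).
Proof. by apply: measurableC; exact: measurable_enorm_ball. Qed.

Let mpref rho n : cmeas (fun xi : E => ((\1_(~` eball rho) xi) * (lam n / @den R d m l (omega n)
  xi))%:C : C).
Proof.
apply: cmeas_real; apply: measurable_funM; first exact: measurable_indic (mballC rho).
by apply: measurable_funM => //; exact: measurable_invr.
Qed.

Let mlower rho n a p : P a -> cmeas (lower rho n a p).
Proof.
move=> Pa; apply: cmeasM; first exact: mpref.
apply: cmeasM; first exact: cmeas_cst.
by apply: mmul_coords; exact: mFou.
Qed.

(** At least one derivative has fallen on the cut-off, so one power of [|xi|] is missing: a gain of
    [1 / rho] off the ball. The condition [1 <= rho] makes the powers of [|xi|] increase with the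
    exponent there. *)
Let lower_bound rho n a p xi : 1 <= rho -> P a -> p \in lower_splits (mseq a) ->
  cmod (lower rho n a p xi) <= (2 * pi) ^+ m * B / rho * cmod (Fou n p.1 a xi).
Proof.
move=> rho1 Pa pl; have /andP[la am] := Pa.
have rho0 : 0 < rho by rewrite (lt_le_trans ltr01).
have B2 : 0 <= (2 * pi) ^+ m * B by rewrite mulr_ge0// exprn_ge0// mulr_ge0// pi_ge0.
have [xb|xb] := pselect (eball rho xi).
  rewrite /lower indicE memNset; last by move=> /(_ xb).
  by rewrite mul0r mul0r cmod0 mulr_ge0 ?cmod_ge0// divr_ge0// ltW.
have xr : rho < enorm xi by rewrite ltNge; apply/negP.
have x1 : 1 <= enorm xi by rewrite (le_trans rho1)// ltW.
have x0 : 0 < enorm xi by rewrite (lt_le_trans ltr01).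
have h2 := cmod_mul_coords_le p.2 (Fou n p.1 a) xi.
rewrite /lower; move: (mul_coords _ _ _) h2 => mc h2.
rewrite indicE mem_set// mul1r !cmodM cmod_real cmodX cmodN cmod1 expr1n mulr1.
rewrite cmod_real ger0_norm; last by rewrite divr_ge0// ltW// den_gt0.
rewrite ger0_norm ?exprn_ge0 ?(ltW (eps0 n))//.
have sp : (size p.2 < mlen a)%N by rewrite -size_mseq; exact: size_lower_splits.
have h1 := @lam_power_le R d m l hl (eps n) (omega n) (lam n) B (eps0 n) (omega0 n) (lam0 n)
  (lamB n) _ xi Pa.
have D0 := @den_gt0 R d m l (omega n) (omega0 n) xi x0.
apply: (@le_trans _ _ (lam n / @den R d m l (omega n) xi * (eps n ^+ (mlen a - l) *
    ((2 * pi) ^+ m * (enorm xi ^+ mlen a / rho) * cmod (Fou n p.1 a xi))))).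
  rewrite ler_wpM2l ?divr_ge0 ?(ltW D0)// ler_wpM2l ?exprn_ge0 ?(ltW (eps0 n))//.
  apply: le_trans h2 _; rewrite ler_wpM2r ?cmod_ge0// exprMn.
  rewrite ler_pM ?exprn_ge0 ?mulr_ge0 ?pi_ge0 ?(ltW x0)//.
    by rewrite ler_weXn2l// (leq_trans (ltnW sp)).
  rewrite ler_pdivlMr//.
  apply: (@le_trans _ _ (enorm xi ^+ size p.2 * enorm xi));
    first by rewrite ler_wpM2l ?exprn_ge0 ?(ltW x0)// ltW.
  by rewrite -exprSr ler_weXn2l.
have -> : lam n / @den R d m l (omega n) xi * (eps n ^+ (mlen a - l) *
    ((2 * pi) ^+ m * (enorm xi ^+ mlen a / rho) * cmod (Fou n p.1 a xi))) =
  (lam n * (eps n ^+ (mlen a - l) * enorm xi ^+ mlen a)) / @den R d m l (omega n) xi *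
    ((2 * pi) ^+ m / rho * cmod (Fou n p.1 a xi)) by ring.
have -> : (2 * pi) ^+ m * B / rho * cmod (Fou n p.1 a xi) =
    B * ((2 * pi) ^+ m / rho * cmod (Fou n p.1 a xi)) by ring.
rewrite ler_wpM2r//; last by rewrite ler_pdivrMr.
by rewrite mulr_ge0 ?cmod_ge0// divr_ge0 ?(ltW rho0)// exprn_ge0// mulr_ge0// pi_ge0.
Qed.

Let Pn_split rho n xi : 1 <= rho -> (\1_(~` eball rho) xi)%:C * Pn n xi =
  ((\1_(~` eball rho) xi) * (lam n / @den R d m l (omega n) xi))%:C * G n xi -
  \sum_(a | P a) \sum_(p <- lower_splits (mseq a)) lower rho n a p xi.
Proof.
move=> rho1; have [xb|xb] := pselect (eball rho xi).
  rewrite indicE memNset; last by move=> /(_ xb).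
  rewrite !mul0r sub0r big1 ?oppr0// => a _; rewrite big1// => p _.
  by rewrite /lower indicE memNset ?mul0r ?mul0r//; move=> /(_ xb).
have xr : rho < enorm xi by rewrite ltNge; apply/negP.
have x0 : 0 < enorm xi by rewrite (lt_trans _ xr)// (lt_le_trans ltr01).
apply/eqP; rewrite eq_sym subr_eq; apply/eqP.
rewrite addrC /G /pde_symbol /Pn !mulr_sumr -big_split /=; apply: eq_bigr => a Pa.
rewrite splitsE -cats1 big_cat big_seq1 /= 2!mulrDr; congr (_ + _).
  by rewrite !mulr_sumr; apply: eq_bigr => p _; rewrite /lower linE.
rewrite (_ : (fun x => phi x * wn n a x) = lin u (bet n [::] a) n); last exact: (linE n [::] a).
rewrite -/(Fou n [::] a) indicE mem_set// !mul1r.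
rewrite -[coef n a * _ * _]mulrA mul_coords_mseq /term /kap /wgt.
rewrite (@weight_scaled R d m l hl (eps n) (omega n) (lam n) (omega0 n) a xi x0 Pa).
by rewrite /coef /T0 !realcM; ring.
Qed.

Let mPn n : cmeas (Pn n).
Proof. by apply: cmeas_sum => a Pa; apply: cmeasM => //; exact: mFou. Qed.

(** For a fixed radius, the part in the ball vanishes by weak convergence, and the part outside is
    [lam / den] times [G], which vanishes by [G_null], minus the lower-order terms, bounded by [e]
    times a bounded sequence. *)
Let Pn_null : enull (fun n => sqn leb (Pn n)).
Proof.
pose N := size (index_enum (multiindex d m)).
pose c1 := ((2 * pi) ^+ m * B) ^+ 2.
have c1_ge0 : 0 <= c1 by exact: sqr_ge0.
pose S n := ((2 ^+ N)%:E * \sum_(a | P a) ((2 ^+ size (lower_splits (mseq a)))%:E *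
  \sum_(p <- lower_splits (mseq a)) (c1%:E * sqn leb (Fou n p.1 a))))%E.
have bS : ebounded S.
  apply: eboundedZ; first by rewrite exprn_ge0.
  apply: ebounded_sum => a Pa; apply: eboundedZ; first by rewrite exprn_ge0.
  by apply: ebounded_sum => p _; apply: eboundedZ => //; exact: Fou_bounded.
have bS4 : ebounded (fun n => 4%:E * S n)%E by exact: eboundedZ.
apply: (enull_approx bS4) => e e0.
(* The radius for which the squared gain [1 / rho^2] is at most [e]. *)
pose rho := Num.max 1 (Num.sqrt e^-1).
have rho1 : 1 <= rho by rewrite le_max lexx.
have rho0 : 0 < rho by rewrite (lt_le_trans ltr01).
have rhoe : (rho ^+ 2)^-1 <= e.
  rewrite -[e]invrK lef_pV2 ?posrE ?exprn_gt0 ?invr_gt0//.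
  rewrite -[leLHS](@sqr_sqrtr R) ?invr_ge0 ?(ltW e0)// lerXn2r ?nnegrE ?sqrtr_ge0 ?(ltW rho0)//.
  by rewrite le_max lexx orbT.
have mb : measurable (eball rho) by exact: measurable_enorm_ball.
pose Z1 n := ((2 ^+ N)%:E * \sum_(a | P a) (c1%:E * sqn leb (fun xi => (\1_(eball rho) xi)%:C *
  Fou n [::] a xi)%R))%E.
pose Z2 n := ((m.+2%:R * B ^+ 2)%:E * \int[leb]_xi (cmod (G n xi) ^+ 2 / Q n xi)%:E)%E.
exists (fun n => 2%:E * Z1 n + 4%:E * Z2 n)%E.
  apply: enullD; apply: enullZ => //; last first.
    by apply: enullZ G_null; rewrite mulr_ge0 ?sqr_ge0.
  apply: enullZ; first by rewrite exprn_ge0.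
  apply: enull_sum => a Pa; apply: enullZ => //.
  by apply: Fou_low => //; exact: lebesgue_enorm_ball_lty.
apply: nearW => n.
have m1 : cmeas (fun x : E => (\1_(eball rho) x)%:C : C) by apply: cmeas_real; exact: measurable_indic.
have m2 : cmeas (fun x : E => (\1_(~` eball rho) x)%:C : C) by apply: cmeas_real;
  exact: measurable_indic.
pose L xi := \sum_(a | P a) \sum_(p <- lower_splits (mseq a)) lower rho n a p xi.
have mL : cmeas L.
  by apply: cmeas_sum => a Pa; apply: cmeas_sum => p _; exact: mlower.
pose PG xi := ((\1_(~` eball rho) xi) * (lam n / @den R d m l (omega n) xi))%:C * G n xi.
have mG : cmeas (G n) by apply: ccont_cmeas; exact: (csm_cont (sG n 0)).
have mPG : cmeas PG by apply: cmeasM mG; exact: mpref.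
have s1 : (sqn leb (fun xi => (\1_(eball rho) xi)%:C * Pn n xi)%R <= Z1 n)%E.
  rewrite (_ : (fun xi => _) = fun xi => \sum_(a | P a) (term n a xi * ((\1_(eball rho) xi)%:C *
    Fou n [::] a xi))).
    have mt a : P a -> cmeas (fun xi => (\1_(eball rho) xi)%:C * Fou n [::] a xi).
      by move=> Pa; apply: cmeasM => //; exact: mFou.
    apply: le_trans (sqn_sum _ _ _) _ => [a Pa|]; first by apply: cmeasM => //; exact: mt.
    rewrite lee_wpmul2l// ?lee_fin ?exprn_ge0//; apply: lee_sum => a Pa.
    apply: le_sqn => //; [by apply: cmeasM => //; exact: mt|exact: mt|].
    move=> xi; rewrite cmodM exprMn ler_wpM2r ?sqr_ge0//.
    have tb := term_bound n xi Pa.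
    by rewrite /c1 lerXn2r ?nnegrE ?cmod_ge0// (le_trans _ tb)// cmod_ge0.
  by apply/funext => xi; rewrite mulr_sumr; apply: eq_bigr => a _; ring.
have s2 : (sqn leb PG <= Z2 n)%E.
  rewrite /Z2 -ge0_integralZl//; last 3 first.
  - by apply/measurable_EFinP; exact: measurable_GQ.
  - by move=> xi _; rewrite lee_fin mulr_ge0 ?sqr_ge0// invr_ge0 ltW// Qsum_gt0.
  - by rewrite lee_fin mulr_ge0 ?sqr_ge0.
  apply: ge0_le_integral => //.
  - by move=> xi _; rewrite lee_fin sqr_ge0.
  - by apply/measurable_EFinP; exact: measurable_cmod2.
  - by apply/measurable_EFinP; apply: measurable_funM => //; exact: measurable_GQ.
  move=> xi _; rewrite -EFinM lee_fin /PG cmodM cmod_real exprMn.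
  have q0 := @Qsum_gt0 R d m l (eps n) xi.
  have [xb|xb] := pselect (eball rho xi).
    rewrite indicE memNset; last by move=> /(_ xb).
    rewrite mul0r normr0 expr0n mul0r; apply: mulr_ge0; first by rewrite mulr_ge0 ?sqr_ge0.
    by apply: divr_ge0; [exact: sqr_ge0|exact: ltW].
  have xr : rho < enorm xi by rewrite ltNge; apply/negP.
  have x1 : 1 <= enorm xi by rewrite (le_trans rho1)// ltW.
  have D0 := @den_gt0 R d m l (omega n) (omega0 n) xi (lt_le_trans ltr01 x1).
  rewrite indicE mem_set// mul1r real_normK ?num_real//.
  rewrite (_ : m.+2%:R * B ^+ 2 * (cmod (G n xi) ^+ 2 / Q n xi) =
    m.+2%:R * B ^+ 2 / Q n xi * cmod (G n xi) ^+ 2); last by ring.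
  rewrite ler_wpM2r ?sqr_ge0//.
  rewrite ler_pdivlMr// exprMn exprVn mulrAC ler_pdivrMr ?exprn_gt0//.
  have := @lam_Qsum_le R d m l hl (eps n) (omega n) (lam n) B (eps0 n) (omega0 n) (lam0 n) (lamB
    n) xi x1.
  by rewrite exprMn mulrA.
have s3 : (sqn leb L <= e%:E * S n)%E.
  apply: le_trans (sqn_sum _ _ _) _ => [a Pa|].
    by apply: cmeas_sum => p _; exact: mlower.
  rewrite /S muleCA lee_wpmul2l ?lee_fin ?exprn_ge0// [leRHS]ge0_sume_distrr; last first.
    by move=> a _; rewrite mule_ge0 ?lee_fin ?exprn_ge0// sume_ge0// => p _;
      rewrite mule_ge0 ?lee_fin ?sqn_ge0.
  apply: lee_sum => a Pa.
  apply: le_trans (sqn_sum _ _ _) _ => [p _|]; first exact: mlower.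
  rewrite muleCA lee_wpmul2l ?lee_fin ?exprn_ge0// [leRHS]ge0_sume_distrr; last first.
    by move=> p _; rewrite mule_ge0 ?lee_fin ?sqn_ge0.
  rewrite [leLHS]big_seq_cond [leRHS]big_seq_cond; apply: lee_sum => p /andP[ps _].
  apply: le_trans (_ : _ <= (c1 / rho ^+ 2)%:E * sqn leb (Fou n p.1 a))%E _.
    apply: le_sqn; [by rewrite divr_ge0 ?sqr_ge0|exact: mlower|exact: mFou|].
    move=> xi; rewrite (_ : c1 / rho ^+ 2 = ((2 * pi) ^+ m * B / rho) ^+ 2);
      last by rewrite exprMn exprVn.
    rewrite -exprMn lerXn2r ?nnegrE ?cmod_ge0//; last exact: lower_bound.
    exact: le_trans (cmod_ge0 _) (lower_bound n xi rho1 Pa ps).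
  by rewrite muleA -EFinM lee_wpmul2r ?sqn_ge0// lee_fin mulrC ler_wpM2r.
have -> : Pn n = fun xi => (\1_(eball rho) xi)%:C * Pn n xi + (PG xi + (-1) * L xi).
  apply/funext => xi; rewrite mulN1r -/(PG xi - L xi) -Pn_split// -mulrDl -realcD.
  rewrite !indicE in_setC; case: (_ \in _); rewrite /= ?addr0 ?add0r mul1r//.
have mNL : cmeas (fun xi => -1 * L xi) by apply: cmeasM => //; exact: cmeas_cst.
have s4 : (sqn leb (fun xi => PG xi + -1 * L xi)%R <= 2 * Z2 n + 2 * (e%:E * S n))%E.
  apply: le_trans (sqnD _ mPG mNL) _; apply: leeD; first by rewrite lee_pmul2l.
  rewrite lee_pmul2l//; apply: le_trans s3; rewrite -[leRHS]mul1e; apply: le_sqn => //.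
  by move=> xi; rewrite cmodM cmodN cmod1 !mul1r.
apply: le_trans (sqnD _ _ _) _; [exact: cmeasM|exact: cmeasD|].
apply: le_trans (_ : _ <= 2 * Z1 n + 2 * (2 * Z2 n + 2 * (e%:E * S n)))%E _.
  by apply: leeD; rewrite lee_pmul2l.
have z0 : (0 <= Z2 n)%E by exact: le_trans (sqn_ge0 _ _) s2.
have S0 : (0 <= e%:E * S n)%E by exact: le_trans (sqn_ge0 _ _) s3.
rewrite -[leRHS]addeA; apply: leeD => //; move: (Z2 n) (S n) z0 S0 => z t z0 t0.
have h1 : (0 <= 2 * z)%E by rewrite mule_ge0.
have h2 : (0 <= 2 * (e%:E * t))%E by rewrite mule_ge0.
rewrite (ge0_muleDr _ h1 h2) muleCA !muleA -!EFinM.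
have -> : 2 * 2 = 4 :> R by rewrite -natrM.
by rewrite [4 * e]mulrC.
Qed.

Variable kapl : nat -> R.
Hypothesis kaplim : forall s, (l <= s <= m)%N ->
  (fun n => lam n * (eps n / omega n) ^+ (s - l)) @ \oo --> kapl s.

(** Two replacements: [X] exchanges [A_n] for its limit under bounded multipliers, and [Y] exchanges
    the factors [kap] for their limits, uniformly in [xi] because the weights are at most 1, in
    front of functions bounded in L2. *)
Theorem principal_part_null : enull (fun n => sqn leb (fun xi =>
  \sum_(a | P a) ((0 +i* (2 * pi)) ^+ mlen a * (kapl (mlen a) * weight l a (omega n *: xi))%:C) *
    fourier (lin u (fun k x => phi x * Alim a x i k) n) xi)).
Proof.
pose tl n a xi := T0 ^+ mlen a * (kapl (mlen a) * wgt n a xi)%:C.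
have mtl n a : cmeas (tl n a).
  by apply: cmeasM; [exact: cmeas_cst|apply: cmeas_real; apply: measurable_funM].
pose X n a xi := - term n a xi * (Fou n [::] a xi - Fl n a xi).
pose Y n a xi := (tl n a xi - term n a xi) * Fl n a xi.
have mX n a : P a -> cmeas (X n a).
  move=> Pa; apply: cmeasM; first exact: cmeasN (mterm n a).
  exact: cmeasB (mFou n [::] Pa) (mFl n Pa).
have mY n a : P a -> cmeas (Y n a).
  by move=> Pa; apply: cmeasM (mFl n Pa); exact: cmeasB (mtl n a) (mterm n a).
have X_null a : P a -> enull (fun n => sqn leb (X n a)).
  move=> Pa; apply: enull_le (enullZ (sqr_ge0 ((2 * pi) ^+ m * B)) (Fou_approx Pa)).
  apply: nearW => n; apply: le_sqn; [exact: sqr_ge0|exact: mX|exact: cmeasB (mFou n [::]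
    Pa) (mFl n Pa)|].
  move=> xi; have tb := term_bound n xi Pa.
  by rewrite /X cmodM cmodN exprMn ler_wpM2r ?sqr_ge0// lerXn2r ?nnegrE ?cmod_ge0//
    (le_trans _ tb)// cmod_ge0.
have Fl_bounded a : P a -> ebounded (fun n => sqn leb (Fl n a)).
  move=> Pa; apply: (sqn_fourier_lin_bounded cK KO hu Kc (fun n k => @cbetl [::] a k Pa)
    (fun k => @cbetl [::] a k Pa) (fun n => @betl0 [::] a) (@betl0 [::] a)).
  by move=> e e0; apply: nearW => n k x; rewrite subrr cmod0 ltW.
have Y_null a : P a -> enull (fun n => sqn leb (Y n a)).
  move=> Pa; have /andP[la am] := Pa.
  pose del n := (kapl (mlen a) - kap n (mlen a)) * (kapl (mlen a) - kap n (mlen a)).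
  have del0 : del @ \oo --> (0 : R).
    have h : (fun n => kapl (mlen a) - kap n (mlen a)) @ \oo --> (0 : R).
      by rewrite -[X in _ --> X](subrr (kapl (mlen a))); exact: cvgB (cvg_cst _) (kaplim Pa).
    by rewrite -[X in _ --> X](mulr0 0); exact: (cvgM h h).
  have del_ge0 n : 0 <= del n by rewrite /del -expr2 sqr_ge0.
  have pm : 0 <= ((2 * pi) ^+ m) ^+ 2 :> R by exact: sqr_ge0.
  apply: enull_le (enullZ pm (enullM del_ge0 del0 (Fl_bounded a Pa))).
  apply: nearW => n; rewrite muleA -EFinM.
  apply: le_sqn; [by rewrite mulr_ge0|exact: mY|exact: mFl|].
  move=> xi; rewrite /Y cmodM exprMn ler_wpM2r ?sqr_ge0//.
  rewrite /tl /term -mulrBr -raddfB /= cmodM cmod_real -mulrBl exprMn.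
  rewrite ler_pM ?sqr_ge0//.
    by have tb := cTpow am; rewrite lerXn2r ?nnegrE ?cmod_ge0// (le_trans _ tb)// cmod_ge0.
  rewrite real_normK ?num_real// exprMn -[del n]mulr1 /del -expr2 ler_pM ?sqr_ge0//.
  rewrite -[wgt n a xi ^+ 2]real_normK ?num_real// -[leRHS](expr1n _ 2).
  by rewrite lerXn2r ?nnegrE//; exact: weight_le1.
apply: enull_le (enullD (enullZ (ler0n _ 2) Pn_null)
  (enullZ (ler0n _ 2) (enullZ (exprn_ge0 (size (index_enum (multiindex d m))) (ler0n R 2))
  (enull_sum (index_enum (multiindex d m)) (fun a Pa => enullD (enullZ (ler0n _ 2) (X_null a Pa))
     (enullZ (ler0n _ 2) (Y_null a Pa))))))).
apply: nearW => n.
rewrite (_ : (fun xi => _) = fun xi => Pn n xi + \sum_(a | P a) (X n a xi + Y n a xi)); last first.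
  apply/funext => xi; rewrite /Pn -big_split /=; apply: eq_bigr => a Pa.
  rewrite -/(Fl n a) -/T0 -/(wgt n a xi) /X /Y -/(tl n a xi); ring.
have mXY a : P a -> cmeas (fun xi => X n a xi + Y n a xi).
  by move=> Pa; exact: cmeasD (mX n a Pa) (mY n a Pa).
apply: le_trans (sqnD _ (mPn n) _) _; first by apply: cmeas_sum => a Pa; exact: mXY.
rewrite leeD2l// lee_pmul2l//; apply: le_trans (sqn_sum _ _ mXY) _.
rewrite lee_wpmul2l ?lee_fin ?exprn_ge0//; apply: lee_sum => a Pa.
exact: sqnD (mX n a Pa) (mY n a Pa).
Qed.

End principal_part.

(** * The compactification and the weights *)

Section K0oo_topology.
Context {R : realType} {d : nat}.
Local Notation E := 'rV[R]_d.
Local Notation C := R[i].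
Local Notation KT := (E * \bar R)%type.

(** The balls of [\bar R] are defined through [contract]. *)
Lemma continuous_contract : continuous (@contract R : \bar R -> R).
Proof.
move=> x; apply/cvgrPdist_lt => e e0.
exact: (@nbhsx_ballx _ (\bar R) x e e0).
Qed.

Lemma contract_unit (x : \bar R) : (0 <= x)%E -> 0 <= contract x <= 1.
Proof.
move=> x0; have := @contract_le1 R x; rewrite ler_norml => /andP[_ ->]; rewrite andbT.
by rewrite -(@contract0 R) le_contract.
Qed.

Lemma contract_fin (r : R) : 0 <= r -> contract r%:E = r / (1 + r).
Proof. by move=> r0; rewrite /contract ger0_norm. Qed.

(** The image of the sphere times [[0, 1]] under [expand] in the radial variable. *)
Lemma compact_K0oo : compact (@K0oo R d).
Proof.
have cS : compact [set x : E | enorm x = 1].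
  apply: (@subclosed_compact _ _ (cube 1)); last first.
  - by move=> x /= x1 i; rewrite -x1 coord_le_enorm.
  - exact: compact_cube.
  rewrite (_ : [set _ | _] = (@enorm R d) @^-1` [set 1])//.
  by apply: closed_comp; [move=> ? _; exact: continuous_enorm|exact: closed_eq].
have cI : compact `[0, 1 : R]%classic by exact: segment_compact.
rewrite (_ : @K0oo R d = (fun p : E * R => (p.1, expand p.2)) @` ([set x : E | enorm x = 1]
  `*` `[0, 1]%classic)).
  apply: continuous_compact; last exact: compact_setX.
  apply/subspace_continuousP => -[x t] [/= _]; rewrite in_itv /= => /andP[t0 t1].
  set F := within _ _.
  have h1 : (fun p : E * R => p.1) @ F --> x by apply: cvg_within_filter; exact: cvg_fst.
  have h2 : (fun p : E * R => expand p.2) @ F --> expand t.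
    apply/(@cvg_ballP _ (\bar R)) => e e0.
    have t1n : `|t| <= 1 by rewrite ger0_norm.
    have : \forall z \near F, (`|z.2| <= 1) /\ `|t - z.2| < e.
      apply: filterI.
        rewrite /F /within /=; apply: nearW => z [_ /=]; rewrite in_itv /= => /andP[z0 z1].
        by rewrite ger0_norm.
      apply: cvg_within; have : (fun z : E * R => z.2) @ nbhs (x, t) --> t by exact: cvg_snd.
      by move/cvgrPdist_lt; apply.
    apply: filterS => z [z1 tz].
    by rewrite /ball /= /ereal_ball !expandK ?inE.
  exact: cvg_pair h1 h2.
apply/seteqP; split=> [[x t] [/= x1 t0]|_ [[x t] [/= x1 +] <-]].
  exists (x, contract t); last by rewrite /= contractK.
  by split=> //=; rewrite in_itv /=; exact: contract_unit.
rewrite in_itv /= => /andP[t0 t1]; split=> //=.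
by rewrite -(@expand0 R) le_expand.
Qed.

(** Makes the filter in [extend_K0oo] proper, so that its limit is determined. *)
Lemma K0oo_finite_dense (k : KT) : K0oo k -> forall U, nbhs k U -> exists2 z, U z & K0oo_finite z.
Proof.
case: k => e x [/= e1 x0] U /nbhs_ballP[t /= t0 hU].
have /andP[c0 c1] := contract_unit x0.
pose s := Num.min (t / 2) (2^-1).
have s0 : 0 < s by rewrite lt_min divr_gt0//= invr_gt0.
have st : s < t by rewrite gt_min ltr_pdivrMr// ltr_pMr// ltr1n.
have s1 : s <= 2^-1 by rewrite ge_min lexx orbT.
(* Moves [contract x] slightly towards 1/2, into the open interval []0, 1[]; [c' / (1 - c')] is the
   point at which [contract] takes the value [c']. *)
pose c' := contract x + s * (2^-1 - contract x).
have h0 : 0 < c'.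
  have := mulr_ge0 (ltW s0) c0; have : s * contract x <= 2^-1 * contract x by rewrite ler_wpM2r.
  rewrite /c'; lra.
have h1 : c' < 1.
  have : s * contract x <= 2^-1 * contract x by rewrite ler_wpM2r.
  have : 2^-1 * contract x <= 2^-1 by rewrite ler_piMr.
  have : (1 - contract x) * s <= (1 - contract x) * 2^-1 by rewrite ler_wpM2l// subr_ge0.
  rewrite /c'; nra.
have h2 : `|contract x - c'| < t.
  rewrite /c' opprD addNKr normrN normrM (gtr0_norm s0).
  apply: le_lt_trans st; rewrite ler_piMr ?(ltW s0)// ler_norml; apply/andP; split; lra.
exists (e, (c' / (1 - c'))%:E).
  apply: hU; split => /=; first exact: ballxx.
  rewrite /ball /= /ereal_ball contract_fin ?divr_ge0 ?subr_ge0 ?(ltW h0) ?(ltW h1)//.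
  rewrite (_ : c' / (1 - c') / (1 + c' / (1 - c')) = c')//.
  by field; rewrite subr_eq0 gt_eqF//=; lra.
split=> //=; rewrite lte_fin ltry andbT divr_gt0// subr_gt0//.
Qed.

Lemma K0oo_finite_sub (k : KT) : K0oo_finite k -> K0oo k.
Proof. by move=> [h /andP[k0 _]]; split=> //; exact: ltW. Qed.

Lemma to_K0oo_finite (xi : E) : 0 < enorm xi -> K0oo_finite (to_K0oo xi).
Proof.
move=> x0; split => /=; last by rewrite lte_fin x0 ltry.
by rewrite enormZ ?invr_ge0 ?enorm_ge0// mulVf// gt_eqF.
Qed.

Lemma to_K0ooK (xi : E) : 0 < enorm xi -> of_K0oo (to_K0oo xi) = xi.
Proof. by move=> x0; rewrite /of_K0oo /to_K0oo /= scalerA mulfV ?scale1r// gt_eqF. Qed.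

Lemma extend_K0ooE (h : E -> R) (g : KT -> R) : {within @K0oo R d, continuous g} ->
  (forall k, K0oo_finite k -> h (of_K0oo k) = g k) ->
  forall k, K0oo k -> extend_K0oo h k = g k.
Proof.
move=> /subspace_continuousP cg hg k Kk; rewrite /extend_K0oo.
have PF : ProperFilter (within (@K0oo_finite R d) (nbhs k)).
  apply: Build_ProperFilter_ex => P; rewrite /within /= => hP.
  by have [z zU zK] := K0oo_finite_dense Kk hP; exists z; exact: zU.
apply: cvg_lim => //.
apply: (@cvg_trans _ (g @ within (@K0oo_finite R d) (nbhs k))).
  move=> P hP; apply: (@filterS _ (nbhs k) _ (fun z => K0oo_finite z -> P (g z))); last exact: hP.
  by move=> z hz zK /=; rewrite hg//; exact: hz.
apply: cvg_trans (cg k Kk); apply: cvg_app => P hP.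
apply: (@filterS _ (nbhs k) _ (fun z => K0oo z -> P z)); last exact: hP.
by move=> z h1 /K0oo_finite_sub; exact: h1.
Qed.

Lemma continuous_to_K0oo (xi : E) : 0 < enorm xi -> to_K0oo x @[x --> xi] --> to_K0oo xi.
Proof.
move=> x0.
have h1 : (fun x : E => (enorm x)^-1 *: x) @ nbhs xi --> (enorm xi)^-1 *: xi.
  apply: cvgZ; last exact: cvg_id.
  apply: cvgV; first by rewrite gt_eqF.
  exact: continuous_enorm.
have h2 : (fun x : E => (enorm x)%:E) @ nbhs xi --> (enorm xi)%:E.
  by apply: cvg_EFin; [exact: nearW|exact: continuous_enorm].
exact: cvg_pair h1 h2.
Qed.

Lemma continuous_comp_to_K0oo (psi : KT -> C) (w : R) (xi : E) : 0 < w -> C_K0oo psi ->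
  0 < enorm xi -> (fun x => psi (to_K0oo (w *: x)) : C^o) @ nbhs xi --> (psi (to_K0oo (w *: xi)) : C^o).
Proof.
move=> w0 /subspace_continuousP cp x0.
have wx : 0 < enorm (w *: xi) by rewrite enormZ ?(ltW w0)// mulr_gt0.
have Kx : K0oo (to_K0oo (w *: xi)) by apply: K0oo_finite_sub; exact: to_K0oo_finite.
apply: cvg_trans (cp _ Kx).
have c1 : (fun x => w *: x) @ nbhs xi --> w *: xi by exact: scaler_continuous.
have c2 : (fun x => to_K0oo (w *: x)) @ nbhs xi --> to_K0oo (w *: xi).
  exact: (cvg_comp _ _ c1 (continuous_to_K0oo wx)).
have nx : \forall x \near xi, 0 < enorm (w *: x).
  have : (fun x => enorm (w *: x)) @ nbhs xi --> enorm (w *: xi).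
    exact: (cvg_comp _ _ c1 (@continuous_enorm R d _)).
  by move/cvgr_gt; apply.
move=> P hP; have {}hP := c2 _ hP; move: nx hP; rewrite !near_simpl /=.
apply: filterS2 => x hx; apply; apply: K0oo_finite_sub; exact: to_K0oo_finite.
Qed.

Lemma bounded_C_K0oo (psi : KT -> C) : C_K0oo psi ->
  exists2 M : R, 0 <= M & forall k, K0oo k -> cmod (psi k) <= M.
Proof.
move=> cp; have : compact ((fun k => cmod (psi k)) @` (@K0oo R d)).
  apply: continuous_compact; last exact: compact_K0oo.
  by apply: cont_cmod.
move=> /compact_bounded[M [_ hM]]; exists (`|M| + 1); first by rewrite addr_ge0.
move=> k Kk; rewrite (le_trans (ler_norm _))//; apply: hM; last by exists k.
by rewrite (le_lt_trans (ler_norm M))// ltrDl.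
Qed.

End K0oo_topology.

Section weight_extension.
Context {R : realType} {d m : nat}.
Local Notation E := 'rV[R]_d.
Local Notation KT := (E * \bar R)%type.
Variables (l : nat) (hl : (l <= m)%N).

(* [t^(s-l) / (1 + t^(m-l))] in the coordinate [c = t / (1 + t)] of [[0, oo]]. *)
Definition radial (s : nat) (c : R) : R :=
  c ^+ (s - l) * (1 - c) ^+ (m - s) / ((1 - c) ^+ (m - l) + c ^+ (m - l)).

Definition weight_ext (a : multiindex d m) (k : KT) : R :=
  mpow a k.1 * radial (mlen a) (contract k.2).

Let radial_den_gt0 (c : R) : 0 <= c <= 1 -> 0 < (1 - c) ^+ (m - l) + c ^+ (m - l).
Proof.
move=> /andP[c0 c1]; have [->|cn] := eqVneq c 0.
  by rewrite subr0 expr1n ltr_pwDl// exprn_ge0.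
by rewrite ltr_wpDl ?exprn_ge0 ?subr_ge0// exprn_gt0// lt0r cn.
Qed.

Lemma weight_ext_finite (a : multiindex d m) k : (l <= mlen a <= m)%N -> K0oo_finite k ->
  weight l a (of_K0oo k) = weight_ext a k.
Proof.
case: k => e x /andP[la am] [/= e1 /andP[]]; case: x => [t| |]//; rewrite lte_fin => t0 _.
rewrite /weight /of_K0oo /weight_ext /= mpowZ enormZ ?(ltW t0)// e1 mulr1.
rewrite (gtr0_norm t0) /radial.
have t1 : 1 + t != 0 by rewrite gt_eqF// addr_gt0.
have -> : 1 - t / (1 + t) = (1 + t)^-1 by field.
have tl : t ^+ l != 0 by rewrite expf_neq0// gt_eqF.
have T1 : (1 + t) ^+ (m - l) != 0 by rewrite expf_neq0.
have -> : t ^+ mlen a = t ^+ l * t ^+ (mlen a - l) by rewrite -exprD subnKC.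
have -> : t ^+ m = t ^+ l * t ^+ (m - l) by rewrite -exprD subnKC.
have -> : (t / (1 + t)) ^+ (mlen a - l) * (1 + t)^-1 ^+ (m - mlen a) =
    t ^+ (mlen a - l) / (1 + t) ^+ (m - l).
  by rewrite exprMn -mulrA !exprVn -invfM -exprD addnC addnBA// subnK.
rewrite exprMn !exprVn.
have d1 : 1 + t ^+ (m - l) != 0 by rewrite gt_eqF// ltr_pwDl// exprn_ge0// ltW.
move: d1 tl T1; move: (t ^+ l) (t ^+ (mlen a - l)) (t ^+ (m - l)) ((1 + t) ^+ (m - l)) => p q z w
  d1 tl T1.
rewrite (_ : p + p * z = p * (1 + z)); last by ring.
rewrite (_ : w^-1 + z / w = (1 + z) / w); last by field.
by field; rewrite d1 tl T1.
Qed.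

Lemma continuous_mpow (a : multiindex d m) : continuous (@mpow R d m a).
Proof.
rewrite /mpow; elim: (index_enum _) => [|i s ih].
  by under eq_fun do rewrite big_nil; exact: cont_cst.
under eq_fun do rewrite big_cons.
by apply: contM => //; apply: contX; exact: coord_continuous.
Qed.

Lemma continuous_weight_ext (a : multiindex d m) : {within @K0oo R d, continuous (weight_ext a)}.
Proof.
apply/subspace_continuousP => -[e x] [/= e1 x0].
have c1 : (fun k : KT => mpow a k.1) @ nbhs (e, x) --> mpow a e.
  apply: (cvg_comp (fun k : KT => k.1) (@mpow R d m a)); first exact: cvg_fst.
  exact: continuous_mpow.
have c2 : (fun k : KT => radial (mlen a) (contract k.2)) @ nbhs (e, x) --> radial (mlen a) (contract x).
  apply: (cvg_comp (fun k : KT => contract k.2) (radial (mlen a)) (G := nbhs (contract x))).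
    apply: (cvg_comp (fun k : KT => k.2) (@contract R)); first exact: cvg_snd.
    exact: continuous_contract.
  have ci : continuous (fun c : R => c) by move=> ?; exact: cvg_id.
  have cn : continuous (fun c : R => 1 - c).
    by move=> c; apply: cvgB; [exact: cvg_cst|exact: cvg_id].
  have hn : continuous (fun c : R => c ^+ (mlen a - l) * (1 - c) ^+ (m - mlen a)).
    by apply: contM; exact: contX.
  have hd : continuous (fun c : R => (1 - c) ^+ (m - l) + c ^+ (m - l)).
    by apply: contD; exact: contX.
  apply: cvgM; first exact: hn.
  by apply: cvgV; [rewrite gt_eqF// radial_den_gt0// contract_unit|exact: hd].
by apply: cvg_within_filter; exact: cvgM c1 c2.
Qed.

Lemma extend_weight (a : multiindex d m) k : (l <= mlen a <= m)%N -> K0oo k ->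
  extend_K0oo (weight l a) k = weight_ext a k.
Proof.
move=> Pa; apply: extend_K0ooE; first exact: continuous_weight_ext.
by move=> z zK; exact: weight_ext_finite.
Qed.

End weight_extension.

(** * The localisation identity on tensor products *)

Section radon_functionals.
Context {R : realType} {T : topologicalType}.
Local Notation C := R[i].
Implicit Types (S L : set T) (Phi : T -> C) (nu : (T -> C) -> C).

Lemma within_ccontD S Phi1 Phi2 : {within S, continuous (Phi1 : T -> C^o)} ->
  {within S, continuous (Phi2 : T -> C^o)} ->
  {within S, continuous ((fun z => Phi1 z + Phi2 z) : T -> C^o)}.
Proof.
move=> /subspace_continuousP h1 /subspace_continuousP h2; apply/subspace_continuousP => x Sx.
exact: ccvgD (h1 x Sx) (h2 x Sx).
Qed.

Lemma within_ccontM S Phi1 Phi2 : {within S, continuous (Phi1 : T -> C^o)} ->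
  {within S, continuous (Phi2 : T -> C^o)} ->
  {within S, continuous ((fun z => Phi1 z * Phi2 z) : T -> C^o)}.
Proof.
move=> /subspace_continuousP h1 /subspace_continuousP h2; apply/subspace_continuousP => x Sx.
exact: ccvgM (h1 x Sx) (h2 x Sx).
Qed.

Lemma within_ccont_cst S (c : C) : {within S, continuous ((fun=> c) : T -> C^o)}.
Proof. by apply/subspace_continuousP => x Sx; exact: ccvg_cst. Qed.

Lemma within_ccont_real S (g : T -> R) : {within S, continuous g} ->
  {within S, continuous ((fun z => (g z)%:C) : T -> C^o)}.
Proof.
move=> /subspace_continuousP h; apply/subspace_continuousP => x Sx.
by apply/ccvgP; split => /=; [exact: h|exact: cvg_cst].
Qed.

Lemma within_ccont_eq S Phi1 Phi2 : (forall z, S z -> Phi1 z = Phi2 z) ->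
  {within S, continuous (Phi1 : T -> C^o)} -> {within S, continuous (Phi2 : T -> C^o)}.
Proof.
move=> e12 /subspace_continuousP h; apply/subspace_continuousP => x Sx.
have h1 := h x Sx; change (Phi2 @ within S (nbhs x) --> (Phi2 x : C^o)); rewrite -(e12 x Sx).
apply: cvg_trans h1 => P hP.
apply: (@filterS _ (nbhs x) _ (fun z => S z -> P (Phi1 z))); last exact: hP.
by move=> z hz Sz /=; rewrite -e12//; exact: hz.
Qed.

Lemma within_ccont_sum S I (s : seq I) (P : pred I) (Phi : I -> T -> C) :
  (forall i, P i -> {within S, continuous (Phi i : T -> C^o)}) ->
  {within S, continuous ((fun z => \sum_(i <- s | P i) Phi i z) : T -> C^o)}.
Proof.
move=> h; elim: s => [|i s ih].
  rewrite (_ : (fun z => _) = fun=> 0); first exact: within_ccont_cst.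
  by apply/funext => z; rewrite big_nil.
case Pi: (P i).
  rewrite (_ : (fun z => _) = fun z => Phi i z + \sum_(j <- s | P j) Phi j z).
    exact: within_ccontD (h i Pi) ih.
  by apply/funext => z; rewrite big_cons Pi.
rewrite (_ : (fun z => _) = fun z => \sum_(j <- s | P j) Phi j z); first exact: ih.
by apply/funext => z; rewrite big_cons Pi.
Qed.

Lemma Cc_on_eq S Phi1 Phi2 : (forall z, S z -> Phi1 z = Phi2 z) -> Cc_on S Phi1 -> Cc_on S Phi2.
Proof.
move=> e12 [c1 [L [cL LS s1]]]; split; first exact: within_ccont_eq e12 c1.
by exists L; split=> // z Sz nL; rewrite -e12// s1.
Qed.

Lemma Cc_on_mul S g Phi : {within S, continuous (g : T -> C^o)} -> Cc_on S Phi ->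
  Cc_on S (fun z => g z * Phi z).
Proof.
move=> cg [c1 [L [cL LS s1]]]; split; first exact: within_ccontM.
by exists L; split=> // z Sz nL; rewrite s1// mulr0.
Qed.

Lemma Cc_on0 S : Cc_on S (fun=> 0 : C).
Proof. by split; [exact: within_ccont_cst|exists set0; split=> //; exact: compact0]. Qed.

Lemma Cc_onD S Phi1 Phi2 : Cc_on S Phi1 -> Cc_on S Phi2 -> Cc_on S (fun z => Phi1 z + Phi2 z).
Proof.
move=> [c1 [L1 [cL1 LS1 s1]]] [c2 [L2 [cL2 LS2 s2]]]; split; first exact: within_ccontD.
exists (L1 `|` L2); split; first exact: compactU.
  by rewrite subUset.
by move=> z Sz nL; rewrite s1 ?s2 ?addr0// => h; apply: nL; [right|left].
Qed.

Lemma Cc_onB S Phi1 Phi2 : Cc_on S Phi1 -> Cc_on S Phi2 ->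
  Cc_on S (fun z => -1 * Phi1 z + Phi2 z).
Proof.
move=> c1 c2; apply: Cc_onD c2; apply: Cc_on_mul c1; exact: within_ccont_cst.
Qed.

Lemma Cc_on_sum S I (s : seq I) (P : pred I) (Phi : I -> T -> C) :
  (forall i, P i -> Cc_on S (Phi i)) -> Cc_on S (fun z => \sum_(i <- s | P i) Phi i z).
Proof.
move=> h; elim: s => [|i s ih].
  by apply: Cc_on_eq (Cc_on0 S) => z _; rewrite big_nil.
case Pi: (P i).
  by apply: Cc_on_eq (Cc_onD (h i Pi) ih) => z _; rewrite big_cons Pi.
by apply: Cc_on_eq ih => z _; rewrite big_cons Pi.
Qed.

Section linearity.
Variables (S : set T) (nu : (T -> C) -> C).
Hypothesis hnu : radon S nu.

(** Such a function is supported in the empty compact set, where the continuity bound holds with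
    [B = 0]. This is how values off [S] are discarded. *)
Lemma radon_eq0 Phi : Cc_on S Phi -> (forall z, S z -> Phi z = 0) -> nu Phi = 0.
Proof.
move=> cP P0; have [_ /(_ set0 (@compact0 T) (@sub0set _ S))[M hM]] := hnu.
apply: cmod_eq0; apply/le_anti; rewrite cmod_ge0 andbT.
rewrite -(mulr0 M); apply: hM => //.
by move=> z Sz _; exact: P0.
Qed.

Lemma radonB Phi1 Phi2 : Cc_on S Phi1 -> Cc_on S Phi2 ->
  nu (fun z => -1 * Phi1 z + Phi2 z) = - nu Phi1 + nu Phi2.
Proof. by move=> c1 c2; have [h _] := hnu; rewrite h// mulN1r. Qed.

Lemma radon_eq Phi1 Phi2 : Cc_on S Phi1 -> Cc_on S Phi2 -> (forall z, S z -> Phi1 z = Phi2 z) ->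
  nu Phi1 = nu Phi2.
Proof.
move=> c1 c2 e12; apply/esym/eqP; rewrite -subr_eq0 addrC -radonB//; apply/eqP.
apply: radon_eq0; last by move=> z Sz; rewrite e12// mulN1r addNr.
by apply: Cc_onD => //; apply: Cc_on_mul => //; exact: within_ccont_cst.
Qed.

Lemma radon_sum I (s : seq I) (P : pred I) (c : I -> C) (Phi : I -> T -> C) :
  (forall i, P i -> Cc_on S (Phi i)) ->
  nu (fun z => \sum_(i <- s | P i) c i * Phi i z) = \sum_(i <- s | P i) c i * nu (Phi i).
Proof.
move=> h; have cs s' : Cc_on S (fun z => \sum_(i <- s' | P i) c i * Phi i z).
  by apply: Cc_on_sum => i Pi; apply: Cc_on_mul; [exact: within_ccont_cst|exact: h].
elim: s => [|i s ih].
  by rewrite big_nil; apply: radon_eq0 => // z _; rewrite big_nil.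
rewrite big_cons; case Pi: (P i).
  have [lin _] := hnu; rewrite -ih -lin//; last exact: h.
  by congr nu; apply/funext => z; rewrite big_cons Pi.
by rewrite -ih; congr nu; apply/funext => z; rewrite big_cons Pi.
Qed.

End linearity.

End radon_functionals.

Section product_space.
Context {R : realType} {d : nat}.
Local Notation E := 'rV[R]_d.
Local Notation C := R[i].
Local Notation KT := (E * \bar R)%type.
Implicit Types (Omega : set E).

Lemma within_fst Omega (phi : E -> C) : {within Omega, continuous (phi : E -> C^o)} ->
  {within Omega `*` @K0oo R d, continuous ((fun z => phi z.1) : E * KT -> C^o)}.
Proof.
move=> /subspace_continuousP h; apply/subspace_continuousP => -[x k] [/= Ox Kk].
apply: cvg_trans (h x Ox) => P hP.
have h1 : (fun z : E * KT => z.1) @ nbhs (x, k) --> x by exact: cvg_fst.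
have := h1 _ hP; apply: (@filterS _ (nbhs (x, k))) => z /= h2 [Oz _]; exact: h2.
Qed.

Lemma within_snd Omega (psi : KT -> C) : C_K0oo psi ->
  {within Omega `*` @K0oo R d, continuous ((fun z => psi z.2) : E * KT -> C^o)}.
Proof.
move=> /subspace_continuousP h; apply/subspace_continuousP => -[x k] [/= Ox Kk].
apply: cvg_trans (h k Kk) => P hP.
have h1 : (fun z : E * KT => z.2) @ nbhs (x, k) --> k by exact: cvg_snd.
have := h1 _ hP; apply: (@filterS _ (nbhs (x, k))) => z /= h2 [_ Kz]; exact: h2.
Qed.

Lemma Cc_on_tensor Omega (K : set E) (phi : E -> C) (g : E * KT -> C) : compact K -> K `<=` Omega ->
  continuous (phi : E -> C^o) -> (forall x, ~ K x -> phi x = 0) ->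
  {within Omega `*` @K0oo R d, continuous (g : E * KT -> C^o)} ->
  Cc_on (Omega `*` @K0oo R d) (fun z => phi z.1 * g z).
Proof.
move=> cK KO cp p0 cg; split.
  exact: (within_ccontM (within_fst (continuous_subspaceT cp)) cg).
exists (K `*` @K0oo R d); split.
- exact: compact_setX cK compact_K0oo.
- by move=> z [/KO].
- by move=> z [_ Kz] nL; rewrite p0 ?mul0r// => Kz1; apply: nL.
Qed.

End product_space.

Section measurable_off_zero.
Context {R : realType} {d : nat}.
Local Notation E := 'rV[R]_d.

(** For the multipliers [psi (to_K0oo (omega n *: xi))], continuous off the origin only. *)
Lemma measurable_open_support (U : set E) (f : E -> R) : open U ->
  (forall x, U x -> {for x, continuous f}) -> (forall x, ~ U x -> f x = 0) ->
  measurable_fun [set: E] f.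
Proof.
move=> oU cf f0; have mU := open_measurable_rV oU.
rewrite -(setvU U); apply/measurable_funU => //; first exact: measurableC.
split; last first.
  apply: (measurability _ (RGenOpens.measurableE R)) => _ [_ [a [b ->] <-]].
  apply: open_measurable_rV; rewrite openE => x [Ux fx].
  apply: filterI; first exact: open_nbhs_nbhs.
  by apply: (cf x Ux); apply: open_nbhs_nbhs; split=> //; exact: interval_open.
move=> _ Y mY; have [Y0|Y0] := pselect (Y 0).
  rewrite (_ : _ `&` _ = ~` U); first exact: measurableC.
  by apply/seteqP; split=> [x []//|x nU]; split=> //=; rewrite f0.
rewrite (_ : _ `&` _ = set0); first exact: measurable0.
by apply/seteqP; split=> // x [nU /=]; rewrite f0.
Qed.

Lemma cmeas_open_support (U : set E) (f : E -> R[i]) : open U ->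
  (forall x, U x -> (f : E -> R[i]^o) @ nbhs x --> (f x : R[i]^o)) -> (forall x, ~ U x -> f x = 0) ->
  cmeas f.
Proof.
move=> oU cf f0; split; apply: (measurable_open_support oU).
- by move=> x /cf /(@ccvgP R E (nbhs x) _)[].
- by move=> x /f0 /= ->.
- by move=> x /cf /(@ccvgP R E (nbhs x) _)[].
- by move=> x /f0 /= ->.
Qed.

End measurable_off_zero.

Section one_component.
Context {R : realType} {d r : nat}.
Local Notation E := 'rV[R]_d.
Local Notation C := R[i].
Local Notation leb := (lebesgue_rV R d).
Variables (Omega K : set E) (c0 : E) (u : nat -> E -> 'cV[C]_r).
Hypotheses (cK : compact K) (KO : K `<=` Omega) (hu : weakly_null_L2loc Omega u)
  (Kc : K `<=` unit_cube c0).
Variables (beta : E -> C) (k : 'I_r).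
Hypotheses (cb : continuous (beta : E -> C^o)) (b0 : forall x, ~ K x -> beta x = 0).

Let single j : E -> C := if j == k then beta else fun=> 0.

Let csingle j : continuous (single j : E -> C^o).
Proof. by rewrite /single; case: (j == k); [exact: cb|exact: ccont_cst]. Qed.

Let single0 j x : ~ K x -> single j x = 0.
Proof. by rewrite /single; case: (j == k) => // /b0. Qed.

Let linE n : (fun x => beta x * u n x k ord0) = lin u single n.
Proof.
apply/funext => x; rewrite /lin (bigD1 k)//= big1 => [|j /negbTE jk].
  by rewrite /single eqxx addr0.
by rewrite /single jk mul0r.
Qed.

Lemma cinteg_component n : cinteg leb (fun x => beta x * u n x k ord0).
Proof. by rewrite linE; exact: (cinteg_linc cK KO hu n csingle single0). Qed.

Lemma cmeas_fourier_component n : cmeas (fourier (fun x => beta x * u n x k ord0)).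
Proof. by apply: cmeas_fourier; have /cintegP[] := cinteg_component n. Qed.

Lemma sqn_fourier_component : exists M : R, forall n,
  (sqn leb (fourier (fun x => (beta x * u n x k ord0)%R)) <= M%:E)%E.
Proof.
have [N N0 hN] := sqn_lin_le cK KO hu.
have [c c_ge0 hc] := cmod_compact_bound cK cb b0.
exists (N * c ^+ 2) => n; rewrite linE.
apply: le_trans (sqn_fourier_lin_le cK KO hu Kc n csingle single0) _.
apply: (hN single c n c_ge0 _ single0); first by move=> j; exact: (ccont_cmeas (@csingle j)).
by move=> j x; rewrite /single; case: (j == k); rewrite ?hc// cmod0.
Qed.

End one_component.

(** At the origin the inverse of the norm is 0 by convention and the direction is the zero vector,
    not a unit vector. A [psi] vanishing off [K0oo] thus gives a multiplier vanishing at 0. *)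
Lemma not_K0oo_to_K0oo {R : realType} {d : nat} (xi : 'rV[R]_d) :
  enorm xi = 0 -> ~ K0oo (to_K0oo xi).
Proof.
move=> x0 [/= + _]; rewrite enormZ ?invr_ge0 ?enorm_ge0// x0 mulr0.
by move/esym/eqP; rewrite oner_eq0.
Qed.

Section limit_identity.
Context {R : realType} {d q r m : nat}.
Local Notation E := 'rV[R]_d.
Local Notation C := R[i].
Local Notation KT := (E * \bar R)%type.
Local Notation leb := (lebesgue_rV R d).
Variables (l : nat) (hl : (l <= m)%N) (Omega K : set E) (c0 : E) (u : nat -> E -> 'cV[C]_r).
Hypotheses (cK : compact K) (KO : K `<=` Omega) (hu : weakly_null_L2loc Omega u)
  (Kc : K `<=` unit_cube c0).
Variables (phi phi2 : E -> C) (Alim : multiindex d m -> E -> 'M[C]_(q, r)) (i : 'I_q) (j : 'I_r).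
Local Notation P := (fun a : multiindex d m => (l <= mlen a <= m)%N).
Let b (a : multiindex d m) k x : C := phi x * Alim a x i k.
Hypotheses (cb : forall a k, P a -> continuous (b a k : E -> C^o)).
Hypotheses (phi0 : forall x, ~ K x -> phi x = 0).
Hypotheses (cphi2 : continuous (phi2 : E -> C^o)) (phi20 : forall x, ~ K x -> phi2 x = 0).
Variables (omega : nat -> R) (omega0 : forall n, 0 < omega n) (kapl : nat -> R).
Variable mu : 'I_r -> 'I_r -> (E * KT -> C) -> C.
Hypothesis hmu : one_scale_Hmeasure Omega u omega mu.
Hypothesis Pl_null : enull (fun n => sqn leb (fun xi =>
  \sum_(a | P a) ((0 +i* (2 * pi)) ^+ mlen a * (kapl (mlen a) * weight l a (omega n *: xi))%:C) *
    fourier (lin u (fun k x => phi x * Alim a x i k) n) xi)).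
Variable psi : KT -> C.
Hypotheses (cpsi : C_K0oo psi) (psi0 : forall k, ~ K0oo k -> psi k = 0).

Let b0 a k x : ~ K x -> b a k x = 0.
Proof. by move=> /phi0 h; rewrite /b h mul0r. Qed.

Let coef (a : multiindex d m) : C := (0 +i* (2 * pi)) ^+ mlen a * (kapl (mlen a))%:C.
Let F n a k := fourier (fun x => b a k x * u n x k ord0).
Let F2 n := fourier (fun x => phi2 x * u n x j ord0).
Let ps n xi := psi (to_K0oo (omega n *: xi)).
Let pw (a : multiindex d m) kk : C := psi kk * (@weight_ext R d m l a kk)%:C.
Let S := Omega `*` @K0oo R d.

Let cpw a : C_K0oo (pw a).
Proof.
have h := within_ccont_real (@continuous_weight_ext R d m l a).
exact: (within_ccontM cpsi h).
Qed.

(** The weight is absorbed in [psi]: the product extends continuously to the compactification and is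
    itself admissible in the definition of the one-scale H-measure. *)
Let psE n a xi : P a -> ps n xi * (weight l a (omega n *: xi))%:C = pw a (to_K0oo (omega n *: xi)).
Proof.
move=> Pa; rewrite /ps /pw; have [x0|x0] := ltP 0 (enorm (omega n *: xi)).
  by rewrite -weight_ext_finite ?to_K0ooK//; exact: to_K0oo_finite.
rewrite psi0 ?mul0r//; apply: not_K0oo_to_K0oo.
by apply/le_anti; rewrite x0 enorm_ge0.
Qed.

Let ps_bounded : exists2 M : R, 0 <= M & forall n xi, cmod (ps n xi) <= M.
Proof.
have [M M0 hM] := bounded_C_K0oo cpsi; exists M => // n xi.
have [h|h] := pselect (K0oo (to_K0oo (omega n *: xi))); first exact: hM.
by rewrite /ps psi0// cmod0.
Qed.

Let cmeas_ps n : cmeas (ps n).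
Proof.
apply: (@cmeas_open_support _ _ [set xi : E | 0 < enorm xi]).
- rewrite (_ : [set _ | _] = (@enorm R d) @^-1` [set t | 0 < t])//.
  by apply: open_comp; [move=> ? _; exact: continuous_enorm|exact: open_gt].
- by move=> xi x0; exact: (continuous_comp_to_K0oo (omega0 n) cpsi x0).
move=> xi /negP; rewrite -leNgt => x0; rewrite /ps psi0//; apply: not_K0oo_to_K0oo.
by rewrite enormZ ?(ltW (omega0 n))// (_ : enorm xi = 0) ?mulr0//; apply/le_anti; rewrite x0 enorm_ge0.
Qed.

Let test n xi := conjc (F2 n xi) * ps n xi.

Let cmeas_test n : cmeas (test n).
Proof.
exact: (cmeasM (cmeasJ (cmeas_fourier_component cK KO hu j cphi2 phi20 n)) (cmeas_ps n)).
Qed.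

Let sqn_test : exists M : R, forall n, (sqn leb (test n) <= M%:E)%E.
Proof.
have [M hM] := sqn_fourier_component cK KO hu Kc j cphi2 phi20.
have [N N0 hN] := ps_bounded; exists (N ^+ 2 * M) => n.
have mF2 : cmeas (F2 n) by exact: (cmeas_fourier_component cK KO hu j cphi2 phi20 n).
apply: le_trans (_ : _ <= (N ^+ 2)%:E * sqn leb (F2 n))%E _.
  apply: le_sqn => //; first exact: sqr_ge0.
  move=> xi; rewrite cmodM cmodJ exprMn mulrC ler_wpM2r ?sqr_ge0//.
  by rewrite lerXn2r ?nnegrE ?cmod_ge0.
by rewrite [leRHS]EFinM lee_wpmul2l ?lee_fin ?sqr_ge0//; exact: hM.
Qed.

Let Pl n xi : C := \sum_(a | P a) coef a * (weight l a (omega n *: xi))%:C *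
  \sum_k F n a k xi.

Let F_cinteg n a k xi : P a ->
  cinteg leb (fun x => expi (- (2 * pi * dotr x xi)) * (b a k x * u n x k ord0)).
Proof.
by move=> Pa; exact: (cinteg_kernel xi (cinteg_component cK KO hu k (@cb a k Pa) (@b0 a k) n)).
Qed.

Let fourier_lin n a xi : P a ->
  fourier (lin u (fun k x => phi x * Alim a x i k) n) xi = \sum_k F n a k xi.
Proof.
move=> Pa; rewrite /F /fourier -!/(cI _ _).
rewrite -(cI_sum (index_enum _) (P := xpredT) (F := fun k x => expi (- (2 * pi * dotr x xi)) * (b
  a k x * u n x k ord0))).
  by apply: eq_cI => x; rewrite /lin mulr_sumr.
by move=> k _; exact: F_cinteg.
Qed.

Let term n a k xi := F n a k xi * conjc (F2 n xi) * pw a (to_K0oo (omega n *: xi)).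

Let term_cinteg n a k : P a -> cinteg leb (term n a k).
Proof.
move=> Pa; have mF : cmeas (F n a k) by exact: (cmeas_fourier_component cK KO hu k (@cb a k Pa)
  (@b0 a k) n).
have [M1 h1] := sqn_fourier_component cK KO hu Kc k (@cb a k Pa) (@b0 a k).
have [M2 h2] := sqn_test.
have h3 : cinteg leb (fun xi => F n a k xi * test n xi).
  apply: cinteg_mulJ => //.
    exact: le_lt_trans (h1 n) (ltry _).
  exact: le_lt_trans (h2 n) (ltry _).
have tE xi : term n a k xi = (weight l a (omega n *: xi))%:C * (F n a k xi * test n xi).
  by rewrite /term -psE// /test; ring.
have [mFt _] := (cintegP _ _).1 h3.
apply: (cinteg_le _ h3).
  rewrite (_ : term n a k = fun xi => (weight l a (omega n *: xi))%:C * (F n a k xi * test n xi)).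
    apply: cmeasM mFt; apply: cmeas_real.
    have me : measurable_fun [set: E] (fun xi => enorm (omega n *: xi)).
      under eq_fun do rewrite (enormZ _ (ltW (omega0 n))).
      by apply: measurable_funM => //; exact: continuous_measurable_rV (@continuous_enorm R d).
    apply: measurable_funM; last first.
      by apply: measurable_invr; apply: measurable_funD; exact: measurable_funX.
    under eq_fun do rewrite mpowZ.
    by apply: measurable_funM => //; exact: continuous_measurable_rV (@continuous_mpow R d m a).
  exact/funext.
move=> xi; rewrite tE cmodM cmod_real ler_piMl ?cmod_ge0//; exact: weight_le1.
Qed.

Let pairing n : cI leb (fun xi => Pl n xi * test n xi) =
  \sum_(a | P a) \sum_k coef a * cI leb (term n a k).
Proof.
transitivity (cI leb (fun xi => \sum_(a | P a) \sum_k coef a * term n a k xi)).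
  apply: eq_cI => xi; rewrite mulr_suml; apply: eq_bigr => a Pa.
  rewrite mulr_sumr mulr_suml; apply: eq_bigr => k _.
  by rewrite /term -psE// /test; ring.
rewrite cI_sum; last first.
  by move=> a Pa; apply: cinteg_sum => k _; apply: cintegZ; exact: term_cinteg.
apply: eq_bigr => a Pa; rewrite cI_sum; last by move=> k _; apply: cintegZ; exact: term_cinteg.
by apply: eq_bigr => k _; rewrite cIZ//; exact: term_cinteg.
Qed.

Let PlE n : (fun xi => \sum_(a | P a) ((0 +i* (2 * pi)) ^+ mlen a * (kapl (mlen a) * weight l a
  (omega n *: xi))%:C) *
    fourier (lin u (fun k x => phi x * Alim a x i k) n) xi) = Pl n.
Proof.
apply/funext => xi; apply: eq_bigr => a Pa; rewrite fourier_lin// /coef; congr (_ * _).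
by rewrite realcM mulrA.
Qed.

Let cmeas_Pl n : cmeas (Pl n).
Proof.
apply: cmeas_sum => a Pa; apply: cmeasM.
  apply: cmeasM; first exact: cmeas_cst.
  apply: cmeas_real.
  have me : measurable_fun [set: E] (fun xi => enorm (omega n *: xi)).
    under eq_fun do rewrite (enormZ _ (ltW (omega0 n))).
    by apply: measurable_funM => //; exact: continuous_measurable_rV (@continuous_enorm R d).
  apply: measurable_funM; last first.
    by apply: measurable_invr; apply: measurable_funD; exact: measurable_funX.
  under eq_fun do rewrite mpowZ.
  by apply: measurable_funM => //; exact: continuous_measurable_rV (@continuous_mpow R d m a).
by apply: cmeas_sum => k _; exact: (cmeas_fourier_component cK KO hu k (@cb a k Pa) (@b0 a k) n).
Qed.

(** AM-GM with weights [e^-1] on the vanishing factor and [e] on the bounded one. *)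
Let pairing_null : (fun n => cI leb (fun xi => Pl n xi * test n xi) : C^o) @ \oo --> (0 : C^o).
Proof.
have [M hM] := sqn_test.
have hP : enull (fun n => sqn leb (Pl n)).
  by apply: enull_le Pl_null; apply: nearW => n; rewrite PlE.
apply: (@ccvg_enull _ _ (fun n => (cmod (cI leb (fun xi => Pl n xi * test n xi)))%:E)).
  exact: nearW.
apply: (@enull_approx _ _ (fun n => sqn leb (test n))); first by exists M; exact: nearW.
move=> e e0; exists (fun n => (e^-1)%:E * sqn leb (Pl n))%E.
  by apply: enullZ => //; rewrite invr_ge0 ltW.
have := hP _ ltr01; apply: filterS => n hn.
rewrite -{2}(invrK e); apply: cmod_cI_mul_le; rewrite ?invr_gt0//.
- exact: le_lt_trans hn (ltry _).
- exact: le_lt_trans (hM n) (ltry _).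
Qed.

Let Phi a k (z : E * KT) : C := b a k z.1 * conjc (phi2 z.1) * pw a z.2.

Let Cc_Phi a k : P a -> Cc_on S (Phi a k).
Proof.
move=> Pa; have h1 := within_snd (Omega := Omega) (@cpw a).
have h2 : {within S, continuous ((fun z => conjc (phi2 z.1)) : E * KT -> C^o)}.
  exact: (within_fst (continuous_subspaceT (ccontJ cphi2))).
have := Cc_on_tensor cK KO (@cb a k Pa) (@b0 a k) (within_ccontM h2 h1).
by apply: Cc_on_eq => z _; rewrite /Phi mulrA.
Qed.

(** The definition gives [conj_measure (mu k j)], the components being paired in the order [k], [j];
    this is [mu j k] by hermitian symmetry, whence the transpose in the theorem. *)
Let limit_term a k : P a ->
  (fun n => cI leb (term n a k) : C^o) @ \oo --> (mu j k (Phi a k) : C^o).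
Proof.
move=> Pa; have [[_ hherm _] hlim] := hmu.
rewrite (hherm j k (Phi a k) (Cc_Phi k Pa)).
have h1 : Cc Omega (b a k) by split; [exact: cb|exists K; split=> //; exact: b0].
have h2 : Cc Omega phi2 by split=> //; exists K.
exact: hlim (b a k) phi2 (pw a) h1 h2 (@cpw a) k j.
Qed.

Let sum_zero : \sum_(a | P a) \sum_k coef a * mu j k (Phi a k) = 0.
Proof.
have h : (fun n => \sum_(a | P a) \sum_k coef a * cI leb (term n a k) : C^o) @ \oo -->
    (\sum_(a | P a) \sum_k coef a * mu j k (Phi a k) : C^o).
  apply: ccvg_sum => a Pa; apply: ccvg_sum => k _.
  have h1 : ((fun=> coef a) : nat -> C^o) @ \oo --> (coef a : C^o) by exact: ccvg_cst.
  have h2 : (fun n => cI leb (term n a k) : C^o) @ \oo --> (mu j k (Phi a k) : C^o) by exact: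
    limit_term.
  exact: ccvgM h1 h2.
move: pairing_null; rewrite (_ : (fun n => cI _ _) = fun n => \sum_(a | P a) \sum_k coef a * cI
  leb (term n a k)).
  move=> /ccvgP[h3 h4]; move: h => /ccvgP[h1 h2].
  by apply: complex_eqP; [exact: (cvg_unique _ h1 h3)|exact: (cvg_unique _ h2 h4)].
by apply/funext => n; exact: pairing.
Qed.

Lemma limit_identity : \sum_k mu j k (fun z =>
  (\sum_(a | P a) (coef a * (@weight_ext R d m l a z.2)%:C) * Alim a z.1 i k) *
  (phi z.1 * conjc (phi2 z.1) * psi z.2)) = 0.
Proof.
rewrite -[RHS]sum_zero exchange_big /=; apply: eq_bigr => k _.
have [[hrad _ _] _] := hmu.
rewrite -(radon_sum (hrad j k) (index_enum _) (fun a => coef a) (fun a Pa => Cc_Phi k Pa)).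
congr (mu j k _); apply/funext => z; rewrite mulr_suml; apply: eq_bigr => a _.
by rewrite /Phi /b /pw; ring.
Qed.

End limit_identity.

Lemma compact_finite_cover {T : ptopologicalType} (A : set T) (f : T -> set T) : compact A ->
  (forall x, A x -> open (f x)) -> (forall x, A x -> f x x) ->
  exists2 s : seq T, (forall x, x \in s -> A x) & forall y, A y -> exists2 x, x \in s & f x y.
Proof.
move=> cA of_ fxx; move: cA; rewrite compact_cover => /(_ T A f of_).
case=> [y Ay|D' DA hD]; first by exists y => //; exact: fxx.
exists (finmap.enum_fset D'); first by move=> x xD; have := DA x xD; rewrite inE.
by move=> y /hD [x xD fy]; exists x.
Qed.

(** * From tensor products to all test functions *)

Section boxes.
Context {R : realType} {d : nat}.
Local Notation E := 'rV[R]_d.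
Local Notation C := R[i].
Implicit Types (x y : E) (h : R).

Definition cbox x h : set E := [set y | forall i, `|y ord0 i - x ord0 i| <= h].

Lemma compact_cbox x h : compact (cbox x h).
Proof.
have := @rV_compact R d (fun i => `[x ord0 i - h, x ord0 i + h]%classic)
  (fun i => @segment_compact R (x ord0 i - h) (x ord0 i + h)).
congr compact; apply/seteqP; split=> y /= hy i; have := hy i.
  by rewrite in_itv /= ler_distl.
by rewrite in_itv /= ler_distl.
Qed.

Lemma nbhs_cbox x (U : set E) : nbhs x U -> exists2 h : R, 0 < h <= 2^-1 & cbox x h `<=` U.
Proof.
move=> /nbhs_ballP[e /= e0 eU]; exists (Num.min (e / 2) 2^-1).
  by rewrite ge_min lexx orbT andbT lt_min divr_gt0//= invr_gt0.
move=> y hy; apply: eU; split=> // i j; rewrite (ord1 i) /ball /= distrC.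
apply: le_lt_trans (hy j) _; rewrite (@le_lt_trans _ _ (e / 2))//; first by rewrite ge_min lexx.
by rewrite ltr_pdivrMr// ltr_pMr// ltr1n.
Qed.

Lemma cbox_nbhs x h : 0 < h -> nbhs x (cbox x h).
Proof.
move=> h0; apply/nbhs_ballP; exists h => //= y [_ hy] i; have := hy ord0 i.
by rewrite /ball /= distrC; exact: ltW.
Qed.

Lemma cbox_unit_cube x h : h <= 2^-1 -> cbox x h `<=` unit_cube (x - const_mx h).
Proof.
move=> h1 y hy i; have := hy i; rewrite ler_distl !mxE => /andP[h2 h3]; apply/andP; split; lra.
Qed.

Definition centered_bump x h y : R := box_bump (x - const_mx h) (2 * h) y.

Lemma centered_bump_eq0 x h y : 0 < h -> ~ cbox x h y -> centered_bump x h y = 0.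
Proof.
move=> h0 ny; apply: box_bump_eq0; first by rewrite mulr_gt0.
move=> hy; apply: ny => i; have := hy i; rewrite !mxE ler_distl => /andP[h2 h3].
by apply/andP; split; lra.
Qed.

Lemma centered_bump_gt0 x h : 0 < h -> 0 < centered_bump x h x.
Proof.
by move=> h0; apply: box_bump_gt0; [rewrite mulr_gt0|move=> i; rewrite !mxE; apply/andP; split; lra].
Qed.

Lemma continuous_centered_bump x h : continuous (centered_bump x h).
Proof. exact: continuous_box_bump. Qed.

Lemma csm_centered_bump k x h : csm k (fun y => (centered_bump x h y)%:C).
Proof. exact: csm_box_bump. Qed.

Lemma compact_neighbourhood (K Omega : set E) : open Omega -> compact K -> K `<=` Omega ->
  exists L, [/\ compact L, L `<=` Omega & forall x, K x -> nbhs x L].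
Proof.
move=> oO cK KO.
have hx x : exists h : R, K x -> 0 < h /\ cbox x h `<=` Omega.
  have [Kx|?] := pselect (K x); last by exists 0.
  have [|h /andP[h0 _] hO] := @nbhs_cbox x Omega; last by exists h.
  by apply: open_nbhs_nbhs; split=> //; exact: KO.
have [h {}hx] := choice hx.
have [||s sK sc] := @compact_finite_cover E K (fun x => (cbox x (h x))°) cK.
- by move=> x _; exact: open_interior.
- by move=> x /hx[h0 _]; exact: cbox_nbhs.
exists [set y | exists2 x, x \in s & cbox x (h x) y]; split.
- elim: (s) => [|x t ih].
    rewrite (_ : [set _ | _] = set0); first exact: compact0.
    by apply/seteqP; split=> // y [].
  rewrite (_ : [set _ | _] = cbox x (h x) `|` [set y | exists2 x, x \in t & cbox x (h x) y]).
    by apply: compactU => //; exact: compact_cbox.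
  apply/seteqP; split=> y /=.
    by move=> [z]; rewrite inE => /orP[/eqP ->|zt]; [left|right; exists z].
  by move=> [hy|[z zt hy]]; [exists x => //; rewrite mem_head|exists z => //; rewrite inE zt orbT].
- by move=> y [x /sK/hx[_ +]]; apply.
- by move=> y /sc[x xs xy]; apply: filterS xy => z zx; exists x.
Qed.

End boxes.

Section density.
Context {R : realType} {d : nat}.
Local Notation E := 'rV[R]_d.
Local Notation C := R[i].
Local Notation KT := (E * \bar R)%type.
Variables (Omega : set E) (oO : open Omega).
Local Notation S := (Omega `*` @K0oo R d).

Lemma within_slice (Phi : E * KT -> C) x : {within S, continuous (Phi : E * KT -> C^o)} ->
  Omega x -> C_K0oo (fun k => Phi (x, k)).
Proof.
move=> /subspace_continuousP h Ox; apply/subspace_continuousP => k Kk.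
have h0 : (fun k' : KT => x) @ nbhs k --> x by exact: cvg_cst.
have h1 : (fun k' : KT => (x, k')) @ nbhs k --> (x, k) by exact: (cvg_pair h0 cvg_id).
apply: cvg_trans (h (x, k) (conj Ox Kk)) => P hP.
by have := h1 _ hP; apply: (@filterS _ (nbhs k)) => k' /= h2 Kk'; exact: h2.
Qed.

(** A tube argument: the compactness of [K0oo] makes the neighbourhood of [x] independent of [k]. *)
Lemma uniform_slice (Phi : E * KT -> C) x (e : R) : {within S, continuous (Phi : E * KT -> C^o)} ->
  Omega x -> 0 < e -> \forall y \near x, Omega y -> forall k, K0oo k -> cmod (Phi (y,
    k) - Phi (x, k)) <= e.
Proof.
move=> /subspace_continuousP h Ox e0.
have cc := (compact_near_coveringP _).1 (@compact_K0oo R d).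
have H : forall k, K0oo k -> \forall k' \near k & y \near x,
    Omega y -> K0oo k' -> cmod (Phi (y, k') - Phi (x, k')) <= e.
  move=> k Kk; have e2 : 0 < e / 2 by rewrite divr_gt0.
  have /ccvg_cmodP/cvgrPdist_le/(_ _ e2) := h (x, k) (conj Ox Kk).
  case=> -[U V] /= [Ux Vk] hUV.
  exists (V, U) => // -[k' y] [/= Vk' Uy] Oy Kk'.
  have h1 := hUV (y, k') (conj Uy Vk') (conj Oy Kk').
  have h2 := hUV (x, k') (conj (nbhs_singleton Ux) Vk') (conj Ox Kk').
  move: h1 h2; rewrite /= !sub0r !normrN !ger0_norm ?cmod_ge0// => h1 h2.
  rewrite (_ : Phi (y, k') - Phi (x, k') = (Phi (y, k') - Phi (x, k)) - (Phi (x, k') - Phi (x,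
    k))); last by ring.
  by apply: le_trans (cmodD _ _) _; rewrite cmodN [e]splitr lerD.
have := cc E (nbhs x) (fun y k => Omega y -> K0oo k -> cmod (Phi (y, k) - Phi (x,
  k)) <= e) (nbhs_filter x) H.
by apply: filterS => y hy Oy k Kk; exact: hy.
Qed.

Variable nu : (E * KT -> C) -> C.
Hypothesis hnu : radon S nu.
Hypothesis nu0 : forall x h (phi2 : E -> C) (psi : KT -> C), 0 < h <= 2^-1 -> cbox x h `<=` Omega ->
  continuous (phi2 : E -> C^o) -> (forall y, ~ cbox x h y -> phi2 y = 0) -> C_K0oo psi ->
  nu (fun z => (centered_bump x h z.1)%:C * phi2 z.1 * psi z.2) = 0.

(* On the support of [Phi] the functions [eta^2 / max (sum eta^2, s0)] sum to [1];
   off it [Phi] vanishes, so there too the error only involves differences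
   [Phi (x, k) - Phi (x_i, k)]. *)
Theorem radon_density_eq0 (Phi : E * KT -> C) : Cc_on S Phi -> nu Phi = 0.
Proof.
move=> [cPhi [L [cL LS PL]]].
pose K := (fun z : E * KT => z.1) @` L.
have cK : compact K.
  by apply: continuous_compact cL; apply: continuous_subspaceT => z; exact: cvg_fst.
have KO : K `<=` Omega by move=> _ [z /LS[Oz _] <-].
(* All approximants are to be supported over this one compact set, so that the continuity constant
   [M] does not depend on [e]. *)
have [K' [cK' K'O KK']] := compact_neighbourhood oO cK KO.
have [_ /(_ (K' `*` @K0oo R d) (compact_setX cK' compact_K0oo) _)[|M hM]] := hnu.
  by move=> z [/K'O].
suff key : forall e : R, 0 < e -> cmod (nu Phi) <= M * e.
  apply: cmod_eq0; apply/le_anti; rewrite cmod_ge0 andbT.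
  have M0 : 0 <= M by have := key 1 ltr01; rewrite mulr1; apply: le_trans; exact: cmod_ge0.
  apply/ler_addgt0Pl => t t0; rewrite addr0.
  have M1 : 0 < M + 1 by rewrite ltr_wpDl.
  apply: le_trans (key _ (divr_gt0 t0 M1)) _.
  by rewrite mulrA ler_pdivrMr// mulrC ler_wpM2l ?(ltW t0)// lerDl.
move=> e e0.
have hx x : exists h : R, K x -> [/\ 0 < h <= 2^-1, cbox x h `<=` K' &
    forall y, cbox x h y -> forall k, K0oo k -> cmod (Phi (y, k) - Phi (x, k)) <= e].
  have [Kx|?] := pselect (K x); last by exists 0.
  have h1 := uniform_slice cPhi (KO _ Kx) e0.
  have [h h0 hU] := nbhs_cbox (filterI (KK' x Kx) h1).
  exists h => _; split=> // y /hU[] //= K'y hy k Kk; exact: hy (K'O _ K'y) k Kk.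
have [h {}hx] := choice hx.
pose eta x y := centered_bump x (h x) y.
(* Half the squared value at the centre, so that the open sets where [eta x ^+ 2] exceeds it cover
   [K]. With [s0] the least [c x] of a finite subcover, or 1 if smaller, the sum of squares is at
   least [s0] on [K], where the maximum in [mx] is therefore inactive. *)
pose c x := eta x x ^+ 2 / 2.
have c0 x : K x -> 0 < c x.
  by move=> /hx[/andP[h0 _] _ _]; rewrite divr_gt0// exprn_gt0// centered_bump_gt0.
have ceta x : continuous (fun y => eta x y ^+ 2) by apply: contX; exact: continuous_centered_bump.
have [||s sK sc] := @compact_finite_cover E K (fun x => [set y | c x < eta x y ^+ 2]) cK.
- move=> x _; rewrite (_ : [set _ | _] = (fun y => eta x y ^+ 2) @^-1` [set t | c x < t])//.
  by apply: open_comp; [move=> ? _; exact: ceta|exact: open_gt].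
- move=> x Kx /=; rewrite /c ltr_pdivrMr// ltr_pMr ?ltr1n// exprn_gt0// centered_bump_gt0//.
  by have [/andP[]] := hx x Kx.
pose s0 := \big[Num.min/1]_(x <- s) c x.
have s0_gt0 : 0 < s0.
  rewrite /s0 big_seq; elim/big_ind: _ => // [a b a0 b0|x /sK]; first by rewrite lt_min a0.
  exact: c0.
have s0_le x : x \in s -> s0 <= c x.
  rewrite /s0; elim: (s) => //= y t ih; rewrite inE big_cons ge_min => /orP[/eqP ->|/ih ->].
    by rewrite lexx.
  by rewrite orbT.
pose sg y := \sum_(x <- s) eta x y ^+ 2.
pose mx y := Num.max (sg y) s0.
have mx0 y : 0 < mx y by rewrite lt_max s0_gt0 orbT.
have csg : continuous sg by apply: cont_sum => x _; exact: ceta.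
have cmx : continuous mx.
  by move=> y; apply: continuous_max; [exact: csg|exact: cst_continuous].
have sg1 y : K y -> mx y = sg y.
  move=> /sc[x xs /= hxy]; rewrite /mx max_l//.
  apply: le_trans (s0_le x xs) _; apply: le_trans (ltW hxy) _.
  rewrite /sg (perm_big _ (perm_to_rem xs)) big_cons lerDl.
  by apply: sumr_ge0 => ? _; rewrite sqr_ge0.
(* The square in the partition of unity is shared out: one factor [eta] is the smooth bump required
   by [nu0], the other goes into [phi2], which need only be continuous. *)
pose phi2 x y : C := (eta x y / mx y)%:C.
have cphi2 x : continuous (phi2 x : E -> C^o).
  apply: ccont_real; apply: contM; first exact: continuous_centered_bump.
  move=> y; have my : mx y != 0 by rewrite gt_eqF.
  exact: (cvgV my (@cmx y)).
have eta0 x y : x \in s -> ~ cbox x (h x) y -> eta x y = 0.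
  by move=> /sK/hx[/andP[h0 _] _ _] ny; exact: centered_bump_eq0.
pose Psi z : C := \sum_(x <- s) 1 * ((centered_bump x (h x) z.1)%:C * phi2 x z.1 * Phi (x, z.2)).
pose T (x : E) (z : E * KT) : C := (centered_bump x (h x) z.1)%:C * phi2 x z.1 * Phi (x, z.2).
have cT x : x \in s -> Cc_on S (T x).
  move=> xs; have [/andP[h0 _] hK' _] := hx x (sK x xs).
  have h1 := within_snd (Omega := Omega) (within_slice cPhi (KO _ (sK _ xs))).
  have cb : continuous ((fun y => (centered_bump x (h x) y)%:C * phi2 x y) : E -> C^o).
    by apply: ccontM (cphi2 x); apply: ccont_real; exact: continuous_centered_bump.
  have b0 y : ~ cbox x (h x) y -> (centered_bump x (h x) y)%:C * phi2 x y = 0.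
    by move=> /(centered_bump_eq0 h0) ->; rewrite mul0r.
  exact: (Cc_on_tensor (@compact_cbox _ _ x (h x)) (fun y hy => K'O _ (hK' y hy)) cb b0 h1).
have T0 x : x \in s -> nu (T x) = 0.
  move=> xs; have [h0 hK' _] := hx x (sK x xs).
  apply: (nu0 h0 _ (cphi2 x) _ (within_slice cPhi (KO _ (sK _ xs)))).
    by move=> y /hK'/K'O.
  by move=> y ny; rewrite /phi2 eta0// mul0r.
have cPsi : Cc_on S Psi.
  rewrite /Psi; under eq_fun do rewrite big_seq_cond.
  apply: Cc_on_sum => x /andP[xs _]; apply: Cc_on_mul; first exact: within_ccont_cst.
  exact: cT.
have Psi0 : nu Psi = 0.
  rewrite /Psi; under eq_fun do rewrite big_seq_cond.
  rewrite (radon_sum hnu s (P := fun x => (x \in s) && true) (fun=> 1) (Phi := T)).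
    by rewrite big1// => x /andP[xs _]; rewrite T0// mulr0.
  by move=> x /andP[xs _]; exact: cT.
have CcPhi : Cc_on S Phi by split=> //; exists L.
have -> : nu Phi = nu (fun z => -1 * Psi z + Phi z).
  by rewrite (radonB hnu)// Psi0 oppr0 add0r.
have dE z : S z -> -1 * Psi z + Phi z =
    \sum_(x <- s) (eta x z.1 ^+ 2 / mx z.1)%:C * (Phi z - Phi (x, z.2)).
  move=> Sz; have PE : \sum_(x <- s) (eta x z.1 ^+ 2 / mx z.1)%:C * Phi z = Phi z.
    rewrite -mulr_suml; have [Kz|nKz] := pselect (K z.1).
      rewrite -raddf_sum /= -mulr_suml -/(sg z.1) -(sg1 _ Kz) mulfV ?mul1r//.
      by rewrite gt_eqF.
    rewrite PL ?mulr0// => Lz; apply: nKz; by exists z.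
  rewrite mulN1r addrC -{1}PE /Psi -sumrB; apply: eq_bigr => x _.
  rewrite mul1r /phi2 -realcM mulrBr; congr (_ - _%:C * _).
  by rewrite mulrA expr2.
apply: hM.
- exact: (@Cc_onB R _ S Psi Phi cPsi CcPhi).
- move=> z Sz nz; rewrite dE// big_seq big1// => x xs.
  have [_ hK' _] := hx x (sK x xs).
  rewrite eta0 ?expr0n ?mul0r ?mul0r// => hz; apply: nz; split; first exact: hK'.
  by have [] := Sz.
move=> z [K'z Kz]; rewrite dE; last by split=> //; exact: K'O.
apply: le_trans (cmod_sum _ _ _) _.
apply: (@le_trans _ _ (\sum_(x <- s) eta x z.1 ^+ 2 / mx z.1 * e)).
  rewrite [leLHS]big_seq [leRHS]big_seq; apply: ler_sum => x xs.
  have w0 : 0 <= eta x z.1 ^+ 2 / mx z.1 by rewrite divr_ge0 ?sqr_ge0// ltW.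
  rewrite cmodM cmod_real ger0_norm//.
  have [hz|/(eta0 _ _ xs) ->] := pselect (cbox x (h x) z.1); last by rewrite expr0n /= !mul0r.
  have [_ _ hP] := hx x (sK x xs); rewrite ler_wpM2l//.
  by have := hP z.1 hz z.2 Kz; case: (z).
rewrite -mulr_suml ler_piMl ?(ltW e0)// -mulr_suml ler_pdivrMr// mul1r.
by rewrite /mx le_max lexx.
Qed.

End density.

(** * Annihilation of the measure by the symbol, and the three cases *)

Section symbol_measure.
Context {R : realType}.
Local Notation C := R[i].

(** Only the sum over [k] vanishes on tensor products, not its terms, so the density argument must
    be applied to the whole entry as one Radon functional. *)
Lemma radon_mul_sum {T : topologicalType} (r : nat) (S : set T) (mu : 'I_r -> (T -> C) -> C)
    (g : 'I_r -> T -> C) : (forall k, radon S (mu k)) ->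
  (forall k, {within S, continuous (g k : T -> C^o)}) ->
  radon S (fun Phi => \sum_k mu k (fun z => g k z * Phi z)).
Proof.
move=> hmu cg; split=> [a Phi1 Phi2 c1 c2|L cL LS].
  rewrite mulr_sumr -big_split /=; apply: eq_bigr => k _.
  have [lin _] := hmu k; rewrite -lin; try exact: Cc_on_mul.
  by congr (mu k _); apply/funext => z; rewrite mulrDr mulrCA.
have /choice[M hM] : forall k, exists M : R, forall Phi (B : R), Cc_on S Phi ->
    supported_in S L Phi -> (forall z, L z -> cmod (Phi z) <= B) -> cmod (mu k Phi) <= M * B.
  by move=> k; have [_ h] := hmu k; exact: h.
have /choice[c hc] : forall k, exists c : R, 0 <= c /\ forall z, L z -> cmod (g k z) <= c.
  move=> k; have : compact ((fun z => cmod (g k z)) @` L).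
    apply: continuous_compact cL; apply: cont_cmod; exact: continuous_subspaceW LS (cg k).
  move=> /compact_bounded[N [_ hN]]; exists (`|N| + 1); split; first by rewrite addr_ge0.
  move=> z Lz; rewrite (le_trans (ler_norm _))//; apply: hN; last by exists z.
  by rewrite (le_lt_trans (ler_norm N))// ltrDl.
exists (\sum_k M k * c k) => Phi B cP sP hB.
apply: le_trans (cmod_sum _ _ _) _; rewrite mulr_suml; apply: ler_sum => k _.
rewrite -mulrA; have [c0 hck] := hc k; apply: hM.
- exact: Cc_on_mul.
- by move=> z Sz nL; rewrite sP// mulr0.
by move=> z Lz; rewrite cmodM ler_pM ?cmod_ge0//; [exact: hck|exact: hB].
Qed.

Lemma locally_uniform_limit_continuous {d : nat} (Omega : set 'rV[R]_d) (F : nat -> 'rV[R]_d -> C)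
    (G : 'rV[R]_d -> C) : open Omega ->
  (forall n, {within Omega, continuous (F n : 'rV[R]_d -> C^o)}) ->
  locally_uniform_cvg Omega F G -> {within Omega, continuous (G : 'rV[R]_d -> C^o)}.
Proof.
move=> oO cF FG; apply/subspace_continuousP => x Ox.
have [|h /andP[h0 _] hO] := @nbhs_cbox R d x Omega; first exact: open_nbhs_nbhs.
apply/ccvg_cmodP; apply/cvgrPdist_le => e e0.
have e3 : 0 < e / 3 by rewrite divr_gt0.
have [N _ hN] := locally_uniform_cmod (@compact_cbox _ _ x h) hO FG e3.
have {}hN y : cbox x h y -> cmod (F N y - G y) < e / 3 by exact: (hN N (leqnn N)).
have /subspace_continuousP/(_ x Ox)/ccvg_cmodP/cvgrPdist_le/(_ _ e3) := cF N.
have hx : (within Omega (nbhs x)) (cbox x h) by apply: (@filterS _ (nbhs x) _ (cbox x h));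
  [move=> y hy _|exact: cbox_nbhs].
apply: filterS2 hx => y hy; rewrite !sub0r !normrN !ger0_norm ?cmod_ge0// => h1.
rewrite (_ : G y - G x = - (F N y - G y) + (F N y - F N x) + (F N x - G x)); last by ring.
apply: le_trans (cmodD _ _) _; apply: le_trans (lerD (cmodD _ _) (lexx _)) _.
have := hN y hy; have := hN x (nbhs_singleton (cbox_nbhs x h0)); rewrite cmodN; lra.
Qed.

Lemma cvg_bounded_seq (a : nat -> R) (b : R) : a @ \oo --> b -> exists M : R, forall n, a n <= M.
Proof.
move=> ab; have /cvg_seq_bounded[M [_ hM]] : cvgn a by apply/cvg_ex; exists b.
exists (`|M| + 1) => n; apply: le_trans (ler_norm _) _; apply: hM => //.
by rewrite (le_lt_trans (ler_norm M))// ltrDl.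
Qed.

Section annihilation.
Context {d q r m : nat}.
Local Notation E := 'rV[R]_d.
Local Notation KT := (E * \bar R)%type.
Variables (l : nat) (hl : (l <= m)%N) (Omega : set E) (oO : open Omega)
  (u : nat -> E -> 'cV[C]_r) (hu : weakly_null_L2loc Omega u).
Variables (A : nat -> multiindex d m -> E -> 'M[C]_(q, r))
  (Alim : multiindex d m -> E -> 'M[C]_(q, r)).
Hypothesis hA : forall n a, (l <= mlen a <= m)%N -> forall i k,
    {within Omega, continuous (fun x => A n a x i k : C^o)}.
Hypothesis hAlim : forall a, (l <= mlen a <= m)%N -> forall i k,
    locally_uniform_cvg Omega (fun n x => A n a x i k) (fun x => Alim a x i k).
Variables (eps omega lam : nat -> R) (f : nat -> 'I_q -> (E -> C) -> C).
Hypotheses (eps0 : forall n, 0 < eps n) (omega0 : forall n, 0 < omega n)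
  (lam0 : forall n, 0 <= lam n).
Hypothesis hf0 : weighted_null Omega l m eps f.
Hypothesis hpde : forall n i theta, Ccinf Omega theta ->
    \sum_(a : multiindex d m | (l <= mlen a <= m)%N)
      (eps n ^+ (mlen a - l))%:C *
      dist_partial a (dist_of_fun (fun x => (A n a x *m u n x) i ord0)) theta
    = f n i theta.
Variable mu : 'I_r -> 'I_r -> (E * KT -> C) -> C.
Hypothesis hmu : one_scale_Hmeasure Omega u omega mu.
Variable kapl : nat -> R.
Hypothesis kaplim : forall s, (l <= s <= m)%N ->
  (fun n => lam n * (eps n / omega n) ^+ (s - l)) @ \oo --> kapl s.

Local Notation S := (Omega `*` @K0oo R d).

(** Common form of the three symbols: the values of [kapl] decide which degrees survive. *)
Let sym i k (z : E * KT) : C := \sum_(a : multiindex d m | (l <= mlen a <= m)%N)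
  ((0 +i* (2 * pi)) ^+ mlen a * (kapl (mlen a))%:C * (@weight_ext R d m l a z.2)%:C) * Alim a z.1 i k.

Let cAlim a i k : (l <= mlen a <= m)%N -> {within Omega, continuous (fun x => Alim a x i k : C^o)}.
Proof.
move=> Pa; apply: (locally_uniform_limit_continuous oO (F := fun n x => A n a x i k)).
  by move=> n; exact: hA.
exact: hAlim.
Qed.

Let csym i k : {within S, continuous (sym i k : E * KT -> C^o)}.
Proof.
apply: within_ccont_sum => a Pa.
have h1 := within_fst (@cAlim a i k Pa).
have h2 := within_snd (Omega := Omega) (within_ccont_real (@continuous_weight_ext R d m l a)).
apply: within_ccontM; last exact: h1.
by apply: within_ccontM; [exact: within_ccont_cst|exact: h2].
Qed.

Let kap_bounded : exists B : R, forall n s, (l <= s <= m)%N ->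
  lam n * (eps n / omega n) ^+ (s - l) <= B.
Proof.
have /choice[M hM] : forall s, exists M : R, (l <= s <= m)%N ->
    forall n, lam n * (eps n / omega n) ^+ (s - l) <= M.
  move=> s; case Ps: (l <= s <= m)%N; last by exists 0.
  by have [M hM] := cvg_bounded_seq (kaplim Ps); exists M.
exists (\sum_(s < m.+1) `|M s|) => n s Ps; have /andP[_ sm] := Ps.
apply: le_trans (hM s Ps n) _; apply: le_trans (ler_norm _) _.
by rewrite (bigD1 (Ordinal (sm : (s < m.+1)%N)))//= lerDl sumr_ge0.
Qed.

Lemma symbol_annihilates i j (Phi : E * KT -> C) : Cc_on S Phi ->
  \sum_k mu j k (fun z => sym i k z * Phi z) = 0.
Proof.
move=> cPhi; have [[hrad _ _] _] := hmu.
have hnu := radon_mul_sum (hrad j) (fun k => @csym i k).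
apply: (radon_density_eq0 oO hnu) cPhi => x h phi2 psi /andP[h0 h1] hO cphi2 phi20 cpsi.
have cK := @compact_cbox R d x h.
have Kc := @cbox_unit_cube R d x h h1.
pose phi y : C := (centered_bump x h y)%:C.
have phi0 y : ~ cbox x h y -> phi y = 0 by move=> /(centered_bump_eq0 h0) h2; rewrite /phi h2.
have cphi : continuous (phi : E -> C^o) by apply: ccont_real; exact: continuous_centered_bump.
have [B hB] := kap_bounded.
have Pl_null := principal_part_null hl oO cK hO hu Kc (fun k => @csm_centered_bump R d k x h) phi0
  i hA hAlim eps0 omega0 lam0 hB hf0 hpde kaplim.
have cb a k : (l <= mlen a <= m)%N -> continuous ((fun y => phi y * Alim a y i k) : E -> C^o).
  by move=> Pa; exact: (continuous_mul_local oO cK hO cphi phi0 (@cAlim a i k Pa)).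
(* Fixes the value read at [xi = 0], which [C_K0oo] leaves arbitrary. *)
pose psi' k : C := if pselect (K0oo k) then psi k else 0.
have psiE k : K0oo k -> psi k = psi' k by rewrite /psi'; case: pselect.
have cpsi' : C_K0oo psi' by exact: within_ccont_eq psiE cpsi.
have psi'0 k : ~ K0oo k -> psi' k = 0 by rewrite /psi'; case: pselect.
(* The second cut-off enters the H-measure conjugated, so the identity is applied to the conjugate
   of [phi2]. *)
have cJ : continuous ((fun y => conjc (phi2 y)) : E -> C^o) by exact: (ccontJ cphi2).
have J0 y : ~ cbox x h y -> conjc (phi2 y) = 0 by move=> /phi20 ->; rewrite conjc0.
have id0 := limit_identity hl cK hO hu Kc j cb phi0 cJ J0 omega0 hmu Pl_null cpsi' psi'0.
have cb2 : continuous ((fun y => phi y * phi2 y) : E -> C^o) by exact: (ccontM cphi cphi2).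
have b20 y : ~ cbox x h y -> phi y * phi2 y = 0 by move=> /phi0 ->; rewrite mul0r.
have c1 := Cc_on_tensor cK hO cb2 b20 (within_snd (Omega := Omega) cpsi).
have c2 := Cc_on_tensor cK hO cb2 b20 (within_snd (Omega := Omega) cpsi').
rewrite -[RHS]id0; transitivity (\sum_k mu j k (fun z => sym i k z * (phi z.1 * phi2 z.1 * psi' z.2))).
  by apply: (radon_eq hnu c1 c2) => z [_ Kz]; rewrite psiE.
by apply: eq_bigr => k _; congr (mu j k _); apply/funext => z; rewrite conjcK.
Qed.

(** [lo] and [hi] bound the degrees that survive in the limit. The two symbols agree only on [Omega]
    times [K0oo], where [weight_ext] is the extension by continuity; elsewhere their values do not
    affect [mu]. *)
Lemma symbol_measure_eq0 (lo hi : nat) (c : R) : (l <= lo)%N -> (hi <= m)%N ->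
  (forall s, (l <= s <= m)%N -> kapl s = if (lo <= s <= hi)%N then c ^+ s else 0) ->
  mul_tr_measure_eq0 Omega (symbol l lo hi c Alim) mu.
Proof.
move=> llo him kE i j Phi cPhi; have [[hrad _ _] _] := hmu.
rewrite -[RHS](symbol_annihilates i j cPhi); apply: eq_bigr => k _.
have cs : Cc_on S (fun z => sym i k z * Phi z) by exact: Cc_on_mul (@csym i k) cPhi.
have sE z : S z -> sym i k z * Phi z = symbol l lo hi c Alim z.1 z.2 i k * Phi z.
  move=> [_ Kz]; congr (_ * _); rewrite /symbol summxE [RHS]big_mkcond /sym [LHS]big_mkcond /=.
  apply: eq_bigr => a _; case Pa: (l <= mlen a <= m)%N.
    rewrite kE//; case: ifP => // _; last by rewrite mulr0 !mul0r.
    rewrite mxE extend_weight//; congr (_ * _ * _); rewrite realcX -exprMn; congr (_ ^+ _).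
    by apply: complex_eqP; rewrite ?reM ?imM /=; ring.
  case: ifP => // /andP[la ah].
  by move: Pa; rewrite (leq_trans llo la) (leq_trans ah him).
apply/esym/(radon_eq (hrad j k) cs) => //.
exact: Cc_on_eq sE cs.
Qed.

End annihilation.

End symbol_measure.

Theorem theorem10 (R : realType) (d q r m l : nat) (hl : (l <= m)%N)
  (Omega : set 'rV[R]_d) (hOmega : open Omega)
  (u : nat -> 'rV[R]_d -> 'cV[R[i]]_r) (hu : weakly_null_L2loc Omega u)
  (eps : nat -> R) (heps : forall n, 0 < eps n)
  (heps_bounded : exists M : R, forall n, eps n <= M)
  (A : nat -> multiindex d m -> 'rV[R]_d -> 'M[R[i]]_(q, r))
  (Alim : multiindex d m -> 'rV[R]_d -> 'M[R[i]]_(q, r))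
  (hA : forall n a, (l <= mlen a <= m)%N -> forall i k,
    {within Omega, continuous (fun x => A n a x i k : R[i]^o)})
  (hAlim : forall a, (l <= mlen a <= m)%N -> forall i k,
    locally_uniform_cvg Omega (fun n x => A n a x i k) (fun x => Alim a x i k))
  (f : nat -> 'I_q -> ('rV[R]_d -> R[i]) -> R[i])
  (hf : forall n i, Hneg_loc Omega m (f n i))
  (hf0 : weighted_null Omega l m eps f)
  (hpde : forall n i theta, Ccinf Omega theta ->
    \sum_(a : multiindex d m | (l <= mlen a <= m)%N)
      (eps n ^+ (mlen a - l))%:C *
      dist_partial a (dist_of_fun (fun x => (A n a x *m u n x) i ord0)) theta
    = f n i theta)
  (omega : nat -> R) (homega : forall n, 0 < omega n)
  (homega0 : omega @ \oo --> 0)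
  (c : \bar R) (hc : (fun n => (eps n / omega n)%:E) @ \oo --> c)
  (sigma : nat -> nat) (hsigma : {homo sigma : n1 n2 / (n1 < n2)%N})
  (mu : 'I_r -> 'I_r -> ('rV[R]_d * ('rV[R]_d * \bar R) -> R[i]) -> R[i])
  (hmu : one_scale_Hmeasure Omega (u \o sigma) (omega \o sigma) mu) :
  [/\ c = 0%E -> mul_tr_measure_eq0 Omega (symbol l l l 1 Alim) mu,
      forall c0 : R, 0 < c0 -> c = c0%:E ->
        mul_tr_measure_eq0 Omega (symbol l l m c0 Alim) mu &
      c = +oo%E -> mul_tr_measure_eq0 Omega (symbol l m m 1 Alim) mu].
Proof.
have sge n : (n <= sigma n)%N.
  by elim: n => // n ih; exact: leq_ltn_trans ih (hsigma _ _ (ltnSn n)).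
have scvg : sigma @ \oo --> \oo.
  by move=> B [N _ hN]; exists N => // n Nn; apply: hN; exact: leq_trans Nn (sge n).
have hu' : weakly_null_L2loc Omega (u \o sigma).
  have [h1 h2] := hu; split=> [n|K v cK KO vL v0]; first exact: h1.
  exact: (cvg_comp _ _ scvg (h2 K v cK KO vL v0)).
have hf0' : weighted_null Omega l m (eps \o sigma) (f \o sigma).
  move=> phi /hf0[g [hg g0]]; exists (g \o sigma); split; first by move=> n; exact: hg.
  exact: (cvg_comp _ _ scvg g0).
have hAlim' a : (l <= mlen a <= m)%N -> forall i k,
    locally_uniform_cvg Omega (fun n x => A (sigma n) a x i k) (fun x => Alim a x i k).
  by move=> Pa i k K cK KO; exact: (cvg_comp _ _ scvg (hAlim a Pa i k K cK KO)).
have hc' := cvg_comp _ _ scvg hc.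
have eps0 n : 0 < (eps \o sigma) n by exact: heps.
have omega0 n : 0 < (omega \o sigma) n by exact: homega.
pose t n := eps (sigma n) / omega (sigma n).
have t0 n : 0 < t n by rewrite divr_gt0.
have main := @symbol_measure_eq0 R d q r m l hl Omega hOmega (u \o sigma) hu'
  (fun n => A (sigma n)) Alim (fun n => hA (sigma n)) hAlim' (eps \o sigma) (omega \o sigma) _
  (f \o sigma) eps0 omega0 _ hf0' (fun n => hpde (sigma n)) mu hmu.
have cvgX (s : nat -> R) (b : R) k : s @ \oo --> b -> (fun n => s n ^+ k) @ \oo --> b ^+ k.
  move=> sb; have ci : continuous (fun x : R => x) by move=> ?; exact: cvg_id.
  exact: (cvg_comp s (fun x : R => x ^+ k) sb (@contX R R k id ci b)).
split=> [c0|c0 c0_gt0 cE|coo].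
- have tl : t @ \oo --> (0 : R) by move: hc'; rewrite c0 => /fine_cvgP[_].
  (* As [0 ^+ 0 = 1], only the degree [l] keeps a non-zero limit. *)
  apply: (main (fun=> 1) (fun=> ler01) (fun s => (0 : R) ^+ (s - l))) => // [s /andP[ls sm]|s /andP[ls sm]].
    by under eq_fun do rewrite mul1r; exact: cvgX.
  by rewrite expr1n expr0n subn_eq0 ls /=; case: (leqP s l).
- have tl : t @ \oo --> c0 by move: hc'; rewrite cE => /fine_cvgP[_].
  have c00 : 0 <= c0 ^+ l by rewrite exprn_ge0// ltW.
  (* The factor [c0 ^+ l] turns the limits [c0 ^+ (s - l)] into the powers [c0 ^+ s] of the
     symbol. *)
  apply: (main (fun=> c0 ^+ l) (fun=> c00) (fun s => c0 ^+ l * c0 ^+ (s - l))) => // [s _|s /andP[ls sm]].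
    by apply: cvgM; [exact: cvg_cst|exact: cvgX].
  by rewrite ls sm -exprD subnKC.
have tl : (fun n => (t n)^-1) @ \oo --> (0 : R).
  apply/cvgrPdist_le => e e0; move: hc'; rewrite coo => /cvgeryP/cvgryPge/(_ e^-1).
  apply: filterS => n hn; rewrite sub0r normrN ger0_norm ?invr_ge0 ?(ltW (t0 n))//.
  by rewrite -[leRHS]invrK lef_pV2 ?posrE ?invr_gt0.
(* Dividing by the largest coefficient [t^(m-l)] leaves [t^-(m-s)] in degree [s], which tends to 0
   unless [s = m]. *)
apply: (main (fun n => (t n)^-1 ^+ (m - l)) _ (fun s => (0 : R) ^+ (m - s))) => // [n|s /andP[ls sm]|s /andP[ls sm]].
- by rewrite exprn_ge0// invr_ge0 ltW.
- rewrite (_ : (fun n => _) = fun n => (t n)^-1 ^+ (m - s)); first exact: cvgX.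
  apply/funext => n; rewrite -/(t n).
  have tn : t n != 0 by rewrite gt_eqF.
  have -> : (m - l)%N = ((m - s) + (s - l))%N by rewrite addnBA// subnK.
  by rewrite exprD -mulrA -exprMn mulVf// expr1n mulr1.
rewrite expr1n expr0n subn_eq0 sm andbT.
by case: (leqP m s).
Qed.
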